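(* Let $H \in \mathcal{H}_2^{n_o \times n_i}$ and let $\Sigma_{\mathrm{D\text{-}SO}}$ be the set of second-order models $(\hat E, \hat K, \hat B, \hat C)$ such that $\hat E, \hat K \in \mathbb{R}^{r \times r}$ are diagonal, $\lambda^2 \hat I + \lambda \hat E + \hat K$ has all of its eigenvalues in $\mathbb{C}_-$, $\hat B \in \mathbb{R}^{r \times n_i}$, and $\hat C \in \mathbb{R}^{n_o \times r}$. Let $(\hat E, \hat K, \hat B, \hat C)$ be $\mathcal{H}_2$-optimal for $H$ in $\Sigma_{\mathrm{D\text{-}SO}}$. Let $\Lambda^+ = \operatorname{diag}(\lambda_i^+)$ and $\Lambda^- = \operatorname{diag}(\lambda_i^-)$ be complex diagonal matrices such that $\hat E = -(\Lambda^+ + \Lambda^-)$ and $\hat K = \Lambda^+ \Lambda^-$, and let all $\lambda_i^+$ and $\lambda_j^-$ be pairwise distinct. Define $c_i = \hat C e_i$ and $b_i = \hat B^{\mathrm{T}} e_i$. Then the transfer function $\hat H$ of $(\hat E, \hat K, \hat B, \hat C)$ can be written as $$\hat H(s) = \hat C \bigl( s^2 \hat I + s \hat E + \hat K \bigr)^{-1} \hat B = \sum_{i=1}^{r} \frac{c_i b_i^{\mathrm{T}}}{(s - \lambda_i^+)(s - \lambda_i^-)}$$ and it satisfies, for $i = 1, 2, \dots, r$, $$\Bigl( H\bigl(-\overline{\lambda_i^+}\bigr) - H\bigl(-\overline{\lambda_i^-}\bigr) \Bigr) b_i = \Bigl( \hat H\bigl(-\overline{\lambda_i^+}\bigr) -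 \hat H\bigl(-\overline{\lambda_i^-}\bigr) \Bigr) b_i,$$ $$c_i^{\mathrm{T}} \Bigl( H\bigl(-\overline{\lambda_i^+}\bigr) - H\bigl(-\overline{\lambda_i^-}\bigr) \Bigr) = c_i^{\mathrm{T}} \Bigl( \hat H\bigl(-\overline{\lambda_i^+}\bigr) - \hat H\bigl(-\overline{\lambda_i^-}\bigr) \Bigr),$$ $$c_i^{\mathrm{T}} H'\bigl(-\overline{\lambda_i^+}\bigr) b_i = c_i^{\mathrm{T}} \hat H'\bigl(-\overline{\lambda_i^+}\bigr) b_i,$$ $$c_i^{\mathrm{T}} H'\bigl(-\overline{\lambda_i^-}\bigr) b_i = c_i^{\mathrm{T}} \hat H'\bigl(-\overline{\lambda_i^-}\bigr) b_i.$$
   Context: $n_o, n_i, r$ are positive integers; $\boldsymbol{\imath}$ is the imaginary unit; $\mathbb{C}_+$, $\mathbb{C}_-$ are the open right and left half-planes; $\hat I$ is the $r \times r$ identity; $e_i$ is the $i$th canonical basis vector. A second-order model $(\hat E, \hat K, \hat B, \hat C)$ is the system $\ddot{\hat x}(t) + \hat E \dot{\hat x}(t) + \hat K \hat x(t) = \hat B u(t)$, $\hat y(t) = \hat C \hat x(t)$, with transfer function $\hat H(s) = \hat C (s^2 \hat I + s \hat E + \hat K)^{-1} \hat B$. The eigenvalues of $\lambda^2 \hat I + \lambda \hat E + \hat K$ are the $\lambda \in \mathbb{C}$ at which this matrix is singular. $\mathcal{H}_2^{n_o \times n_i}$ is the Hardy space of $\mathbb{C}^{n_o \times n_i}$-valued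 functions analytic on $\mathbb{C}_+$ with finite $\mathcal{H}_2$ norm, where $\|F\|_{\mathcal{H}_2}^2 = \frac{1}{2\pi} \int_{-\infty}^{\infty} \|F(\boldsymbol{\imath}\omega)\|_F^2 \, d\omega$ (boundary values on the imaginary axis). A model is $\mathcal{H}_2$-optimal for $H$ in a set of models if its transfer function $\hat H$ minimizes $\|H - \hat H\|_{\mathcal{H}_2}$ over that set.
   Formalization: H is additionally assumed real, i.e. H(conj s) = conj(H(s)) on the open right half-plane; without this the claim fails, e.g. for H(s) = 1/((s+1)(s+2)) + i/(s+1) with n_o = n_i = r = 1. *)

(* Defs.v *)
From HB Require Import structures.
From mathcomp Require Import all_boot all_order all_algebra.
From mathcomp Require Import all_classical all_reals all_analysis.
From mathcomp Require Import complex.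

Set Implicit Arguments.
Unset Strict Implicit.
Unset Printing Implicit Defensive.

Import Order.TTheory GRing.Theory Num.Theory.
Import numFieldNormedType.Exports.

Local Open Scope classical_set_scope.
Local Open Scope ring_scope.
Local Open Scope complex_scope.

Section HardySpace.
Variables (R : realType) (no ni : nat).

Local Notation CR := (complex R).
Implicit Types F : CR -> 'M[CR]_(no, ni).

(* The half-planes compare real parts: [0 < s] in [R[i]] would force [s] to be
   real. *)
Definition right_half_plane : set CR := [set s | 0 < complex.Re s].
Definition left_half_plane : set CR := [set s | complex.Re s < 0].

Definition frobenius (A : 'M[CR]_(no, ni)) : R :=
  Num.sqrt (\sum_(i < no) \sum_(j < ni) Normc.normc (A i j) ^+ 2).

(* [derivable] and [derive1] over the field [R[i]] are complex
   differentiability and the complex derivative; both are taken entrywise. *)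
Definition holomorphic_on (D : set CR) F : Prop :=
  forall s, D s -> forall i j, derivable (fun z : CR^o => F z i j : CR^o) s 1.

Definition mx_derive F (s : CR) : 'M[CR]_(no, ni) :=
  \matrix_(i, j) ((fun z => F z i j : CR^o)^`())%classic s.

(* Finite Hardy norm in the usual sense of uniformly bounded L2 means over the
   vertical lines of the open right half-plane. Square integrability of the
   boundary values alone would also admit functions such as
   [exp(s) / (s + 1)], which are not in the Hardy space. *)
Definition hardy2 F : Prop :=
  holomorphic_on right_half_plane F /\
  exists M : R, forall x : R, 0 < x ->
    (\int[@lebesgue_measure R]_w
       (frobenius (F (x +i* w)) ^+ 2)%R%:E <= M%:E)%E.

(* F(i w), as the horizontal limit from the right half-plane; for F in the
   Hardy space it exists for almost every w. *)
Definition boundary_value F (w : R) : 'M[CR]_(no, ni) :=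
  \matrix_(i, j) lim ((F (x +i* w) i j : CR^o) @[x --> (0 : R)^'+]).

Definition h2norm F : \bar R :=
  ((((2 * pi)^-1)%R%:E *
    \int[@lebesgue_measure R]_w
      (frobenius (boundary_value F w) ^+ 2)%R%:E) `^ (2^-1)%R)%E.

(* H(conj s) = conj(H(s)): the transfer function of a system with real input,
   output and impulse response. Real second-order models can only match this
   part of a general H: for H(s) = 1/((s+1)(s+2)) + 'i/(s+1) the best model
   with r = 1 has E = 3, K = 2, B = C = 1, and the interpolation conditions
   fail. *)
Definition real_symmetric F : Prop :=
  forall s, right_half_plane s -> F (s^*) = map_mx (@conjc R) (F s).

End HardySpace.

Section SecondOrderModels.
Variables (R : realType) (no ni r : nat).

Local Notation CR := (complex R).
Local Notation toC := (map_mx (real_complex R)).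

Record so_model := SOModel {
  so_E : 'M[R]_r;
  so_K : 'M[R]_r;
  so_B : 'M[R]_(r, ni);
  so_C : 'M[R]_(no, r)
}.

Definition so_pencil (S : so_model) (s : CR) : 'M[CR]_r :=
  (s ^+ 2)%:M + s *: toC (so_E S) + toC (so_K S).

Definition so_eigenvalue (S : so_model) (s : CR) : Prop :=
  so_pencil S s \notin unitmx.

Definition so_tf (S : so_model) (s : CR) : 'M[CR]_(no, ni) :=
  toC (so_C S) *m invmx (so_pencil S s) *m toC (so_B S).

Definition Sigma_DSO : set so_model :=
  [set S | [/\ is_diag_mx (so_E S), is_diag_mx (so_K S) &
               so_eigenvalue S `<=` @left_half_plane R]].

Definition h2_optimal (H : CR -> 'M[CR]_(no, ni)) (Sigma : set so_model)
    (S : so_model) : Prop :=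
  Sigma S /\
  forall S', Sigma S' ->
    (h2norm (fun s => H s - so_tf S s)%R
       <= h2norm (fun s => H s - so_tf S' s)%R)%E.

Definition so_c (S : so_model) (i : 'I_r) : 'cV[CR]_no :=
  toC (so_C S *m delta_mx i (0 : 'I_1)).

Definition so_b (S : so_model) (i : 'I_r) : 'cV[CR]_ni :=
  toC ((so_B S)^T *m delta_mx i (0 : 'I_1)).

End SecondOrderModels.

(* Main.v *)
(* For G = H - Hhat with boundary function G0, perturbing one real parameter of
   an optimal model gives Re <G0, m kappa> = 0, where m is a real matrix and
   kappa the derivative of the perturbed scalar factor 1/q_k, with
   q_k(s) = (s - l+)(s - l-); since everything is real symmetric the whole
   pairing vanishes. On the imaginary axis conj(1/q_k) is
   1/((i w - p)(i w - q)) with p = -conj(l+), q = -conj(l-) in the right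
   half-plane, and Cauchy's formula turns the pairing of G0 with that kernel
   into -2 pi (G(p) - G(q))/(p - q), and with 1/(i w - p)^2 into -2 pi G'(p).
   Perturbing B and C yields the conditions on G(p) - G(q). Perturbing the k-th
   entries of E and K yields two orthogonality relations against multiples of
   conj(1/q_k^2), and partial fractions reduce them, modulo the previous
   conditions, to the conditions on G'(p) and G'(q).

   The boundary function of a real symmetric Hardy function f is obtained from
   the means N(x) of |f|^2 over vertical lines: shifting the line of integration
   of f(z) f(c - z) shows that the squared L2 distance of two lines is
   N(x) + N(y) - 2 N((x + y)/2), so N is midpoint convex and bounded, hence
   decreasing, and f(x + i .) is L2-Cauchy as x -> 0. Its limit reproduces f
   through the Poisson kernel, so that f(x + i w) converges to it at every
   Lebesgue point w. *)
From HB Require Import structures.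
From mathcomp Require Import all_boot all_order all_algebra.
From mathcomp Require Import all_classical all_reals all_analysis.
From mathcomp Require Import complex ring lra measurable_realfun.
Require Import Defs.
Set Implicit Arguments.
Unset Strict Implicit.
Unset Printing Implicit Defensive.
Import Order.TTheory GRing.Theory Num.Theory.
Import numFieldNormedType.Exports.
Local Open Scope classical_set_scope.
Local Open Scope ring_scope.
Local Open Scope complex_scope.

(** * Complex differentiability and integration *)

(** No residue calculus is used. Cauchy's theorem is proved for functions that are holomorphic
    except at one interior point, where they are merely continuous; a simple pole is thus reduced to
    a removable one by subtracting a term with the same residue whose integral along the imaginary
    axis is explicit. This yields the reproducing formula only for kernels with one pole in each
    half-plane. The kernels of the theorem have both poles on the right; they are reached by partial
    fractions with an auxiliary pole at -1 and, for a double pole, by a limit.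

    Up to the imaginary axis a Hardy function is controlled only by its L2 means, so every estimate
    is an integral of squares uniform in the abscissa.

    The perturbed models have to remain stable. Positivity of the diagonal entries of E and K
    implies stability, is an open condition, and holds at the optimum because the poles lie in the
    left half-plane. The kernel is not linear in E and K; what keeps the remainder of second order
    is that a linear numerator divided by q_k is bounded on the imaginary axis. *)

Section ComplexNorm.
Variable R : realType.
Local Notation C := R[i].
Local Notation nc := (@Normc.normc R).
Implicit Types z w : C.

Lemma normc_normr z : `|z| = (nc z)%:C. Proof. by []. Qed.

Lemma normc_ge0 z : 0 <= nc z.
Proof. by rewrite -ler0c -normc_normr. Qed.

Lemma normc_eq0 z : (nc z == 0) = (z == 0).
Proof.
by apply/eqP/eqP => [/Normc.eq0_normc//|->]; rewrite Normc.normc0.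
Qed.

Lemma normc_gt0 z : (0 < nc z) = (z != 0).
Proof. by rewrite lt_neqAle normc_ge0 andbT eq_sym normc_eq0. Qed.

Lemma sqr_normcE z : nc z ^+ 2 = complex.Re z ^+ 2 + complex.Im z ^+ 2.
Proof. by case: z => a b /=; rewrite sqr_sqrtr// addr_ge0// sqr_ge0. Qed.

Lemma ler_normcD z w : nc (z + w) <= nc z + nc w.
Proof. exact: le_normcD. Qed.

Lemma ler_normcB z w : nc (z - w) <= nc z + nc w.
Proof. by rewrite -(normcN w); exact: ler_normcD. Qed.

Lemma normc_distC z w : nc (z - w) = nc (w - z).
Proof. by rewrite -normcN opprB. Qed.

Lemma ler_sub_normcD z w : nc z - nc w <= nc (z + w).
Proof. by rewrite lerBlDr -{1}(addrK w z); exact: ler_normcB. Qed.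

Lemma ler_Re_normc z : `|complex.Re z| <= nc z.
Proof.
rewrite -(@ler_pXn2r _ 2) ?nnegrE ?normc_ge0 ?normr_ge0//.
by rewrite sqr_normcE real_normK ?num_real// lerDl sqr_ge0.
Qed.

Lemma ler_Im_normc z : `|complex.Im z| <= nc z.
Proof.
rewrite -(@ler_pXn2r _ 2) ?nnegrE ?normc_ge0 ?normr_ge0//.
by rewrite sqr_normcE real_normK ?num_real// lerDr sqr_ge0.
Qed.

Lemma normc_le_ReIm z : nc z <= `|complex.Re z| + `|complex.Im z|.
Proof.
rewrite -(@ler_pXn2r _ 2) ?nnegrE ?normc_ge0 ?addr_ge0//.
rewrite sqr_normcE sqrrD !real_normK ?num_real//.
by rewrite -addrA [X in _ <= _ + X]addrC addrA lerDl mulrn_wge0// mulr_ge0.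
Qed.

Lemma normc_conj z : nc z^* = nc z.
Proof. by case: z => a b /=; rewrite sqrrN. Qed.

Lemma normc_real (x : R) : nc x%:C = `|x|.
Proof. by rewrite /= expr0n addr0 sqrtr_sqr. Qed.

Lemma normc_imag (x : R) : nc (0 +i* x) = `|x|.
Proof. by rewrite /= expr0n add0r sqrtr_sqr. Qed.

Lemma normcX z n : nc (z ^+ n) = nc z ^+ n.
Proof.
by elim: n => [|n IHn]; rewrite ?expr0 ?Normc.normc1// !exprS Normc.normcM IHn.
Qed.

Lemma mulc_conj z : z * z^* = (nc z ^+ 2)%:C.
Proof.
case: z => a b; rewrite sqr_normcE /=; apply/eqP; rewrite eq_complex /=.
by apply/andP; split; apply/eqP; ring.
Qed.

Lemma gtc0_realE (e : C) : 0 < e -> exists2 d : R, 0 < d & e = d%:C.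
Proof.
case: e => a b; rewrite ltcE /= => /andP[/eqP -> a0].
by exists a.
Qed.

End ComplexNorm.

#[global] Arguments Normc.normc : simpl never.

Section ComplexDifferentiability.
Variable R : realType.
Local Notation C := R[i].
Local Notation nc := (@Normc.normc R).

(* Continuity and f'(z) = L with real radii: the balls of the topology of [R[i]]
   as a normed space have radii in [R[i]]. *)
Definition ccont (f : C -> C) (z : C) := forall e : R, 0 < e ->
  exists2 d : R, 0 < d & forall w, nc (w - z) < d -> nc (f w - f z) < e.

Definition cdiff (f : C -> C) (z L : C) := forall e : R, 0 < e ->
  exists2 d : R, 0 < d &
    forall h, nc h < d -> nc (f (z + h) - f z - L * h) <= e * nc h.

(** This bridge borrows the rules for sums, products and inverses from [is_derive], and makes the
    holomorphy of [H], stated with [derivable], available with real radii. *)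
Lemma cdiff_is_derive (f : C -> C) (z L : C) :
  cdiff f z L <-> is_derive (z : C^o) (1 : C^o) (f : C^o -> C^o) (L : C^o).
Proof.
pose q (h : C^o) : C^o := h^-1 *: (f (h + z) - f z).
have qE : (fun h : C^o => h^-1 *: (((f : C^o -> C^o) \o shift (z : C^o))
    (h *: (1 : C^o)) - f z) : C^o) = q.
  by apply/funext => h; rewrite /q /= /shift /= /GRing.scale /= mulr1.
have H : cdiff f z L <-> ((q h @[h --> 0^'] --> (L : C^o)) : Prop).
  split.
    move=> fL; apply/cvgrPdist_le => e /gtc0_realE[e' e0 ->].
    have [d d0 Hd] := fL _ e0.
    rewrite /prop_near1 /= /nbhs /= /within /=.
    have d0' : (0 : C) < d%:C by rewrite ltcR.
    apply: filterS (nbhsx_ballx (0 : C^o) _ d0') => h /=.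
    rewrite /ball /= sub0r normrN normc_normr ltcR => hd h0.
    have := Hd h hd.
    rewrite normc_normr lecR /q /GRing.scale /=.
    have -> : L - h^-1 * (f (h + z) - f z) =
              - (h^-1 * (f (z + h) - f z - L * h)).
      rewrite (addrC h z).
      by field.
    rewrite normcN Normc.normcM Normc.normcV => H.
    by rewrite mulrC ler_pdivrMr ?normc_gt0.
  move=> /cvgrPdist_le fL e e0.
  have e0' : (0 : C) < e%:C by rewrite ltcR.
  have := fL _ e0'; rewrite /prop_near1 /= /nbhs /= /within /=.
  move=> /nbhs_ballP[d' /= /gtc0_realE[d d0 ->] Hd].
  exists d => // h hd.
  have [->|h0] := eqVneq h 0.
    by rewrite mulr0 subr0 addr0 subrr Normc.normc0 mulr0.
  have := Hd h; rewrite /ball /= sub0r normrN normc_normr ltcR => /(_ hd h0).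
  rewrite /q /GRing.scale /= normc_normr lecR.
  have -> : L - h^-1 * (f (h + z) - f z) =
              - (h^-1 * (f (z + h) - f z - L * h)).
    rewrite (addrC h z).
    by field.
  by rewrite normcN Normc.normcM Normc.normcV mulrC ler_pdivrMr ?normc_gt0.
split=> [/H fL|[fd fL]].
  apply: DeriveDef; rewrite /derivable /derive qE.
    by apply/cvg_ex; exists L.
  exact: cvg_lim.
apply/H; move: fd fL; rewrite /derivable /derive qE => /cvg_ex[l ql] qL.
have lL : l = L.
  by rewrite -qL; apply/esym/(@cvg_lim C^o (@norm_hausdorff _ C^o)); exact: ql.
by rewrite -lL; exact: ql.
Qed.

Lemma cdiff_derivable (f : C -> C) z :
  derivable (f : C^o -> C^o) z 1 ->
  cdiff f z (((f : C^o -> C^o)^`())%classic z).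
Proof.
move=> fz; apply/cdiff_is_derive; apply: (DeriveDef fz).
exact/esym/derive1E.
Qed.

Lemma cdiff_derive1 (f : C -> C) z L : cdiff f z L ->
  ((f : C^o -> C^o)^`())%classic z = L.
Proof. move=> /cdiff_is_derive[_ <-]; exact: derive1E. Qed.

Lemma cdiff_cont f z L : cdiff f z L -> ccont f z.
Proof.
move=> fL e e0; have [d d0 Hd] := fL 1 ltr01.
have K0 : 0 < 1 + nc L by rewrite ltr_wpDr ?normc_ge0.
exists (Num.min d (e / (1 + nc L))).
  by rewrite lt_min d0 divr_gt0.
move=> w; rewrite lt_min => /andP[wd]; rewrite ltr_pdivlMr// => we.
have := Hd _ wd; rewrite (addrC z) subrK mul1r => H.
rewrite -(subrK (L * (w - z)) (f w - f z)).
apply: le_lt_trans (ler_normcD _ _) _; rewrite Normc.normcM.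
apply: le_lt_trans we; rewrite (mulrDr _ 1 (nc L)) mulr1 lerD//.
by rewrite mulrC.
Qed.

Lemma cdiff_eq f z L L' : cdiff f z L -> L = L' -> cdiff f z L'.
Proof. by move=> ? <-. Qed.

Lemma cdiff_cst c z : cdiff (fun=> c) z 0.
Proof.
move=> e e0; exists 1 => // h _.
by rewrite subrr mul0r subr0 Normc.normc0 mulr_ge0 ?normc_ge0// ltW.
Qed.

Lemma cdiff_id z : cdiff id z 1.
Proof.
move=> e e0; exists 1 => // h _.
by rewrite mul1r /= (addrC z) addrK subrr Normc.normc0 mulr_ge0 ?normc_ge0// ltW.
Qed.

Lemma cdiffD f g z L M : cdiff f z L -> cdiff g z M ->
  cdiff (fun x => f x + g x) z (L + M).
Proof.
move=> /cdiff_is_derive H1 /cdiff_is_derive H2; exact/cdiff_is_derive.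
Qed.

Lemma cdiffB f g z L M : cdiff f z L -> cdiff g z M ->
  cdiff (fun x => f x - g x) z (L - M).
Proof.
move=> /cdiff_is_derive H1 /cdiff_is_derive H2; exact/cdiff_is_derive.
Qed.

Lemma cdiffM f g z L M : cdiff f z L -> cdiff g z M ->
  cdiff (fun x => f x * g x) z (f z * M + g z * L).
Proof.
move=> /cdiff_is_derive H1 /cdiff_is_derive H2; exact/cdiff_is_derive.
Qed.

Lemma cdiffV f z L : f z != 0 -> cdiff f z L ->
  cdiff (fun x => (f x)^-1) z (- f z ^- 2 * L).
Proof.
move=> fz /cdiff_is_derive [fd fL]; apply/cdiff_is_derive; apply: DeriveDef.
  exact: derivableV.
by rewrite deriveV// fL.
Qed.

Lemma cdiff_affine f (a b z L : C) : cdiff f (a + b * z) L ->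
  cdiff (fun x => f (a + b * x)) z (L * b).
Proof.
move=> fL e e0.
have K0 : 0 < 1 + nc b by rewrite ltr_wpDr ?normc_ge0.
have [d d0 Hd] := fL _ (divr_gt0 e0 K0).
exists (d / (1 + nc b)); first exact: divr_gt0.
move=> h; rewrite ltr_pdivlMr// => hd.
have bh : nc (b * h) < d.
  apply: le_lt_trans hd; rewrite Normc.normcM mulrC ler_wpM2l ?normc_ge0//.
  by rewrite lerDr.
have := Hd _ bh; rewrite mulrDr addrA mulrA => /le_trans; apply.
rewrite Normc.normcM mulrA ler_wpM2r ?normc_ge0//.
rewrite mulrAC ler_pdivrMr// ler_wpM2l ?(ltW e0)//.
by rewrite lerDr.
Qed.

Lemma ccont_cst c z : ccont (fun=> c) z.
Proof. exact: cdiff_cont (cdiff_cst _ _). Qed.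

Lemma ccontD f g z : ccont f z -> ccont g z -> ccont (fun x => f x + g x) z.
Proof.
move=> fz gz e e0; have e20 : 0 < e / 2 by rewrite divr_gt0.
have [d d0 Hd] := fz _ e20; have [d' d'0 Hd'] := gz _ e20.
exists (Num.min d d'); first by rewrite lt_min d0.
move=> w; rewrite lt_min => /andP[/Hd h1 /Hd' h2].
rewrite opprD addrACA (splitr e).
exact: le_lt_trans (ler_normcD _ _) (ltrD h1 h2).
Qed.

Lemma ccontM f g z : ccont f z -> ccont g z -> ccont (fun x => f x * g x) z.
Proof.
move=> fz gz e e0.
have K0 : 0 < 1 + nc (f z) by rewrite ltr_wpDr ?normc_ge0.
have K1 : 0 < 1 + nc (g z) by rewrite ltr_wpDr ?normc_ge0.
have e20 : 0 < e / 2 by rewrite divr_gt0.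
have [d d0 Hd] := fz _ (divr_gt0 e20 K1).
have [d1 d10 Hd1] := fz _ ltr01.
have [d2 d20 Hd2] := gz _ (divr_gt0 e20 K0).
exists (Num.min d (Num.min d1 d2)); first by rewrite !lt_min d0 d10.
move=> w; rewrite !lt_min => /and3P[/Hd h1 /Hd1 h2 /Hd2 h3].
have -> : f w * g w - f z * g z = (f w - f z) * g z + f w * (g w - g z) by ring.
apply: le_lt_trans (ler_normcD _ _) _; rewrite !Normc.normcM (splitr e).
rewrite ler_ltD//.
  rewrite ltr_pdivlMr// in h1; apply: ltW; apply: le_lt_trans h1.
  by rewrite ler_wpM2l ?normc_ge0// lerDr.
rewrite ltr_pdivlMr// in h3; apply: le_lt_trans h3; rewrite mulrC.
rewrite ler_wpM2l ?normc_ge0//.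
rewrite -(subrK (f z) (f w)) (le_trans (ler_normcD _ _))// lerD2r.
exact: ltW.
Qed.

Lemma ccontV f z : f z != 0 -> ccont f z -> ccont (fun x => (f x)^-1) z.
Proof.
move=> fz0 fz e e0; have n0 : 0 < nc (f z) by rewrite normc_gt0.
have h20 : 0 < nc (f z) / 2 by rewrite divr_gt0.
have [d1 d10 Hd1] := fz _ h20.
have [d d0 Hd] := fz _ (mulr_gt0 e0 (mulr_gt0 n0 h20)).
exists (Num.min d d1); first by rewrite lt_min d0.
move=> w; rewrite lt_min => /andP[/Hd h1 /Hd1 h2].
have fw : nc (f z) / 2 < nc (f w).
  have := ler_sub_normcD (f z) (f w - f z); rewrite (addrC (f z)) subrK; lra.
have fw0 : f w != 0 by rewrite -normc_gt0; lra.
have -> : (f w)^-1 - (f z)^-1 = - ((f w - f z) / (f w * f z)) by field; apply/andP.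
rewrite normcN Normc.normcM Normc.normcV Normc.normcM.
have p0 : 0 < nc (f w) by rewrite normc_gt0.
rewrite ltr_pdivrMr ?mulr_gt0//; apply: lt_le_trans h1 _.
rewrite ler_wpM2l ?(ltW e0)// mulrC ler_wpM2r ?(ltW n0)//; exact: ltW.
Qed.

Lemma ccont_affine f (a b z : C) : ccont f (a + b * z) ->
  ccont (fun x => f (a + b * x)) z.
Proof.
move=> fz e e0; have [d d0 Hd] := fz _ e0.
have K0 : 0 < 1 + nc b by rewrite ltr_wpDr ?normc_ge0.
exists (d / (1 + nc b)); first exact: divr_gt0.
move=> w; rewrite ltr_pdivlMr// => wd; apply: Hd.
rewrite opprD addrACA subrr add0r -mulrBr Normc.normcM mulrC.
by apply: le_lt_trans wd; rewrite ler_wpM2l ?normc_ge0// lerDr.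
Qed.

Lemma near_eq_cdiff f g z L (d : R) : 0 < d -> (forall w, nc (w - z) < d -> f w = g w) ->
  cdiff f z L -> cdiff g z L.
Proof.
move=> d0 fg fz e e0; have [d1 d10 Hd1] := fz _ e0.
exists (Num.min d d1); first by rewrite lt_min d0.
move=> h; rewrite lt_min => /andP[h1 h2].
rewrite -!fg ?subrr ?Normc.normc0//; first exact: Hd1.
by rewrite (addrC z) addrK.
Qed.

End ComplexDifferentiability.

(** * Integrals of complex-valued functions of a real variable *)

Section ComplexIntegral.
Variable R : realType.
Local Notation C := R[i].
Local Notation nc := (@Normc.normc R).
Local Notation re := (@complex.Re R).
Local Notation im := (@complex.Im R).
Local Notation mu := (@lebesgue_measure R).
Local Notation RM := (measurableTypeR R).
Implicit Types (D : set RM) (f g : RM -> C) (c : C) (u v : RM -> R).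

Definition integ D u := mu.-integrable D (EFin \o u).

Definition cmeas D f :=
  measurable_fun D (fun x => re (f x)) /\ measurable_fun D (fun x => im (f x)).

Definition cinteg D f :=
  integ D (fun x => re (f x)) /\ integ D (fun x => im (f x)).

Definition cint D f : C :=
  (\int[mu]_(x in D) re (f x))%R +i* (\int[mu]_(x in D) im (f x))%R.

Lemma ReD (a b : C) : re (a + b) = re a + re b. Proof. by case: a b => ? ? []. Qed.
Lemma ImD (a b : C) : im (a + b) = im a + im b. Proof. by case: a b => ? ? []. Qed.
Lemma ReN (a : C) : re (- a) = - re a. Proof. by case: a. Qed.
Lemma ImN (a : C) : im (- a) = - im a. Proof. by case: a. Qed.
Lemma Re_mulE (a b : C) : re (a * b) = re a * re b - im a * im b.
Proof. by case: a b => ? ? []. Qed.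
Lemma Im_mulE (a b : C) : im (a * b) = re a * im b + im a * re b.
Proof. by case: a b => ? ? []. Qed.
Lemma ReJ (a : C) : re a^* = re a. Proof. by case: a. Qed.
Lemma ImJ (a : C) : im a^* = - im a. Proof. by case: a. Qed.
Lemma eq_ReIm (a b : C) : re a = re b -> im a = im b -> a = b.
Proof. by case: a b => ? ? [? ?] /= -> ->. Qed.

Lemma integ_measurable D u : integ D u -> measurable_fun D u.
Proof. by move=> /integrableP[/measurable_EFinP]. Qed.

Lemma cinteg_cmeas D f : cinteg D f -> cmeas D f.
Proof. by move=> [/integ_measurable ? /integ_measurable ?]. Qed.

Lemma integ_le D u v : measurable D -> measurable_fun D u -> integ D v ->
  (forall x, D x -> `|u x| <= v x) -> integ D u.
Proof.
move=> mD mu' iv uv; apply: le_integrable iv => //; first exact/measurable_EFinP.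
by move=> x Dx /=; rewrite lee_fin (le_trans (uv _ Dx))// ler_norm.
Qed.

Lemma integ0 D : measurable D -> integ D (fun=> 0).
Proof. by move=> mD; exact: (integrable0 mu). Qed.

Lemma integD D u v : measurable D -> integ D u -> integ D v ->
  integ D (fun x => u x + v x).
Proof. by move=> mD iu iv; exact: (integrableD mD iu iv). Qed.

Lemma integB D u v : measurable D -> integ D u -> integ D v ->
  integ D (fun x => u x - v x).
Proof. by move=> mD iu iv; exact: (integrableB mD iu iv). Qed.

Lemma integN D u : measurable D -> integ D u -> integ D (fun x => - u x).
Proof. by move=> mD iu; exact: (integrableN iu). Qed.

Lemma integZ D u a : measurable D -> integ D u -> integ D (fun x => a * u x).
Proof. by move=> mD iu; exact: (integrableZl mD a iu). Qed.

Lemma integ_norm D u : integ D u -> integ D (fun x => `|u x|).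
Proof. exact: integrable_norm. Qed.

Lemma eq_integ D u v : measurable D -> (forall x, D x -> u x = v x) ->
  integ D u -> integ D v.
Proof.
move=> mD uv; apply: eq_integrable => // x /set_mem Dx /=.
by rewrite uv.
Qed.

Lemma eq_cinteg D f g : measurable D -> (forall x, D x -> f x = g x) ->
  cinteg D f -> cinteg D g.
Proof.
by move=> mD fg [h1 h2]; split; [apply: eq_integ mD _ h1|apply: eq_integ mD _ h2] => x Dx;
  rewrite fg.
Qed.

Lemma eq_cint D f g : (forall x, D x -> f x = g x) -> cint D f = cint D g.
Proof.
by move=> fg; congr Complex; apply: eq_Rintegral => x /set_mem Dx; rewrite fg.
Qed.

Lemma cintegD D f g : measurable D -> cinteg D f -> cinteg D g ->
  cinteg D (fun x => f x + g x).
Proof.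
move=> mD [f1 f2] [g1 g2]; split.
  by apply: (eq_integ mD _ (integD mD f1 g1)) => x _; rewrite ReD.
by apply: (eq_integ mD _ (integD mD f2 g2)) => x _; rewrite ImD.
Qed.

Lemma cintegN D f : measurable D -> cinteg D f -> cinteg D (fun x => - f x).
Proof.
move=> mD [f1 f2]; split.
  by apply: (eq_integ mD _ (integN mD f1)) => x _; rewrite ReN.
by apply: (eq_integ mD _ (integN mD f2)) => x _; rewrite ImN.
Qed.

Lemma cintegB D f g : measurable D -> cinteg D f -> cinteg D g ->
  cinteg D (fun x => f x - g x).
Proof. by move=> mD cf cg; apply: cintegD => //; exact: cintegN. Qed.

Lemma cintegZ D f c : measurable D -> cinteg D f -> cinteg D (fun x => c * f x).
Proof.
move=> mD [f1 f2]; split.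
  apply: (eq_integ mD _ (integB mD (integZ (re c) mD f1) (integZ (im c) mD f2))) => x _.
  by rewrite Re_mulE.
apply: (eq_integ mD _ (integD mD (integZ (re c) mD f2) (integZ (im c) mD f1))) => x _.
by rewrite Im_mulE.
Qed.

Lemma cintD D f g : measurable D -> cinteg D f -> cinteg D g ->
  cint D (fun x => f x + g x) = cint D f + cint D g.
Proof.
move=> mD [f1 f2] [g1 g2]; apply: eq_ReIm; rewrite ?ReD ?ImD /= -RintegralD//;
  by apply: eq_Rintegral => x _; rewrite ?ReD ?ImD.
Qed.

Lemma cintZ D f c : measurable D -> cinteg D f ->
  cint D (fun x => c * f x) = c * cint D f.
Proof.
move=> mD [f1 f2]; apply: eq_ReIm.
  rewrite Re_mulE /= -!RintegralZl//.
  rewrite -RintegralB//; [|exact: integZ|exact: integZ].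
  by apply: eq_Rintegral => x _; rewrite Re_mulE.
rewrite Im_mulE /= -!RintegralZl//.
rewrite -RintegralD//; [|exact: integZ|exact: integZ].
by apply: eq_Rintegral => x _; rewrite Im_mulE.
Qed.

Lemma cintN D f : measurable D -> cinteg D f ->
  cint D (fun x => - f x) = - cint D f.
Proof.
move=> mD cf; rewrite -mulN1r -cintZ//.
by apply: eq_cint => x _; rewrite mulN1r.
Qed.

Lemma cintB D f g : measurable D -> cinteg D f -> cinteg D g ->
  cint D (fun x => f x - g x) = cint D f - cint D g.
Proof.
by move=> mD cf cg; rewrite -cintN// -cintD//; exact: cintegN.
Qed.

Lemma cmeasD D f g : cmeas D f -> cmeas D g -> cmeas D (fun x => f x + g x).
Proof.
move=> [f1 f2] [g1 g2]; split.
  by under eq_fun do rewrite ReD; exact: measurable_funD.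
by under eq_fun do rewrite ImD; exact: measurable_funD.
Qed.

Lemma cmeasN D f : cmeas D f -> cmeas D (fun x => - f x).
Proof.
move=> [f1 f2]; split.
  by under eq_fun do rewrite ReN; exact: measurable_funN.
by under eq_fun do rewrite ImN; exact: measurable_funN.
Qed.

Lemma cmeasB D f g : cmeas D f -> cmeas D g -> cmeas D (fun x => f x - g x).
Proof. by move=> mf mg; apply: cmeasD => //; exact: cmeasN. Qed.

Lemma cmeasM D f g : cmeas D f -> cmeas D g -> cmeas D (fun x => f x * g x).
Proof.
move=> [f1 f2] [g1 g2]; split.
  under eq_fun do rewrite Re_mulE.
  by apply: measurable_funB; exact: measurable_funM.
under eq_fun do rewrite Im_mulE.
by apply: measurable_funD; exact: measurable_funM.
Qed.

Lemma cmeas_conj D f : cmeas D f -> cmeas D (fun x => (f x)^*).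
Proof.
move=> [f1 f2]; split; first by under eq_fun do rewrite ReJ.
by under eq_fun do rewrite ImJ; exact: measurable_funN.
Qed.

Lemma measurable_sqr_normc D f : cmeas D f ->
  measurable_fun D (fun x => nc (f x) ^+ 2).
Proof.
move=> [f1 f2]; under eq_fun do rewrite sqr_normcE.
by apply: measurable_funD; exact: measurable_funX.
Qed.

Lemma measurable_sqrt : measurable_fun [set: R] (@Num.sqrt R).
Proof. by apply: continuous_measurable_fun; exact: sqrt_continuous. Qed.

Lemma measurable_normc D f : cmeas D f -> measurable_fun D (fun x => nc (f x)).
Proof.
move=> mf; have -> : (fun x => nc (f x)) = Num.sqrt \o (fun x => nc (f x) ^+ 2).
  by apply/funext => x /=; rewrite sqrtr_sqr ger0_norm// normc_ge0.
by apply: measurableT_comp; [exact: measurable_sqrt|exact: measurable_sqr_normc].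
Qed.

Lemma cinteg_le D f v : measurable D -> cmeas D f -> integ D v ->
  (forall x, D x -> nc (f x) <= v x) -> cinteg D f.
Proof.
move=> mD [f1 f2] iv fv; split; apply: (integ_le mD _ iv) => // x Dx;
  apply: le_trans (fv _ Dx); [exact: ler_Re_normc|exact: ler_Im_normc].
Qed.

Lemma integ_normc D f : measurable D -> cinteg D f -> integ D (fun x => nc (f x)).
Proof.
move=> mD [f1 f2].
apply: (integ_le mD _ (integD mD (integ_norm f1) (integ_norm f2))).
  by apply: measurable_normc; apply: cinteg_cmeas; split.
by move=> x Dx; rewrite ger0_norm ?normc_ge0// normc_le_ReIm.
Qed.

(** The factor 2 comes from bounding the real and imaginary parts separately. It is harmless, since
    the bound only serves estimates whose constants are immaterial. *)
Lemma normc_cint D f : measurable D -> cinteg D f ->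
  nc (cint D f) <= 2 * \int[mu]_(x in D) nc (f x).
Proof.
move=> mD cf; have [f1 f2] := cf; have nf := integ_normc mD cf.
apply: le_trans (normc_le_ReIm _) _; rewrite mulr_natl mulr2n /=.
by apply: lerD; apply: le_trans (le_normr_Rintegral mD _) _ => //;
  apply: le_Rintegral => //; [exact: integ_norm| |exact: integ_norm|] => x _;
  [exact: ler_Re_normc|exact: ler_Im_normc].
Qed.

Lemma normc_cint_le D f v : measurable D -> cmeas D f -> integ D v ->
  (forall x, D x -> nc (f x) <= v x) ->
  nc (cint D f) <= 2 * \int[mu]_(x in D) v x.
Proof.
move=> mD mf iv fv; have cf := cinteg_le mD mf iv fv.
apply: le_trans (normc_cint mD cf) _; rewrite ler_wpM2l//.
by apply: le_Rintegral => //; exact: integ_normc.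
Qed.

Lemma ccont_line (F : C -> C) (a b : C) (x : R) :
  ccont F (a + b * x%:C) ->
  {for x, continuous (fun t : R => re (F (a + b * t%:C)))} /\
  {for x, continuous (fun t : R => im (F (a + b * t%:C)))}.
Proof.
move=> /ccont_affine Fx.
split; apply/cvgrPdist_lt => e e0; have [d d0 Hd] := Fx _ e0;
  apply: filterS (nbhsx_ballx x _ d0) => t /=; rewrite /ball /= => xt.
  have h : nc (t%:C - x%:C) < d by rewrite -rmorphB normc_real distrC.
have H := Hd _ h.
  rewrite -ReN -ReD; apply: le_lt_trans (ler_Re_normc _) _.
  by rewrite normc_distC.
have h : nc (t%:C - x%:C) < d by rewrite -rmorphB normc_real distrC.
have H := Hd _ h.
rewrite -ImN -ImD; apply: le_lt_trans (ler_Im_normc _) _.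
by rewrite normc_distC.
Qed.

Lemma cmeas_line (F : C -> C) (a b : C) :
  (forall x : R, ccont F (a + b * x%:C)) ->
  cmeas setT (fun t => F (a + b * t%:C)).
Proof.
by move=> FC; split; apply: continuous_measurable_fun => x;
  have [] := ccont_line (FC x).
Qed.

Lemma cinteg_segment (F : C -> C) (a b : C) (s t : R) :
  (forall x : R, s <= x <= t -> ccont F (a + b * x%:C)) ->
  cinteg `[s, t] (fun x => F (a + b * x%:C)).
Proof.
by move=> FC; split; apply: continuous_compact_integrable;
  (try exact: segment_compact); apply: continuous_in_subspaceT => x;
  rewrite inE /= in_itv /= => xst; have [] := ccont_line (FC x xst).
Qed.

Lemma cint_split f (a b c : R) : a <= b -> b <= c -> cinteg `[a, c] f ->
  cint `[a, c] f = cint `[a, b] f + cint `[b, c] f.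
Proof.
move=> ab bc [f1 f2].
have H u : integ `[a, c] u -> (\int[mu]_(x in `[a, c]) u x =
    \int[mu]_(x in `[a, b]) u x + \int[mu]_(x in `[b, c]) u x)%R.
  move=> iu; have h := Rintegral_itvB iu.
  have := h b; rewrite !bnd_simp ab bc => /(_ isT isT) /eqP.
  rewrite subr_eq => /eqP ->; rewrite addrC Rintegral_itv_obnd_cbnd//.
  apply: integrableS iu => // x /=; rewrite !in_itv /= => /andP[bx ->].
  by rewrite (le_trans ab (ltW bx)).
by apply: eq_ReIm; rewrite ?ReD ?ImD /= H.
Qed.

End ComplexIntegral.

(** * Cauchy's theorem on a strip *)

Section Goursat.
Variable R : realType.
Local Notation C := R[i].
Local Notation nc := (@Normc.normc R).
Local Notation mu := (@lebesgue_measure R).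
Implicit Types (F h g : C -> C) (a b c d s t x y : R) (z : C).

Lemma horizontalE x y : x +i* y = (0 +i* y) + 1 * x%:C :> C.
Proof. by apply: eq_ReIm; rewrite /= ?mul1r ?add0r ?mul0r ?subr0 ?addr0. Qed.

Lemma verticalE x y : x +i* y = x%:C + 'i * y%:C :> C.
Proof. by apply: eq_ReIm; rewrite /=; ring. Qed.

Lemma cinteg_horizontal F y s t :
  (forall x, s <= x <= t -> ccont F (x +i* y)) ->
  cinteg `[s, t] (fun x => F (x +i* y)).
Proof.
move=> Fc; apply: (@eq_cinteg _ _ (fun x => F ((0 +i* y) + 1 * x%:C))) => //.
  by move=> x _; rewrite -horizontalE.
by apply: cinteg_segment => x /Fc; rewrite horizontalE.
Qed.

Lemma cinteg_vertical F x s t :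
  (forall y, s <= y <= t -> ccont F (x +i* y)) ->
  cinteg `[s, t] (fun y => F (x +i* y)).
Proof.
move=> Fc; apply: (@eq_cinteg _ _ (fun y => F (x%:C + 'i * y%:C))) => //.
  by move=> y _; rewrite -verticalE.
by apply: cinteg_segment => y /Fc; rewrite verticalE.
Qed.

Lemma cmeas_vertical F x : (forall y, ccont F (x +i* y)) ->
  cmeas setT (fun y => F (x +i* y)).
Proof.
move=> Fc; have -> : (fun y => F (x +i* y)) = (fun y => F (x%:C + 'i * y%:C)).
  by apply/funext => y; rewrite -verticalE.
by apply: cmeas_line => y; rewrite -verticalE.
Qed.

(** The counterclockwise contour integral over the boundary of the rectangle [[a, b] x [c, d]], with
    opposite sides merged into one integral. *)
Definition rint h a b c d : C :=
  cint `[a, b] (fun x => h (x +i* c) - h (x +i* d)) +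
  'i * cint `[c, d] (fun y => h (b +i* y) - h (a +i* y)).

Definition cont_rect h a b c d :=
  forall x y, a <= x <= b -> c <= y <= d -> ccont h (x +i* y).

Lemma cont_rectS h a b c d a' b' c' d' : a <= a' -> b' <= b -> c <= c' -> d' <= d ->
  cont_rect h a b c d -> cont_rect h a' b' c' d'.
Proof.
move=> aa bb cc dd H x y /andP[x1 x2] /andP[y1 y2]; apply: H.
  by rewrite (le_trans aa)// (le_trans x2).
by rewrite (le_trans cc)// (le_trans y2).
Qed.

Lemma cinteg_rect_h h a b c d : c <= d -> cont_rect h a b c d ->
  cinteg `[a, b] (fun x => h (x +i* c) - h (x +i* d)).
Proof.
move=> cd H; apply: cintegB => //; apply: cinteg_horizontal => x xab; apply: H;
  by rewrite ?xab ?lexx ?cd.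
Qed.

Lemma cinteg_rect_v h a b c d : a <= b -> cont_rect h a b c d ->
  cinteg `[c, d] (fun y => h (b +i* y) - h (a +i* y)).
Proof.
move=> ab H; apply: cintegB => //; apply: cinteg_vertical => x xab; apply: H;
  by rewrite ?xab ?lexx ?ab.
Qed.

Lemma rint_split_h h a m b c d : a <= m -> m <= b -> c <= d ->
  cont_rect h a b c d -> rint h a b c d = rint h a m c d + rint h m b c d.
Proof.
move=> am mb cd H; have ab := le_trans am mb.
have H1 := cont_rectS (lexx a) mb (lexx c) (lexx d) H.
have H2 := cont_rectS am (lexx b) (lexx c) (lexx d) H.
rewrite /rint (cint_split am mb (cinteg_rect_h cd H)).
rewrite addrACA -mulrDr -cintD//; [|exact: cinteg_rect_v..].
congr (_ + 'i * _); apply: eq_cint => y _; ring.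
Qed.

Lemma rint_split_v h a b c m d : a <= b -> c <= m -> m <= d ->
  cont_rect h a b c d -> rint h a b c d = rint h a b c m + rint h a b m d.
Proof.
move=> ab cm md H; have cd := le_trans cm md.
have H1 := cont_rectS (lexx a) (lexx b) (lexx c) md H.
have H2 := cont_rectS (lexx a) (lexx b) cm (lexx d) H.
rewrite /rint (cint_split cm md (cinteg_rect_v ab H)).
rewrite addrACA -mulrDr -cintD//; [|exact: cinteg_rect_h..].
congr (_ + 'i * _); apply: eq_cint => y _; ring.
Qed.

Lemma rintB h g a b c d : a <= b -> c <= d ->
  cont_rect h a b c d -> cont_rect g a b c d ->
  rint (fun z => h z - g z) a b c d = rint h a b c d - rint g a b c d.
Proof.
move=> ab cd H G; rewrite /rint opprD -mulrN addrACA -mulrDr.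
rewrite -!cintB//; [|exact: cinteg_rect_v..|exact: cinteg_rect_h|exact: cinteg_rect_h].
by congr (_ + 'i * _); apply: eq_cint => y _; ring.
Qed.

Lemma fine_lebesgue_segment s t : s <= t -> fine (mu `[s, t]%classic) = t - s.
Proof.
rewrite le_eqVlt => /predU1P[->|st];
by rewrite lebesgue_measure_itv/= lte_fin ?ltxx ?st ?subrr.
Qed.

Lemma cint_cst s t (k : C) : s <= t -> cint `[s, t] (fun=> k) = (t - s)%:C * k.
Proof.
move=> st; rewrite /cint !Rintegral_cst//= fine_lebesgue_segment//.
by case: k => k1 k2; apply: eq_ReIm; rewrite /=; ring.
Qed.

(** Lets [goursat] subtract the first-order Taylor polynomial of [h] without changing the contour
    integral. *)
Lemma rint_affine (k l : C) a b c d : a <= b -> c <= d ->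
  rint (fun z => k + l * z) a b c d = 0.
Proof.
move=> ab cd; rewrite /rint.
rewrite (_ : cint _ _ = cint `[a, b] (fun=> l * (0 +i* (c - d)))); last first.
  apply: eq_cint => x _.
  by rewrite opprD addrACA subrr add0r -mulrBr; congr (_ * _);
    apply: eq_ReIm; rewrite /= ?subrr.
rewrite (_ : cint `[c, d] _ = cint `[c, d] (fun=> l * (b - a)%:C)); last first.
  apply: eq_cint => x _.
  by rewrite opprD addrACA subrr add0r -mulrBr; congr (_ * _);
    apply: eq_ReIm; rewrite /= ?subrr.
by rewrite !cint_cst//; apply: eq_ReIm; case: l => l1 l2 /=; ring.
Qed.

Lemma normc_cint_segment (f : R -> C) s t (K : R) : s <= t ->
  cinteg `[s, t] f -> (forall x, s <= x <= t -> nc (f x) <= K) ->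
  nc (cint `[s, t] f) <= 2 * K * (t - s).
Proof.
move=> st cf fK.
apply: le_trans (@normc_cint_le _ `[s, t]%classic f (fun=> K) _ _ _ _) _.
- by [].
- exact: cinteg_cmeas.
- apply: continuous_compact_integrable; first exact: segment_compact.
  by apply: continuous_in_subspaceT => x _; exact: cst_continuous.
- by move=> x; rewrite /= in_itv /=; exact: fK.
by rewrite Rintegral_cst//= fine_lebesgue_segment// mulrA.
Qed.

Lemma normc_rint h a b c d (K : R) : a <= b -> c <= d ->
  cont_rect h a b c d ->
  (forall x y, a <= x <= b -> c <= y <= d -> nc (h (x +i* y)) <= K) ->
  nc (rint h a b c d) <= 4 * K * ((b - a) + (d - c)).
Proof.
move=> ab cd H hK; apply: le_trans (ler_normcD _ _) _.
rewrite Normc.normcM normc_imag normr1 mul1r mulrDr; apply: lerD.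
  apply: le_trans (@normc_cint_segment _ a b (2 * K) _ (cinteg_rect_h cd H) _) _.
  - exact: ab.
  - move=> x xab; apply: le_trans (ler_normcB _ _) _.
    by rewrite mulr_natl mulr2n lerD// hK// ?lexx ?cd.
  - by rewrite mulrA -natrM.
apply: le_trans (@normc_cint_segment _ c d (2 * K) _ (cinteg_rect_v ab H) _) _.
- exact: cd.
- move=> x xab; apply: le_trans (ler_normcB _ _) _.
  by rewrite mulr_natl mulr2n lerD// hK// ?lexx ?ab.
- by rewrite mulrA -natrM.
Qed.

Lemma nested_segments (u l : nat -> R) : (forall n, 0 <= l n) ->
  (forall n, u n <= u n.+1) -> (forall n, u n.+1 + l n.+1 <= u n + l n) ->
  exists x, forall n, u n <= x <= u n + l n.
Proof.
move=> l0 uS ulS.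
have nd : forall m n, (m <= n)%N -> u m <= u n.
  by move=> m n mn; have /nondecreasing_seqP := uS; apply.
have ni : forall m n, (m <= n)%N -> u n + l n <= u m + l m.
  by move=> m n mn; have /(nonincreasing_seqP (fun i => u i + l i)) := ulS; apply.
have ub k : ubound (range u) (u k + l k).
  move=> _ [n _ <-]; have [nk|kn] := leqP n k.
    by rewrite (le_trans (nd _ _ nk))// lerDl.
  by apply: le_trans (ni _ _ (ltnW kn)); rewrite lerDl.
exists (sup (range u)) => n; apply/andP; split.
  by apply: ub_le_sup; [exists (u 0%N + l 0%N); exact: ub|exists n].
by apply: ge_sup; [exists (u 0%N); exists 0%N|exact: ub].
Qed.

Section bisection.
Variables (h : C -> C) (a b c d : R).
Hypotheses (ab : a <= b) (cd : c <= d).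
Hypothesis hdiff : forall x y, a <= x <= b -> c <= y <= d ->
  exists L, cdiff h (x +i* y) L.

Let l n : R := (b - a) / 2 ^+ n.
Let m n : R := (d - c) / 2 ^+ n.

Let l_ge0 n : 0 <= l n. Proof. by rewrite divr_ge0 ?subr_ge0 ?exprn_ge0. Qed.
Let m_ge0 n : 0 <= m n. Proof. by rewrite divr_ge0 ?subr_ge0 ?exprn_ge0. Qed.
Let lS n : l n = l n.+1 + l n.+1.
Proof. by rewrite /l exprS invfM; field; rewrite expf_neq0. Qed.
Let mS n : m n = m n.+1 + m n.+1.
Proof. by rewrite /m exprS invfM; field; rewrite expf_neq0. Qed.

Let hcont : cont_rect h a b c d.
Proof. by move=> x y xab ycd; have [L /cdiff_cont] := hdiff xab ycd. Qed.

Let Q n (p : R * R) := nc (rint h p.1 (p.1 + l n) p.2 (p.2 + m n)).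
Let inr n (p : R * R) :=
  [&& a <= p.1, p.1 + l n <= b, c <= p.2 & p.2 + m n <= d].

Let step n p : inr n p -> exists p' : R * R,
  [/\ p.1 <= p'.1, p'.1 + l n.+1 <= p.1 + l n,
      p.2 <= p'.2, p'.2 + m n.+1 <= p.2 + m n &
      Q n p <= 4 * Q n.+1 p'].
Proof.
case: p => x y /and4P[/= ax xb cy yd].
have l1 := l_ge0 n.+1; have m1 := m_ge0 n.+1.
have lE := lS n; have mE := mS n.
have H : cont_rect h x (x + l n) y (y + m n) by exact: cont_rectS hcont.
have E : rint h x (x + l n) y (y + m n) =
    rint h x (x + l n.+1) y (y + m n.+1) +
    rint h x (x + l n.+1) (y + m n.+1) (y + m n.+1 + m n.+1) +
    (rint h (x + l n.+1) (x + l n.+1 + l n.+1) y (y + m n.+1) +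
    rint h (x + l n.+1) (x + l n.+1 + l n.+1) (y + m n.+1) (y + m n.+1 + m n.+1)).
  rewrite -!(addrA _ (m n.+1)) -!(addrA _ (l n.+1)) -lE -mE.
  rewrite (@rint_split_h h x (x + l n.+1)); [|lra..|exact: H].
  rewrite (@rint_split_v h x (x + l n.+1) y (y + m n.+1)); [|lra..|]; last first.
    by apply: cont_rectS H; lra.
  rewrite (@rint_split_v h (x + l n.+1) _ y (y + m n.+1)); [|lra..|]; last first.
    by apply: cont_rectS H; lra.
  by [].
(* Some quarter carries at least a fourth of the modulus; if all four failed, the triangle
   inequality applied to [E] would be violated. *)
have [h1|h1] := leP (Q n (x, y)) (4 * Q n.+1 (x, y)).
  by exists (x, y); split => //=; clear h1; lra.
have [h2|h2] := leP (Q n (x, y)) (4 * Q n.+1 (x, y + m n.+1)).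
  by exists (x, y + m n.+1); split => //=; clear h1 h2; lra.
have [h3|h3] := leP (Q n (x, y)) (4 * Q n.+1 (x + l n.+1, y)).
  by exists (x + l n.+1, y); split => //=; clear h1 h2 h3; lra.
have [h4|h4] := leP (Q n (x, y)) (4 * Q n.+1 (x + l n.+1, y + m n.+1)).
  by exists (x + l n.+1, y + m n.+1); split => //=; clear h1 h2 h3 h4; lra.
exfalso; move: h1 h2 h3 h4.
have -> : Q n (x, y) = nc (rint h x (x + l n) y (y + m n)) by [].
rewrite E /Q /=.
set r1 := rint h x _ y _; set r2 := rint h x _ _ _.
set r3 := rint h _ _ y _; set r4 := rint h _ _ (y + _) _.
clear ax xb cy yd l1 m1 lE mE H E.
have := ler_normcD (r1 + r2) (r3 + r4).
have := ler_normcD r1 r2; have := ler_normcD r3 r4; lra.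
Qed.

(** Repeated bisection: the modulus loses at most a factor 4 per step, while perimeter and diameter
    both halve. The error of the linear approximation at the common point of the rectangles is [e]
    times the diameter, so the powers of 4 cancel and only a multiple of [e] remains. *)
Lemma goursat : rint h a b c d = 0.
Proof.
have /choice[nxt nxtP] : forall np : nat * (R * R), exists p' : R * R,
    inr np.1 np.2 ->
    [/\ np.2.1 <= p'.1, p'.1 + l np.1.+1 <= np.2.1 + l np.1,
      np.2.2 <= p'.2, p'.2 + m np.1.+1 <= np.2.2 + m np.1 &
      Q np.1 np.2 <= 4 * Q np.1.+1 p'].
  move=> [n p] /=; have [/step[p' Hp']|nin] := boolP (inr n p).
    by exists p'.
  by exists p.
(* Only the lower left corners are recorded; the side lengths at stage [n] are always [l n] and
   [m n]. *)
pose fix u n := if n is k.+1 then nxt (k, u k) else (a, c).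
have u_in n : inr n (u n).
  elim: n => [|n IH].
    rewrite /inr /= !lexx /l /m expr0 !divr1 !subrKC !lexx; by [].
  have [/= h1 h2 h3 h4 _] := nxtP (n, u n) IH.
  by move: IH => /and4P[i1 i2 i3 i4]; apply/and4P; split;
    [exact: le_trans h1|exact: le_trans i2|exact: le_trans h3|exact: le_trans i4].
have uS n := nxtP (n, u n) (u_in n).
have uQ n : Q 0%N (u 0%N) <= 4 ^+ n * Q n (u n).
  elim: n => [|n IH]; first by rewrite expr0 mul1r.
  have [_ _ _ _ /= h5] := uS n.
  by rewrite exprSr -mulrA (le_trans IH)// ler_pM2l ?exprn_gt0.
have [x0 Hx] : exists x, forall n, (u n).1 <= x <= (u n).1 + l n.
  by apply: nested_segments => // n; have [] := uS n.
have [y0 Hy] : exists x, forall n, (u n).2 <= x <= (u n).2 + m n.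
  by apply: nested_segments => // n; have [] := uS n.
have inx : a <= x0 <= b.
  have /and4P[i1 i2 _ _] := u_in 0%N; have /andP[j1 j2] := Hx 0%N.
  by rewrite (le_trans i1)// (le_trans j2).
have iny : c <= y0 <= d.
  have /and4P[_ _ i1 i2] := u_in 0%N; have /andP[j1 j2] := Hy 0%N.
  by rewrite (le_trans i1)// (le_trans j2).
have [L hL] := hdiff inx iny.
pose S := (b - a) + (d - c).
have S0 : 0 <= S by rewrite addr_ge0 ?subr_ge0.
have main e : 0 < e -> Q 0%N (u 0%N) <= 4 * e * S ^+ 2.
  move=> e0; have [del del0 Hdel] := hL e e0.
  have [n nP] : exists n, S / 2 ^+ n < del.
    have := @cvg_geometric R S 2^-1; rewrite ger0_norm ?invr_ge0// invf_lt1// ltr1n.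
    move=> /(_ isT) /cvgrPdist_lt /(_ _ del0)[n _ /(_ n (leqnn n))].
    rewrite /= sub0r normrN ger0_norm ?mulr_ge0 ?exprn_ge0 ?invr_ge0//.
    by rewrite exprVn; exists n.
  have /and4P[i1 i2 i3 i4] := u_in n.
  have Sn : l n + m n = S / 2 ^+ n by rewrite /l /m -mulrDl.
  have ln0 := l_ge0 n; have mn0 := m_ge0 n.
  pose g z := (h (x0 +i* y0) - L * (x0 +i* y0)) + L * z.
  have Hc : cont_rect h (u n).1 ((u n).1 + l n) (u n).2 ((u n).2 + m n).
    exact: cont_rectS hcont.
  have gc : cont_rect g (u n).1 ((u n).1 + l n) (u n).2 ((u n).2 + m n).
    move=> x y _ _; rewrite /g; apply: ccontD; first exact: ccont_cst.
    by apply: ccontM; [exact: ccont_cst|apply: cdiff_cont; exact: cdiff_id].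
  have E : rint h (u n).1 ((u n).1 + l n) (u n).2 ((u n).2 + m n) =
      rint (fun z => h z - g z) (u n).1 ((u n).1 + l n) (u n).2 ((u n).2 + m n).
    by rewrite rintB ?rint_affine ?lerDl ?subr0.
  have hgc : cont_rect (fun z => h z - g z)
      (u n).1 ((u n).1 + l n) (u n).2 ((u n).2 + m n).
    move=> x y xn yn; apply: ccontD; first exact: Hc.
    rewrite /g; under eq_fun do rewrite -mulN1r.
    apply: ccontM; first exact: ccont_cst.
    exact: gc.
  have bnd : Q n (u n) <= 4 * (e * (S / 2 ^+ n)) * (S / 2 ^+ n).
    rewrite /Q E.
    apply: le_trans (@normc_rint _ _ _ _ _ (e * (S / 2 ^+ n)) _ _ hgc _) _;
      rewrite ?lerDl//; last first.
      by rewrite (addrC (u n).1) (addrC (u n).2) !addrK Sn.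
    move=> x y xn yn.
    have dz : nc ((x +i* y) - (x0 +i* y0)) <= S / 2 ^+ n.
      apply: le_trans (normc_le_ReIm _) _; rewrite -Sn /=; apply: lerD.
        by have := Hx n; rewrite ler_norml; lra.
      by have := Hy n; rewrite ler_norml; lra.
    have := Hdel _ (le_lt_trans dz nP); rewrite (addrC (x0 +i* y0)) subrK => H.
    rewrite /g opprD opprB addrA.
    have -> : h (x +i* y) + (L * (x0 +i* y0) - h (x0 +i* y0)) - L * (x +i* y) =
      h (x +i* y) - h (x0 +i* y0) - L * ((x +i* y) - (x0 +i* y0)) by ring.
    by apply: le_trans H _; rewrite ler_pM2l.
  apply: le_trans (uQ n) _.
  apply: le_trans (ler_wpM2l _ bnd) _; first by rewrite exprn_ge0.
  rewrite (_ : 4 = 2 ^+ 2 :> R); last by ring.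
  rewrite -exprM mulnC exprM le_eqVlt; apply/orP; left; apply/eqP.
  by field; rewrite expf_neq0.
apply/eqP; rewrite -normc_eq0 eq_le normc_ge0 andbT.
have Q0 : Q 0%N (u 0%N) = nc (rint h a b c d).
  by rewrite /Q /= /l /m expr0 !divr1 !subrKC.
rewrite -Q0; apply/ler_addgt0Pl => e e0; rewrite addr0.
(* The added 1 keeps the divisor positive for a degenerate rectangle, where [S = 0]. *)
have D0 : 0 < 4 * S ^+ 2 + 1 by rewrite ltr_wpDl// mulr_ge0// sqr_ge0.
apply: le_trans (main _ (divr_gt0 e0 D0)) _.
rewrite mulrA -(mulrA 4) mulrAC mulrC.
rewrite [X in X <= _](_ : _ = e * (4 * S ^+ 2) / (4 * S ^+ 2 + 1)); last first.
  by field; rewrite gt_eqF.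
by rewrite ler_pdivrMr// ler_pM2l// lerDl.
Qed.

End bisection.
End Goursat.

(** * Tails of convergent integrals *)

Section Tails.
Variable R : realType.
Local Notation C := R[i].
Local Notation nc := (@Normc.normc R).
Local Notation mu := (@lebesgue_measure R).
Local Notation RM := (measurableTypeR R).
Implicit Types (A D : set RM) (u v : RM -> R) (f : RM -> C).

Lemma integS D A u : measurable A -> measurable D -> A `<=` D ->
  integ D u -> integ A u.
Proof. by move=> mA mD AD; exact: integrableS. Qed.

Lemma cintegS D A f : measurable A -> measurable D -> A `<=` D ->
  cinteg D f -> cinteg A f.
Proof. by move=> mA mD AD [h1 h2]; split; apply: integS AD _. Qed.

Lemma Rintegral_setC A u : measurable A -> integ setT u ->
  (\int[mu]_x u x = \int[mu]_(x in A) u x + \int[mu]_(x in ~` A) u x)%R.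
Proof.
move=> mA iu; rewrite -{1}(setUv A) Rintegral_setU ?setUv//.
  exact: measurableC.
by apply/disj_setPS => x [].
Qed.

Lemma cint_setC A f : measurable A -> cinteg setT f ->
  cint setT f = cint A f + cint (~` A) f.
Proof.
by move=> mA [f1 f2]; apply: eq_ReIm; rewrite ?ReD ?ImD /= -Rintegral_setC.
Qed.

Lemma le_Rintegral_set A D u : measurable A -> measurable D -> A `<=` D ->
  integ D u -> (forall x, 0 <= u x) ->
  (\int[mu]_(x in A) u x <= \int[mu]_(x in D) u x)%R.
Proof.
move=> mA mD AD iu u0; have iA := integS mA mD AD iu.
apply: fine_le; [exact: integrable_fin_num|exact: integrable_fin_num|].
apply: ge0_subset_integral => //; first by have /integrableP[] := iu.
by move=> x _; rewrite lee_fin.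
Qed.

(** [A] is any set containing the segment, because the rectangles of the strip argument have
    unrelated lower and upper heights. *)
Lemma Rintegral_tail u (e : R) : integ setT u -> (forall x, 0 <= u x) -> 0 < e ->
  exists n : nat, forall A, measurable A -> `[- n%:R, n%:R]%classic `<=` A ->
    (\int[mu]_(x in ~` A) u x < e)%R.
Proof.
move=> iu u0 e0; pose B n : set RM := `[- n%:R, n%:R]%classic.
have BT : \bigcup_n B n = setT.
  apply/seteqP; split => // x _; exists (Num.truncn `|x|).+1 => //=.
  rewrite /B /= in_itv /= -ler_norml.
  by apply: ltW; rewrite truncnS_gt.
have nB : nondecreasing_seq B.
  move=> m n mn; rewrite subsetEset => x; rewrite /B /= !in_itv /= => /andP[h1 h2].
  have mn' : m%:R <= n%:R :> R by rewrite ler_nat.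
  by rewrite (le_trans _ h1) ?lerN2// (le_trans h2).
have mB n : measurable (B n) by exact: measurable_itv.
have mu' : measurable_fun setT (EFin \o u) by have /integrableP[] := iu.
have := @ge0_nondecreasing_set_cvg_integral _ _ _ B (EFin \o u) mu nB mB.
move=> /(_ (fun i => measurable_funS measurableT (@subsetT _ _) mu')).
move=> /(_ (fun _ x _ => u0 x)); rewrite BT => cv.
have {cv} : (\int[mu]_(x in B i) u x)%R @[i --> \oo] --> (\int[mu]_x u x)%R.
  apply/fine_cvg; rewrite fineK//; exact: integrable_fin_num.
move=> /cvgrPdist_lt /(_ _ e0)[n _ /(_ n (leqnn n)) H].
exists n => A mA BA; apply: le_lt_trans H.
apply: le_trans (ler_norm _); rewrite (Rintegral_setC (mB n) iu) addrAC subrr add0r.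
apply: le_Rintegral_set => //; first exact: measurableC.
- exact: measurableC.
- exact: subsetC.
- by apply: integS iu => //; exact: measurableC.
Qed.

Lemma cint_tail f (e : R) : cinteg setT f -> 0 < e ->
  exists n : nat, forall A, measurable A -> `[- n%:R, n%:R]%classic `<=` A ->
    nc (cint setT f - cint A f) < e.
Proof.
move=> cf e0; have e20 : 0 < e / 2 by rewrite divr_gt0.
have inf := integ_normc measurableT cf.
have [n Hn] := Rintegral_tail inf (fun x => normc_ge0 _) e20.
exists n => A mA BA; rewrite (cint_setC mA cf) addrAC subrr add0r.
have mC : measurable (~` A) by exact: measurableC.
apply: le_lt_trans (normc_cint mC _) _; first exact: cintegS cf.
by have := Hn A mA BA; rewrite ltr_pdivlMr// mulrC.
Qed.

End Tails.

(** * Joint measurability of continuous functions *)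

Section ProductMeasurability.
Variable R : realType.
Local Notation RM := (measurableTypeR R).

(** An open set is the union of the countably many boxes with rational centre and radius
    [1 / (n + 1)] that it contains, and each box is a product of intervals. *)
Lemma open_measurable2 (U : set (R * R)) : open U ->
  measurable (U : set (RM * RM)).
Proof.
move=> oU.
pose box (p q : rat) (n : nat) : set (RM * RM) :=
  `](ratr p - n.+1%:R^-1), (ratr p + n.+1%:R^-1)[%classic `*`
  `](ratr q - n.+1%:R^-1), (ratr q + n.+1%:R^-1)[%classic.
pose F p q n := if `[< box p q n `<=` U >] then box p q n else set0.
have mF p q n : measurable (F p q n).
  by rewrite /F; case: asboolP => // _; apply: measurableX; exact: measurable_itv.
have -> : U = \bigcup_p \bigcup_q \bigcup_n F p q n.
  apply/seteqP; split => [[x y] Uxy|xy [p _ [q _ [n _]]]]; last first.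
    by rewrite /F; case: asboolP => // sub; exact: sub.
  have /nbhs_ballP[e /= e0 He] : nbhs (x, y) U by exact: open_nbhs_nbhs.
  have [n n0] : exists n : nat, n.+1%:R^-1 < e / 2.
    exists (Num.truncn (e / 2)^-1); rewrite invf_plt ?posrE ?divr_gt0//.
    by rewrite truncnS_gt.
  have i0 : 0 < n.+1%:R^-1 :> R by rewrite invr_gt0.
  have [k kE] : exists k : R, k = n.+1%:R^-1 by exists n.+1%:R^-1.
  rewrite -kE in n0 i0.
  have ratk z : exists q : rat, (z - k < ratr q) && (ratr q < z + k).
    have /rat_in_itvoo[q] : z - k < z + k by lra.
    by rewrite in_itv /=; exists q.
  have [p /andP[hp1 hp2]] := ratk x; have [q /andP[hq1 hq2]] := ratk y.
  exists p => //; exists q => //; exists n => //.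
  rewrite /F; case: asboolP => [_|].
    by rewrite /box /= !in_itv /= -kE; split; apply/andP; split; lra.
  case=> -[s t] [/=]; rewrite !in_itv /= -kE => /andP[s1 s2] /andP[t1 t2].
  by apply: He; split; rewrite /ball /= ltr_norml; apply/andP; split; lra.
apply: bigcupT_measurable_rat => p; apply: bigcupT_measurable_rat => q.
exact: bigcupT_measurable.
Qed.

Lemma continuous_measurable2 (f : R * R -> R) : continuous f ->
  measurable_fun setT (f : RM * RM -> R).
Proof.
move=> cf; apply: (measurability _ (RGenOInfty.measurableE R)).
move=> _ [_ [a ->] <-]; rewrite setTI; apply: open_measurable2.
by apply: open_comp => // x _; exact: cf.
Qed.

End ProductMeasurability.

(** * Shifting the line of integration across a vertical strip *)

Section Strip.
Variable R : realType.
Local Notation C := R[i].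
Local Notation nc := (@Normc.normc R).
Local Notation re := (@complex.Re R).
Local Notation im := (@complex.Im R).
Local Notation mu := (@lebesgue_measure R).
Local Notation RM := (measurableTypeR R).
Implicit Types (h : C -> C) (a b c d x y : R).

Lemma goursat_except h (p : C) a b c d :
  a < re p < b -> c < im p < d -> cont_rect h a b c d ->
  (forall x y, a <= x <= b -> c <= y <= d -> x +i* y <> p ->
    exists L, cdiff h (x +i* y) L) ->
  rint h a b c d = 0.
Proof.
case: p => p1 p2 /= /andP[ap pb] /andP[cp pd] hc hd.
have hp : ccont h (p1 +i* p2).
  by apply: hc; apply/andP; split; apply: ltW.
have [del del0 Hdel] := hp _ ltr01.
pose K := nc (h (p1 +i* p2)) + 1.
have K0 : 0 < K by rewrite ltr_wpDl// normc_ge0.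
(* Cutting off four rectangles that avoid [p] leaves a square of side [2 * t]
   around [p], on which [h] is bounded by [K]. *)
have small t : 0 < t -> t < p1 - a -> t < b - p1 -> t < p2 - c -> t < d - p2 ->
    t < del / 2 -> nc (rint h a b c d) <= 16 * K * t.
  move=> t0 t1 t2 t3 t4 t5.
  have z1 : rint h a (p1 - t) c d = 0.
    apply: goursat; [lra|lra|] => x y x1 y1; apply: hd; [lra|lra|].
    by case=> xp _; lra.
  have z2 : rint h (p1 + t) b c d = 0.
    apply: goursat; [lra|lra|] => x y x1 y1; apply: hd; [lra|lra|].
    by case=> xp _; lra.
  have z3 : rint h (p1 - t) (p1 + t) c (p2 - t) = 0.
    apply: goursat; [lra|lra|] => x y x1 y1; apply: hd; [lra|lra|].
    by case=> _ yp; lra.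
  have z4 : rint h (p1 - t) (p1 + t) (p2 + t) d = 0.
    apply: goursat; [lra|lra|] => x y x1 y1; apply: hd; [lra|lra|].
    by case=> _ yp; lra.
  rewrite (@rint_split_h _ h a (p1 - t)) ?z1 ?add0r//; [|lra..].
  have hc1 : cont_rect h (p1 - t) b c d by apply: cont_rectS hc; lra.
  rewrite (@rint_split_h _ h (p1 - t) (p1 + t)) ?z2 ?addr0//; [|lra..].
  have hc2 : cont_rect h (p1 - t) (p1 + t) c d by apply: cont_rectS hc; lra.
  rewrite (@rint_split_v _ h _ _ c (p2 - t)) ?z3 ?add0r//; [|lra..].
  have hc3 : cont_rect h (p1 - t) (p1 + t) (p2 - t) d by apply: cont_rectS hc; lra.
  rewrite (@rint_split_v _ h _ _ (p2 - t) (p2 + t)) ?z4 ?addr0//; [|lra..].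
  have hc4 : cont_rect h (p1 - t) (p1 + t) (p2 - t) (p2 + t).
    by apply: cont_rectS hc3; lra.
  apply: le_trans (@normc_rint _ h _ _ _ _ K _ _ hc4 _) _; [lra|lra| |]; last first.
    by rewrite le_eqVlt; apply/orP; left; apply/eqP; ring.
  move=> x y x1 y1; rewrite -[h (x +i* y)](subrK (h (p1 +i* p2))) /K addrC.
  apply: le_trans (ler_normcD _ _) _; rewrite lerD2l; apply/ltW/Hdel.
  apply: le_lt_trans (normc_le_ReIm _) _ => /=.
  have : `|x - p1| <= t by rewrite ler_norml; lra.
  have : `|y - p2| <= t by rewrite ler_norml; lra.
  lra.
apply/eqP; rewrite -normc_eq0 eq_le normc_ge0 andbT.
apply/ler_addgt0Pl => e e0; rewrite addr0.
have e0' : 0 < e / (16 * K) by rewrite divr_gt0// mulr_gt0.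
pose m := Num.min (e / (16 * K)) (Num.min (Num.min (p1 - a) (b - p1))
  (Num.min (Num.min (p2 - c) (d - p2)) (del / 2))).
have m0 : 0 < m by rewrite !lt_min e0' !subr_gt0 ap pb cp pd divr_gt0.
have m20 : 0 < m / 2 by rewrite divr_gt0.
have : m / 2 < m by lra.
rewrite {2}/m !lt_min => /andP[h1 /andP[/andP[h2 h3] /andP[/andP[h4 h5] h6]]].
apply: le_trans (small _ m20 h2 h3 h4 h5 h6) _.
by rewrite mulrC -ler_pdivlMr ?mulr_gt0//; exact: ltW.
Qed.

(* Clamping the abscissa turns continuity on the strip into continuity, hence
   joint measurability, on the whole plane. *)
Lemma measurable_strip h a b : a <= b ->
  (forall x y, a <= x <= b -> ccont h (x +i* y)) ->
  measurable_fun setT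
    (fun xy : RM * RM => nc (h (Num.max a (Num.min b xy.1) +i* xy.2))).
Proof.
move=> ab hc; apply: continuous_measurable2 => -[x y].
apply/cvgrPdist_lt => e e0.
have cl z : a <= Num.max a (Num.min b z) <= b.
  by rewrite le_max lexx ge_max ab ge_min lexx.
have clip s t : `|Num.max a (Num.min b s) - Num.max a (Num.min b t)| <= `|s - t|.
  have E z : [\/ Num.max a (Num.min b z) = a /\ z <= a,
      Num.max a (Num.min b z) = b /\ b <= z |
      Num.max a (Num.min b z) = z /\ a <= z <= b].
    have [bz|zb] := leP b z; first by constructor 2; rewrite max_r.
    by have [az|za] := leP a z; [constructor 3|constructor 1]; split => //; lra.
  have h1 := ler_norm (s - t); have := ler_norm (t - s).
  rewrite (distrC t) => h2.
  by rewrite ler_norml; case: (E s) => [[-> ?]|[-> ?]|[-> ?]];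
    case: (E t) => [[-> ?]|[-> ?]|[-> ?]]; lra.
have [del del0 Hdel] := hc _ y (cl x) e e0.
have del20 : 0 < del / 2 by rewrite divr_gt0.
apply: filterS (nbhsx_ballx (x, y) _ del20) => -[s t] [/=]; rewrite /ball /=.
move=> xs yt.
have /Hdel H : nc ((Num.max a (Num.min b s) +i* t) -
    (Num.max a (Num.min b x) +i* y)) < del.
  apply: le_lt_trans (normc_le_ReIm _) _ => /=.
  have := clip s x; rewrite (distrC s) (distrC t); lra.
rewrite ltr_norml; apply/andP; split.
  rewrite -ltrN2 opprK opprB; apply: le_lt_trans H.
  by rewrite lerBlDr; rewrite -{1}(subrK (h (Num.max a (Num.min b x) +i* y))
    (h (Num.max a (Num.min b s) +i* t))) ler_normcD.
apply: le_lt_trans H; rewrite normc_distC lerBlDr.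
by rewrite -{1}(subrK (h (Num.max a (Num.min b s) +i* t))
    (h (Num.max a (Num.min b x) +i* y))) ler_normcD.
Qed.

(** Markov's inequality: if [E] were at least [k] on the whole segment, its integral would be at
    least [k * l > K]. *)
Lemma exists_small_value (E : RM -> \bar R) (K k s l : R) :
  measurable_fun setT E -> (forall t, (0 <= E t)%E) ->
  (\int[mu]_t E t <= K%:E)%E -> 0 < k -> 0 <= l -> K < k * l ->
  exists2 t, s <= t <= s + l & (E t < k%:E)%E.
Proof.
move=> mE E0 EK k0 l0 Kl; apply: contrapT => noE.
have kE t : s <= t <= s + l -> (k%:E <= E t)%E.
  by move=> ts; rewrite leNgt; apply/negP => Et; apply: noE; exists t.
have sl : s <= s + l by rewrite lerDl.
have : ((k * l)%:E <= \int[mu]_t E t)%E.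
  apply: (@le_trans _ _ (\int[mu]_(t in `[s, (s + l)%R]) E t)%E); last first.
    by apply: ge0_subset_integral => //; exact: measurable_itv.
  have -> : ((k * l)%:E = \int[mu]_(t in `[s, (s + l)%R]) k%:E)%E.
    rewrite integral_cst//= lebesgue_measure_itv/= lte_fin.
    move: l0; rewrite le_eqVlt => /predU1P[<-|l0].
      by rewrite addr0 ltxx mule0 mulr0.
    by rewrite ltrDl l0 -EFinM addrAC subrr add0r.
  apply: ge0_le_integral => //=.
  - by move=> t _; rewrite lee_fin ltW.
  - exact: measurable_funS mE.
by move=> /le_trans /(_ EK); rewrite lee_fin leNgt Kl.
Qed.

Lemma cinteg_line h x (M : R) : (forall y, ccont h (x +i* y)) ->
  (\int[mu]_y (nc (h (x +i* y)))%:E <= M%:E)%E ->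
  cinteg setT (fun y => h (x +i* y)).
Proof.
move=> hc hM; have mh := cmeas_vertical hc.
apply: (cinteg_le measurableT mh) (fun _ _ => lexx _).
apply/integrableP; split; first by apply/measurable_EFinP; exact: measurable_normc.
under eq_integral => y _ do rewrite /= ger0_norm ?normc_ge0//.
by apply: le_lt_trans hM _; rewrite ltry.
Qed.

(* The integrals over vertical lines are uniformly bounded, so by Tonelli the
   horizontal sides of the rectangles are small at arbitrarily large heights. *)
Lemma strip_shift h (p : C) a b (M : R) : a < re p < b ->
  (forall x y, a <= x <= b -> ccont h (x +i* y)) ->
  (forall x y, a <= x <= b -> x +i* y <> p -> exists L, cdiff h (x +i* y) L) ->
  (forall x, a <= x <= b -> (\int[mu]_y (nc (h (x +i* y)))%:E <= M%:E)%E) ->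
  cint setT (fun y => h (a +i* y)) = cint setT (fun y => h (b +i* y)).
Proof.
move=> /andP[ap pb] hc hd hM; have ab : a <= b by lra.
have aab : a <= a <= b by rewrite lexx.
have bab : a <= b <= b by rewrite lexx ab.
have ca := cinteg_line (fun y => hc a y aab) (hM a aab).
have cb := cinteg_line (fun y => hc b y bab) (hM b bab).
have M0 : 0 <= M.
  rewrite -lee_fin; apply: le_trans (hM a aab).
  by apply: integral_ge0 => y _; rewrite lee_fin normc_ge0.
pose cl x := Num.max a (Num.min b x).
have clE x : a <= x <= b -> cl x = x.
  by move=> /andP[ax xb]; rewrite /cl min_r// max_r.
(* The indicator undoes the clamping outside the strip, so that [E w] below is the integral of
   [nc h] over the horizontal side at height [w]. *)
pose f (xy : RM * RM) := (\1_(`[a, b]%classic : set RM) xy.1 *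
  nc (h (cl xy.1 +i* xy.2)))%:E.
have mf : measurable_fun setT f.
  apply/measurable_EFinP; apply: measurable_funM; last exact: measurable_strip.
  have m1 : measurable_fun setT (\1_(`[a, b]%classic : set RM) : RM -> R).
    exact: measurable_indic.
  exact: (measurableT_comp m1 measurable_fst).
have f0 xy : (0 <= f xy)%E by rewrite lee_fin mulr_ge0 ?normc_ge0.
pose E w := (\int[mu]_x f (x, w))%E.
have mE : measurable_fun setT E by exact: (measurable_fun_fubini_tonelli_G (m1 := mu) f mf f0).
have E0 w : (0 <= E w)%E by apply: integral_ge0 => x _; exact: f0.
have EK : (\int[mu]_w E w <= (M * (b - a))%:E)%E.
  rewrite -(fubini_tonelli (m1 := mu) (m2 := mu) f mf f0).
  have -> : ((M * (b - a))%:E =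
      \int[mu]_x (M * \1_(`[a, b]%classic : set RM) x)%:E)%E.
    under eq_integral do rewrite EFinM.
    rewrite ge0_integralZl//=; last first.
      by apply/measurable_EFinP.
    rewrite integral_indic//= setIT lebesgue_measure_itv/= lte_fin.
    by rewrite (lt_trans ap pb) -EFinM.
  apply: ge0_le_integral => //=.
  - by move=> x _; apply: integral_ge0.
  - exact: (measurable_fun_fubini_tonelli_F (m2 := mu) f mf f0).
  - by apply/measurable_EFinP; apply: measurable_funM.
  move=> x _; rewrite /f /= indicE.
  have [xab|xab] := boolP (x \in _); last first.
    by under eq_integral do rewrite mul0r; rewrite integral0 mulr0.
  rewrite mulr1; under eq_integral do rewrite mul1r.
  move: xab; rewrite inE /= in_itv /= => xab; rewrite clE//.
  exact: hM.
have EE w : E w = (\int[mu]_(x in `[a, b]) nc (h (x +i* w)))%R%:E.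
  have cw : cinteg `[a, b] (fun x => h (x +i* w)).
    by apply: cinteg_horizontal => x xab; exact: hc.
  rewrite /Rintegral fineK; last first.
    by apply: integrable_fin_num => //; exact: integ_normc.
  rewrite integral_mkcond; apply: eq_integral => x _.
  rewrite /f /= indicE patchE; case: ifPn => [xab|_]; last by rewrite mul0r.
  by rewrite mul1r clE//; move: xab; rewrite inE /= in_itv.
have horiz w k : (E w < k%:E)%E -> nc (cint `[a, b] (fun x => h (x +i* w))) <= 2 * k.
  rewrite EE lte_fin => Ek.
  have cw : cinteg `[a, b] (fun x => h (x +i* w)).
    by apply: cinteg_horizontal => x xab; exact: hc.
  apply: le_trans (normc_cint _ cw) _; first exact: measurable_itv.
  by rewrite ler_pM2l// ltW.
apply/esym/eqP; rewrite -subr_eq0 -normc_eq0 eq_le normc_ge0 andbT -cintB//.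
apply/ler_addgt0Pl => e e0; rewrite addr0.
(* Each horizontal side contributes at most [2 * (e / 5)] and the tail of the vertical integrals at
   most [e / 5]. *)
have e50 : 0 < e / 5 by rewrite divr_gt0.
have cab := cintegB measurableT cb ca.
have [n Hn] := cint_tail cab e50.
(* A segment so long that [E] cannot exceed [e / 5] all along it. Beyond the height [N] the
   rectangle contains both [p] and the segment supplied by the tail estimate. *)
pose l := (M * (b - a) + 1) / (e / 5).
have l0 : 0 <= l by rewrite divr_ge0 ?ltW// ltr_wpDl ?mulr_ge0 ?subr_ge0.
have Kl : M * (b - a) < e / 5 * l by rewrite /l mulrCA divff ?gt_eqF// mulr1 ltrDl.
pose N := n%:R + `|im p| + 1.
have N0 : 0 <= N by rewrite /N addr_ge0 ?addr_ge0.
have [t2 /andP[t2N _] /horiz h2] := exists_small_value N mE E0 EK e50 l0 Kl.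
have [t1 /andP[_ t1N] /horiz h1] := exists_small_value (- N - l) mE E0 EK e50 l0 Kl.
rewrite subrK in t1N.
have nN : n%:R + `|im p| < N by rewrite /N ltrDl.
have imp : t1 < im p < t2.
  have := ler_norm (im p); have := ler_norm (- im p); rewrite normrN.
  have : 0 <= n%:R :> R by []. lra.
have nt1 : t1 <= - n%:R by have := normr_ge0 (im p); lra.
have nt2 : n%:R <= t2 by have := normr_ge0 (im p); lra.
have sub : `[- n%:R, n%:R]%classic `<=` `[t1, t2]%classic.
  move=> y /=; rewrite !in_itv /= => /andP[h3 h4].
  by rewrite (le_trans nt1)// (le_trans h4).
have := Hn _ (measurable_itv _) sub.
have : rint h a b t1 t2 = 0.
  apply: (@goursat_except _ p) => //; first by rewrite ap.
  - by move=> x y xab _; exact: hc.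
  - by move=> x y xab _; exact: hd.
move=> /eqP; rewrite /rint addr_eq0 => /eqP rE.
have ct w : cinteg `[a, b] (fun x => h (x +i* w)).
  by apply: cinteg_horizontal => x xab; exact: hc.
have vE : nc (cint `[t1, t2] (fun y => h (b +i* y) - h (a +i* y))) <= 4 * (e / 5).
  have nci V : nc V = nc ('i * V) by rewrite Normc.normcM normc_imag normr1 mul1r.
  rewrite nci -normcN -rE cintB//; apply: le_trans (ler_normcB _ _) _.
  by apply: le_trans (lerD h1 h2) _; lra.
move=> tl; rewrite -(subrK (cint `[t1, t2] (fun y => h (b +i* y) - h (a +i* y)))
  (cint setT _)).
apply: le_trans (ler_normcD _ _) _; lra.
Qed.

End Strip.

(** * Boundary values in the Hardy space *)

Section SquareIntegrable.
Variable R : realType.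
Local Notation C := R[i].
Local Notation nc := (@Normc.normc R).
Local Notation mu := (@lebesgue_measure R).
Local Notation RM := (measurableTypeR R).
Implicit Types (f g : RM -> C) (u v : RM -> R).

Definition l2 f := cmeas setT f /\ integ setT (fun x => nc (f x) ^+ 2).

Definition n2 f : R := (\int[mu]_x nc (f x) ^+ 2)%R.

Lemma n2_ge0 f : 0 <= n2 f.
Proof. by apply: Rintegral_ge0 => x _; rewrite sqr_ge0. Qed.

Lemma l2_bounded f (M : R) : cmeas setT f ->
  (\int[mu]_x (nc (f x) ^+ 2)%:E <= M%:E)%E -> l2 f /\ n2 f <= M.
Proof.
move=> mf fM; have sf : l2 f.
  split=> //; apply/integrableP; split.
    by apply/measurable_EFinP; exact: measurable_sqr_normc.
  under eq_integral => y _ do rewrite /= ger0_norm ?sqr_ge0//.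
  by apply: le_lt_trans fM _; rewrite ltry.
split => //; rewrite -lee_fin /n2 /Rintegral fineK//.
by apply: integrable_fin_num => //; have [] := sf.
Qed.

Lemma l2_le f u : cmeas setT f -> integ setT u -> (forall x, nc (f x) ^+ 2 <= u x) ->
  l2 f.
Proof.
move=> mf iu fu; split => //; apply: (integ_le measurableT _ iu).
  exact: measurable_sqr_normc.
by move=> x _; rewrite ger0_norm ?sqr_ge0.
Qed.

Lemma l2D f g : l2 f -> l2 g -> l2 (fun x => f x + g x).
Proof.
move=> [mf sf] [mg sg].
apply: (l2_le (cmeasD mf mg) (integZ 2 measurableT (integD measurableT sf sg))).
move=> x; apply: (@le_trans _ _ ((nc (f x) + nc (g x)) ^+ 2)).
  by rewrite ler_pXn2r ?nnegrE ?addr_ge0 ?normc_ge0 ?ler_normcD.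
have := sqr_ge0 (nc (f x) - nc (g x)); nra.
Qed.

Lemma l2Mbounded f g (K : R) : l2 f -> cmeas setT g -> (forall x, nc (g x) <= K) ->
  l2 (fun x => g x * f x).
Proof.
move=> [mf sf] mg gK.
apply: (l2_le (cmeasM mg mf) (integZ (K ^+ 2) measurableT sf)) => x.
rewrite Normc.normcM exprMn ler_wpM2r ?sqr_ge0// ler_pXn2r ?nnegrE ?normc_ge0//.
exact: le_trans (normc_ge0 _) (gK x).
Qed.

Lemma l2Z f (c : C) : l2 f -> l2 (fun x => c * f x).
Proof.
by move=> sf; apply: (@l2Mbounded f (fun=> c) (nc c)).
Qed.

Lemma l2N f : l2 f -> l2 (fun x => - f x).
Proof. by move=> /(l2Z (-1)); under eq_fun do rewrite mulN1r. Qed.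

Lemma l2B f g : l2 f -> l2 g -> l2 (fun x => f x - g x).
Proof. by move=> sf sg; apply: l2D => //; exact: l2N. Qed.

Lemma l2_conj f : l2 f -> l2 (fun x => (f x)^*).
Proof.
move=> [mf sf]; split; first exact: cmeas_conj.
by apply: (eq_integ measurableT _ sf) => x _; rewrite normc_conj.
Qed.

Lemma l2_integ_normcM f g : l2 f -> l2 g -> integ setT (fun x => nc (f x) * nc (g x)).
Proof.
move=> [mf sf] [mg sg].
apply: (integ_le measurableT _ (integD measurableT sf sg)).
  by apply: measurable_funM; exact: measurable_normc.
move=> x _; rewrite ger0_norm ?mulr_ge0 ?normc_ge0//.
have := sqr_ge0 (nc (f x) - nc (g x)); have := sqr_ge0 (nc (f x) + nc (g x)).
nra.
Qed.

Lemma l2_cintegM f g : l2 f -> l2 g -> cinteg setT (fun x => f x * g x).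
Proof.
move=> sf sg; have [mf _] := sf; have [mg _] := sg.
apply: (cinteg_le measurableT (cmeasM mf mg) (l2_integ_normcM sf sg)) => x _.
by rewrite Normc.normcM.
Qed.

Lemma cauchy_schwarz f g : l2 f -> l2 g ->
  (\int[mu]_x (nc (f x) * nc (g x)))%R ^+ 2 <= n2 f * n2 g.
Proof.
move=> sf sg; set I := (\int[mu]_x _)%R.
have ifg := l2_integ_normcM sf sg.
have [_ f2] := sf; have [_ g2] := sg.
have quad t : 0 <= t ^+ 2 * n2 f - 2 * t * I + n2 g.
  have -> : t ^+ 2 * n2 f - 2 * t * I + n2 g =
      (\int[mu]_x (t ^+ 2 * nc (f x) ^+ 2 - 2 * t * (nc (f x) * nc (g x))
        + nc (g x) ^+ 2))%R.
    rewrite RintegralD//; last first.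
      by apply: integB => //; exact: integZ.
    by rewrite RintegralB ?RintegralZl//; exact: integZ.
  apply: Rintegral_ge0 => x _.
  by have := sqr_ge0 (t * nc (f x) - nc (g x)); nra.
have := n2_ge0 f; rewrite le_eqVlt => /predU1P[f0|f0].
  have : I = 0; last by move=> ->; rewrite -f0 mul0r expr0n.
  apply/eqP; apply: contraT => I0.
  (* With [n2 f = 0] the quadratic is affine in [t], and this [t] makes it equal to -1. *)
  have := quad ((n2 g + 1) / (2 * I)).
  rewrite -f0 mulr0 sub0r.
  have -> : 2 * ((n2 g + 1) / (2 * I)) * I = n2 g + 1 by field.
  lra.
(* The minimizer of the quadratic. *)
have := quad (I / n2 f).
have -> : (I / n2 f) ^+ 2 * n2 f - 2 * (I / n2 f) * I + n2 g =
  n2 g - I ^+ 2 / n2 f by field; rewrite gt_eqF.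
by rewrite subr_ge0 ler_pdivrMr// mulrC.
Qed.

Lemma normc_cintM f g : l2 f -> l2 g ->
  nc (cint setT (fun x => f x * g x)) ^+ 2 <= 4 * (n2 f * n2 g).
Proof.
move=> sf sg; apply: (@le_trans _ _
    ((2 * \int[mu]_x (nc (f x) * nc (g x)))%R ^+ 2)).
  rewrite ler_pXn2r ?nnegrE ?normc_ge0//; last first.
    apply: mulr_ge0 => //; apply: Rintegral_ge0 => x _.
    by rewrite mulr_ge0 ?normc_ge0.
  apply: (normc_cint_le measurableT _ (l2_integ_normcM sf sg)).
    by have [? _] := sf; have [? _] := sg; exact: cmeasM.
  by move=> x _; rewrite Normc.normcM.
by rewrite exprMn -natrX ler_pM2l// cauchy_schwarz.
Qed.

Lemma eq_n2 f g : f =1 g -> n2 f = n2 g.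
Proof. by move=> fg; apply: eq_Rintegral => x _; rewrite fg. Qed.

End SquareIntegrable.

(** * Lorentzian functions and their integrals *)

Section Lorentzian.
Variable R : realType.
Local Notation mu := (@lebesgue_measure R).
Local Notation RM := (measurableTypeR R).
Implicit Types (s q t : R).

(** Equals [|i t - p|^-2] for [p = s + i q]; for positive [s], multiplied by [s / pi], it is the
    Poisson kernel of the right half-plane at [p]. *)
Definition lor s q (t : RM) : R := (s ^+ 2 + (t - q) ^+ 2)^-1.

Lemma lor_ge0 s q t : 0 <= lor s q t.
Proof. by rewrite invr_ge0 addr_ge0 ?sqr_ge0. Qed.

Lemma integral_oneDsqrV : (\int[mu]_t ((1 + t ^+ 2)^-1)%:E = pi%:E :> \bar R)%E.
Proof.
pose G t : R := (oneDsqr t)^-1.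
have cG : continuous G by exact: continuous_oneDsqrV.
have mG : measurable_fun [set: RM] (EFin \o G).
  by apply/measurable_EFinP; exact: continuous_measurable_fun.
have G0 t : 0 <= G t by rewrite invr_ge0 (le_trans _ (oneDsqr_ge1 t)).
have -> : [set: RM] = `]-oo, 0%R[%classic `|` `[0%R, +oo[%classic.
  apply/seteqP; split => // t _ /=; rewrite !in_itv /= andbT.
  by case: (ltP t 0) => ?; [left|right].
rewrite ge0_integral_setU//=; last first.
- apply/disj_setPS => t [/=]; rewrite !in_itv /= andbT => t1 t2; lra.
- by move=> t _; rewrite lee_fin G0.
- exact: measurable_funS mG.
rewrite (integral0y_oneDsqr R).
have -> : (\int[mu]_(t in `]-oo, 0%R[) ((1 + t ^+ 2)^-1)%:E =
    \int[mu]_(t in `]-oo, 0%R]) (G (- t))%:E)%E.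
  rewrite integral_itv_bndo_bndc; last exact: measurable_funS mG.
  by apply: eq_integral => t _; rewrite /G /oneDsqr sqrrN.
rewrite -(ge0_integration_by_substitution0 mG)//.
by rewrite (integral0y_oneDsqr R) -EFinD -splitr.
Qed.

Lemma integral_lor s q : 0 < s -> (\int[mu]_t (lor s q t)%:E = (pi / s)%:E)%E.
Proof.
move=> s0.
pose F t := (t - q) / s; pose G t : R := (oneDsqr t)^-1.
have cG : continuous G by exact: continuous_oneDsqrV.
have G0 t : 0 <= G t by rewrite invr_ge0 (le_trans _ (oneDsqr_ge1 t)).
have dF t : is_derive t 1 F s^-1.
  rewrite /F; apply: is_derive_eq.
  by rewrite subr0 scaler0 add0r /GRing.scale /= mulr1.
have F'E : F^`()%classic = (fun=> s^-1).
  by apply/funext => t; rewrite derive1E derive_val.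
have subst : (\int[mu]_t (G t)%:E = \int[mu]_t (((G \o F) * F^`()%classic) t)%:E)%E.
  apply: increasing_ge0_integration_by_substitutionT => //.
  - by move=> t t' tt'; rewrite /F ltr_pM2r ?invr_gt0// ltrD2r.
  - by rewrite F'E => t; exact: cst_continuous.
  - by rewrite F'E; exact: is_cvg_cst.
  - by rewrite F'E; exact: is_cvg_cst.
  - by apply/gt0_cvgMlNy; rewrite ?invr_gt0//; exact: cvg_addrr_Ny.
  - by apply/gt0_cvgMly; rewrite ?invr_gt0//; exact: cvg_addrr.
have -> : (\int[mu]_t (lor s q t)%:E =
    \int[mu]_t (s^-1%:E * (((G \o F) * F^`()%classic) t)%:E))%E.
  apply: eq_integral => t _; rewrite -EFinM; congr EFin.
  rewrite F'E /G /F /lor /oneDsqr /= /GRing.mul /= -!/(GRing.mul _ _).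
  field; rewrite gt_eqF//= gt_eqF// ltr_pwDl ?exprn_gt0// sqr_ge0.
  by [].
have mGF : measurable_fun [set: RM] ((G \o F) * F^`()%classic).
  rewrite F'E; apply: measurable_funM => //.
  apply: measurableT_comp; first exact: continuous_measurable_fun.
  by apply: measurable_funM => //; apply: measurable_funB.
rewrite ge0_integralZl//=.
- by rewrite -subst integral_oneDsqrV -EFinM mulrC.
- exact/measurable_EFinP.
- by move=> t _; rewrite F'E lee_fin mulr_ge0// ?invr_ge0 ?ltW// G0.
- by rewrite lee_fin invr_ge0 ltW.
Qed.

Lemma integ_lor s q : 0 < s -> integ setT (lor s q).
Proof.
move=> s0; apply/integrableP; split.
  apply/measurable_EFinP; apply: continuous_measurable_fun => t.
  apply: cvgV; first by rewrite gt_eqF// ltr_pwDl ?exprn_gt0// sqr_ge0.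
  apply: cvgD; first exact: cvg_cst.
  apply: (@cvg_comp _ _ _ (fun t => t - q) (fun x => x ^+ 2)); last first.
    exact: exprn_continuous.
  by apply: cvgB; [exact: cvg_id|exact: cvg_cst].
under eq_integral => y _ do rewrite /= ger0_norm ?lor_ge0//.
by rewrite integral_lor// ltry.
Qed.

Lemma Rintegral_lor s q : 0 < s -> (\int[mu]_t lor s q t)%R = pi / s.
Proof. by move=> s0; rewrite /Rintegral integral_lor. Qed.

End Lorentzian.

(** * Cauchy's formula on a line inside the half-plane *)

Section HardyKernel.
Variable R : realType.
Local Notation C := R[i].
Local Notation nc := (@Normc.normc R).
Local Notation re := (@complex.Re R).
Local Notation im := (@complex.Im R).
Local Notation mu := (@lebesgue_measure R).
Local Notation RM := (measurableTypeR R).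
Implicit Types (f : C -> C) (p m z : C) (x y s t M : R).

Definition scalar_hardy f M :=
  (forall z, 0 < re z -> exists L, cdiff f z L) /\
  forall x, 0 < x -> (\int[mu]_w (nc (f (x +i* w)) ^+ 2)%:E <= M%:E)%E.

Lemma scalar_hardy_l2 f M x : scalar_hardy f M -> 0 < x ->
  l2 (fun w => f (x +i* w)) /\ n2 (fun w => f (x +i* w)) <= M.
Proof.
move=> [fd fM] x0; apply: l2_bounded; last exact: fM.
by apply: cmeas_vertical => w; have [//|L /cdiff_cont] := fd (x +i* w).
Qed.

Lemma scalar_hardy_ge0 f M : scalar_hardy f M -> 0 <= M.
Proof.
by move=> /scalar_hardy_l2 /(_ ltr01)[_]; apply: le_trans; exact: n2_ge0.
Qed.

Lemma cdiff_shift f (a : C) z L : cdiff f (a + z) L ->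
  cdiff (fun w => f (a + w)) z L.
Proof.
move=> fL; have := @cdiff_affine R f a 1 z L; rewrite mul1r => /(_ fL).
by under eq_fun do rewrite mul1r; rewrite mulr1.
Qed.

Lemma ccont_removable (u : C -> C) p L : cdiff u p L -> u p = 0 ->
  ccont (fun z => if z == p then L else u z / (z - p)) p.
Proof.
move=> uL up e e0; have e20 : 0 < e / 2 by rewrite divr_gt0.
have [d d0 Hd] := uL _ e20; exists d => // w wd; rewrite eqxx.
have [_|wp] := eqVneq w p; first by rewrite subrr Normc.normc0.
have wp0 : w - p != 0 by rewrite subr_eq0.
have := Hd _ wd; rewrite (addrC p) subrK up subr0 => H.
have -> : u w / (w - p) - L = (u w - L * (w - p)) / (w - p) by field.
rewrite Normc.normcM Normc.normcV ltr_pdivrMr ?normc_gt0//.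
apply: le_lt_trans H _; rewrite ltr_pM2r ?normc_gt0//; lra.
Qed.

Lemma mul_le_sqrD (a b : R) : a * b <= a ^+ 2 + b ^+ 2.
Proof. have := sqr_ge0 (a - b); have := sqr_ge0 (a + b); nra. Qed.

Lemma sqr_sub_conj (t : R) p :
  ((0 +i* t) + p^*) * ((0 +i* t) - p) = - (re p ^+ 2 + (t - im p) ^+ 2)%:C.
Proof. by case: p => a b; apply: eq_ReIm => /=; ring. Qed.

Section kernel.
Variables (f : C -> C) (M : R) (y : R) (p m : C).
Hypotheses (fH : scalar_hardy f M) (y0 : 0 < y) (p0 : 0 < re p) (m0 : re m < 0).

(* [u] vanishes at [p], and on the imaginary axis [1 / ((z + p^* ) * (z - p))]
   is minus a Lorentzian, whose integral is known. Hence [u z / (z - p)] is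
   holomorphic away from [p] and continuous at [p], its integral does not depend
   on the vertical line, and it decays as the line moves to +oo. *)
Let c0 : C := f (y%:C + p) / (p - m) * (p + p^*).
Let u z : C := f (y%:C + z) / (z - m) - c0 / (z + p^*).

Let zm z : 0 <= re z -> z - m != 0.
Proof.
move=> z0; rewrite subr_eq0; apply: contraTneq z0 => ->; by rewrite leNgt m0.
Qed.

Let zp z : 0 <= re z -> z + p^* != 0.
Proof.
move=> z0; rewrite -normc_gt0 (lt_le_trans _ (le_trans (ler_norm _) (ler_Re_normc _)))//.
by rewrite ReD ReJ ltr_wpDl.
Qed.

Let u_diff z : 0 <= re z -> exists L, cdiff u z L.
Proof.
move=> z0; have [|L fL] := fH.1 (y%:C + z).
  by rewrite ReD /= ltr_pwDl.
eexists; apply: cdiffB.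
  apply: cdiffM; first exact: cdiff_shift fL.
  apply: cdiffV; first exact: zm.
  by apply: cdiffB; [exact: cdiff_id|exact: cdiff_cst].
apply: cdiffM; first exact: cdiff_cst.
apply: cdiffV; first exact: zp.
by apply: cdiffD; [exact: cdiff_id|exact: cdiff_cst].
Qed.

Let up0 : u p = 0.
Proof. by rewrite /u /c0 -mulrA divff ?mulr1 ?subrr// zp// ltW. Qed.

Let kernel_vanish : exists L, cdiff u p L /\
  let h z := if z == p then L else u z / (z - p) in
  cint setT (fun t => h (0 +i* t)) = 0 /\ cinteg setT (fun t => h (0 +i* t)).
Proof.
have [L uL] := u_diff (ltW p0).
exists L; split => //; set h := fun z => _; cbv zeta.
have hp : h p = L by rewrite /h eqxx.
have hc_p : ccont h p by exact: ccont_removable.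
have hNp z : z != p -> h z = u z / (z - p) by rewrite /h => /negbTE ->.
have hd z : 0 <= re z -> z != p -> exists L, cdiff h z L.
  move=> z0 zNp; have [K uK] := u_diff z0.
  have zp0 : z - p != 0 by rewrite subr_eq0.
  eexists; apply: (@near_eq_cdiff _ (fun z => u z / (z - p)) _ _ _ (nc (z - p))).
  - by rewrite normc_gt0.
  - move=> w wz; rewrite hNp//; apply: contraTneq wz => ->.
    by rewrite normc_distC ltxx.
  - apply: cdiffM; first exact: uK.
    apply: cdiffV => //.
    by apply: cdiffB; [exact: cdiff_id|exact: cdiff_cst].
have hc z : 0 <= re z -> ccont h z.
  move=> z0; have [->//|zNp] := eqVneq z p.
  by have [K /cdiff_cont] := hd _ z0 zNp.
have [d1 d10 Hd1] := hc_p _ ltr01.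
pose Kc := nc c0; have Kc0 : 0 <= Kc by exact: normc_ge0.
pose P := re p; have P0 : 0 < P by exact: p0.
pose q := im p; pose mu0 := - re m.
have mu00 : 0 < mu0 by rewrite oppr_gt0.
pose F x w := nc (f ((y + x) +i* w)).
have F0 x w : 0 <= F x w by exact: normc_ge0.
(* Products are bounded by sums of squares, which leaves [F ^+ 2], of integral at most [M], and
   terms that are later dominated by Lorentzians. *)
have h_le x w (a b cm : R) : 0 <= x -> x +i* w != p ->
    0 < cm -> cm <= x - re m ->
    nc ((x +i* w) - p) ^- 2 <= a -> nc ((x +i* w) + p^*) ^- 2 <= b ->
    nc (h (x +i* w)) <= cm^-1 * (F x w ^+ 2 + a) + Kc * (a + b).
  move=> x0 xNp cm0 cmx ha hb; rewrite hNp// Normc.normcM Normc.normcV.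
  set A := (nc (_ - p))^-1; have A0 : 0 <= A by rewrite invr_ge0 normc_ge0.
  pose B := (nc ((x +i* w) + p^*))^-1.
  have B0 : 0 <= B by rewrite invr_ge0 normc_ge0.
  have hA : A ^+ 2 <= a by rewrite exprVn.
  have hB : B ^+ 2 <= b by rewrite exprVn.
  have um : nc (u (x +i* w)) <= cm^-1 * F x w + Kc * B.
    apply: le_trans (ler_normcB _ _) _; rewrite (Normc.normcM c0) (Normc.normcM (f _)).
    rewrite !Normc.normcV; apply: lerD; last exact: lexx.
    rewrite (_ : y%:C + (x +i* w) = (y + x) +i* w); last first.
      by apply: eq_ReIm; rewrite /= ?add0r.
    have zmn : cm <= nc ((x +i* w) - m).
      apply: le_trans cmx _; rewrite -ReN -(ReD (x +i* w)).
      exact: le_trans (ler_norm _) (ler_Re_normc _).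
    rewrite mulrC ler_wpM2r ?normc_ge0// lef_pV2 ?posrE//.
    exact: lt_le_trans cm0 zmn.
  apply: le_trans (ler_wpM2r A0 um) _; rewrite mulrDl.
  apply: lerD; rewrite -mulrA ler_wpM2l ?invr_ge0 ?(ltW cm0)//.
    by apply: le_trans (mul_le_sqrD _ _) _; rewrite lerD2l.
  by apply: le_trans (mul_le_sqrD _ _) _; rewrite addrC lerD.
have sq1 x w : nc ((x +i* w) - p) ^+ 2 = (x - P) ^+ 2 + (w - q) ^+ 2.
  by rewrite sqr_normcE ReD ImD ReN ImN.
have sq2 x w : nc ((x +i* w) + p^*) ^+ 2 = (x + P) ^+ 2 + (w - q) ^+ 2.
  by rewrite sqr_normcE ReD ImD ReJ ImJ.
(* Within [d] of [p] continuity bounds [h] by [nc L + 1], and farther away [h_le] applies. The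
   condition [d <= P] lets [lor d q] dominate the squared modulus of [1 / (z + conj p)]. *)
pose d := Num.min d1 P.
have d0 : 0 < d by rewrite lt_min d10.
have dP : d <= P by rewrite ge_min lexx orbT.
have dd1 : d <= d1 by rewrite ge_min lexx.
have lorS x w : (2 * d ^+ 2 * lor d q w >= 1) || (d <= nc ((x +i* w) - p)).
  have [_|small] := leP d (nc _); first by rewrite orbT.
  rewrite orbF /lor ler_pdivlMr ?mul1r; last by rewrite ltr_pwDl ?exprn_gt0// sqr_ge0.
  have : nc ((x +i* w) - p) ^+ 2 <= d ^+ 2.
    by rewrite ler_pXn2r ?nnegrE ?normc_ge0// ltW.
  rewrite sq1; have := sqr_ge0 (x - P); lra.
(* The integral of this majorant is bounded uniformly in the abscissa, as [strip_shift] demands. *)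
have [A [B [A0 B0 hAB]]] : exists A B, [/\ 0 <= A, 0 <= B & forall x w, 0 <= x ->
    nc (h (x +i* w)) <= A * F x w ^+ 2 + B * lor d q w].
  have [K KE K0] : exists2 K : R, K = nc L + 1 & 0 <= K.
    by exists (nc L + 1) => //; rewrite addr_ge0 ?normc_ge0.
  exists mu0^-1, (K * (2 * d ^+ 2) + mu0^-1 * 2 + Kc * 3); split.
  - by rewrite invr_ge0 ltW.
  - by rewrite !addr_ge0// !mulr_ge0 ?sqr_ge0 ?invr_ge0// ltW.
  move=> x w x0; have l0 := lor_ge0 d q w.
  have mu0V : 0 <= mu0^-1 by rewrite invr_ge0 ltW.
  have AF : 0 <= mu0^-1 * F x w ^+ 2 by rewrite mulr_ge0 ?sqr_ge0.
  have [near|far] := ltP (nc ((x +i* w) - p)) d.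
    have := lorS x w; rewrite [d <= _]leNgt near orbF => lS.
    have hK : nc (h (x +i* w)) <= K.
      rewrite -(subrK L (h (x +i* w))) KE; apply: le_trans (ler_normcD _ _) _.
      rewrite (addrC (nc L)) lerD2r -{1}hp; apply/ltW/Hd1.
      exact: lt_le_trans near dd1.
    apply: le_trans hK _; rewrite !mulrDl.
    have := ler_wpM2l K0 lS; rewrite mulr1 mulrA => H.
    have : 0 <= mu0^-1 * 2 * lor d q w by rewrite !mulr_ge0.
    have : 0 <= Kc * 3 * lor d q w by rewrite !mulr_ge0.
    lra.
  have xNp : x +i* w != p.
    by rewrite -subr_eq0 -normc_gt0; exact: lt_le_trans far.
  have far2 : d ^+ 2 <= nc ((x +i* w) - p) ^+ 2.
    by rewrite ler_pXn2r ?nnegrE ?normc_ge0// ltW.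
  have dpos : 0 < d ^+ 2 + (w - q) ^+ 2 by rewrite ltr_pwDl ?exprn_gt0// sqr_ge0.
  have -> : mu0^-1 * F x w ^+ 2 +
     (K * (2 * d ^+ 2) + mu0^-1 * 2 + Kc * 3) * lor d q w =
     K * (2 * d ^+ 2) * lor d q w + (mu0^-1 * (F x w ^+ 2 + 2 * lor d q w) +
     Kc * (2 * lor d q w + lor d q w)) by ring.
  apply: ler_wpDl; first by rewrite !mulr_ge0// ltW.
  apply: h_le => //; first by rewrite /mu0; lra.
    rewrite /lor (_ : 2 * _ = ((d ^+ 2 + (w - q) ^+ 2) / 2)^-1); last first.
      by rewrite invf_div.
    have pa : 0 < nc ((x +i* w) - p) ^+ 2 by rewrite (lt_le_trans _ far2)// exprn_gt0.
    have pb : 0 < (d ^+ 2 + (w - q) ^+ 2) / 2 by rewrite divr_gt0.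
    rewrite lef_pV2 ?posrE//.
    by move: far2; rewrite sq1; have := sqr_ge0 (x - P); lra.
  have xP : 0 < x + P by rewrite ltr_wpDl.
  have pc : 0 < (x + P) ^+ 2 + (w - q) ^+ 2.
    by rewrite ltr_pwDl ?sqr_ge0// exprn_gt0.
  rewrite sq2 lef_pV2 ?posrE// lerD2r ler_pXn2r ?nnegrE ?(ltW d0) ?(ltW xP)//.
  by apply: le_trans dP _; rewrite lerDr.
have M0 := scalar_hardy_ge0 fH.
have intF x : 0 <= x -> integ setT (fun w => F x w ^+ 2) /\
    (\int[mu]_w (F x w ^+ 2) <= M)%R.
  by move=> x0; have [[_ ?] ?] := scalar_hardy_l2 fH (ltr_pwDl y0 x0).
have mh x : 0 <= x -> cmeas setT (fun w => h (x +i* w)).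
  by move=> x0; apply: cmeas_vertical => w; exact: hc.
have inth x : 0 <= x -> (\int[mu]_w (nc (h (x +i* w)))%:E <=
    (A * M + B * (pi / d))%:E)%E.
  move=> x0; have [iF FM] := intF x x0.
  have il := integ_lor q d0.
  have ilF : integ setT (fun w => A * F x w ^+ 2 + B * lor d q w).
    by apply: integD => //; exact: integZ.
  apply: (@le_trans _ _ (\int[mu]_w (A * F x w ^+ 2 + B * lor d q w)%:E)%E).
    apply: ge0_le_integral => //=.
    - by move=> w _; rewrite lee_fin normc_ge0.
    - by apply/measurable_EFinP; apply: measurable_normc; exact: mh.
    - by apply/measurable_EFinP; exact: integ_measurable ilF.
    - by move=> w _; rewrite lee_fin hAB.
  have -> : (\int[mu]_w (A * F x w ^+ 2 + B * lor d q w)%:E =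
      (\int[mu]_w (A * F x w ^+ 2 + B * lor d q w))%R%:E)%E.
    by rewrite /Rintegral fineK//; exact: integrable_fin_num.
  rewrite lee_fin RintegralD//; [|exact: integZ|exact: integZ].
  by rewrite !RintegralZl// Rintegral_lor// lerD2r ler_wpM2l.
have ch x : 0 <= x -> cinteg setT (fun w => h (x +i* w)).
  by move=> x0; apply: cinteg_line (inth x x0) => w; exact: hc.
split; last exact: ch.
apply/eqP; rewrite -normc_eq0 eq_le normc_ge0 andbT.
pose T := M + pi + Kc * (2 * pi).
have pi0 := pi_ge0 R.
have T0 : 0 <= T by apply: addr_ge0; [exact: addr_ge0|apply: mulr_ge0; lra].
(* The line is moved to [P + s], at distance [s] to the right of [p], where both parts of the bound
   [h_le] have integrals of order [1 / s]. *)
have main s : 1 <= s -> nc (cint setT (fun t => h (0 +i* t))) <= 2 * (T / s).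
  move=> s1; have s0 : 0 < s by lra.
  have Ps0 : 0 <= P + s by rewrite addr_ge0// ltW.
  rewrite (@strip_shift _ h p 0 (P + s) (A * M + B * (pi / d))); first last.
  - by move=> x /andP[x0 _]; exact: inth.
  - by move=> x w /andP[x0 _] /eqP xNp; exact: hd.
  - by move=> x w /andP[x0 _]; exact: hc.
  - by rewrite p0 ltrDl.
  have [iF FM] := intF _ Ps0; have il := integ_lor q s0.
  have i1 : integ setT (fun w => s^-1 * (F (P + s) w ^+ 2 + lor s q w)).
    by apply: integZ => //; exact: integD.
  have i2 : integ setT (fun w => Kc * (lor s q w + lor s q w)).
    by apply: integZ => //; exact: integD.
  apply: le_trans (normc_cint_le measurableT (mh _ Ps0) (integD measurableT i1 i2) _) _.
    move=> w _; apply: h_le => //.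
    - apply: contraTneq s0 => /(congr1 re) /= E; rewrite -leNgt.
      by rewrite -(lerD2l P) E addr0.
    - by rewrite -/P; have := m0; lra.
    - by rewrite sq1 /lor addrAC subrr add0r.
    - have h1 : 0 < s ^+ 2 + (w - q) ^+ 2 by rewrite ltr_pwDl ?exprn_gt0// sqr_ge0.
      have h2 : 0 < (P + s + P) ^+ 2 + (w - q) ^+ 2.
        by rewrite ltr_pwDl ?exprn_gt0 ?sqr_ge0//; lra.
      have h3 : 0 <= P + s + P by lra.
      rewrite sq2 /lor lef_pV2 ?posrE// lerD2r ler_pXn2r ?nnegrE// ?(ltW s0)//.
      lra.
  rewrite ler_pM2l// RintegralD// !RintegralZl//; [|exact: integD..].
  rewrite !RintegralD// !Rintegral_lor//.
  have -> : T / s = s^-1 * (M + pi) + Kc * (pi / s + pi / s).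
    by rewrite /T; field; rewrite gt_eqF.
  rewrite lerD2r ler_wpM2l ?invr_ge0 ?(ltW s0)// lerD//.
  by rewrite ler_pdivrMr// ler_peMr.
apply/ler_addgt0Pl => e e0; rewrite addr0.
pose s := 1 + 2 * T / e.
have s1 : 1 <= s by rewrite lerDl divr_ge0 ?mulr_ge0// ltW.
have s0 : 0 < s by lra.
apply: le_trans (main s s1) _; rewrite mulrA ler_pdivrMr//.
have -> : e * s = e + 2 * T by rewrite /s; field; rewrite gt_eqF.
by rewrite lerDr ltW.
Qed.

(** The integrand is [h] minus [c0] times a Lorentzian, so only [- c0 * pi / re p] survives, and the
    factor [p + conj p = 2 * re p] in [c0] cancels the denominator. The function is taken on the
    line of abscissa [y], since no values on the imaginary axis are available yet. *)
Lemma kernel_level :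
  cint setT (fun t => f (y +i* t) / (((0 +i* t) - p) * ((0 +i* t) - m))) =
  - (2 * pi)%:C * (f (y%:C + p) / (p - m)).
Proof.
have [L [_ [h0 ih]]] := kernel_vanish; move: h0 ih.
set h := fun t : R => _ => h0 ih.
have i1 : cinteg setT (fun t => (lor (re p) (im p) t)%:C).
  split; first exact: integ_lor.
  by have := integ0 (@measurableT _ RM).
have hE t : f (y +i* t) / (((0 +i* t) - p) * ((0 +i* t) - m)) =
    h t + - c0 * (lor (re p) (im p) t)%:C.
  have itp : (0 +i* t) - p != 0.
    rewrite subr_eq0; apply: contraTneq p0 => <-; by rewrite ltxx.
  have itm : (0 +i* t) - m != 0 by apply: zm.
  have itpc : (0 +i* t) + p^* != 0 by apply: zp.
  have lE : (lor (re p) (im p) t)%:C = - (((0 +i* t) + p^*) * ((0 +i* t) - p))^-1.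
    by rewrite sqr_sub_conj invrN opprK /lor fmorphV.
  rewrite lE /h /= ifF; last by apply/negbTE; rewrite -subr_eq0.
  rewrite /u (_ : y%:C + (0 +i* t) = y +i* t); last first.
    by apply: eq_ReIm; rewrite /= ?addr0 ?add0r.
  by field; rewrite itpc itm itp.
rewrite (eq_cint (fun t _ => hE t)) cintD//; last exact: cintegZ.
rewrite h0 add0r cintZ//.
have -> : cint setT (fun t => (lor (re p) (im p) t)%:C) = (pi / re p)%:C.
  apply: eq_ReIm => /=; first exact: Rintegral_lor.
  by rewrite Rintegral_cst// mul0r.
rewrite /c0 (_ : p + p^* = 2 * (re p)%:C); last exact: addcJ.
rewrite (_ : (pi / re p)%:C = pi%:C / (re p)%:C); last by rewrite rmorphM fmorphV.
rewrite (_ : (2 * pi)%:C = 2 * pi%:C); last by rewrite rmorphM rmorph_nat.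
have : (re p)%:C != 0 :> C by rewrite eq_complex /= eqxx andbT gt_eqF.
have : p - m != 0 by apply: zm; exact: ltW.
by move=> H1 H2; field; rewrite H2 H1.
Qed.

End kernel.
End HardyKernel.

(** * Completeness of L2 along fast Cauchy sequences *)

Section SquareIntegrableLimit.
Variable R : realType.
Local Notation C := R[i].
Local Notation nc := (@Normc.normc R).
Local Notation re := (@complex.Re R).
Local Notation im := (@complex.Im R).
Local Notation mu := (@lebesgue_measure R).
Local Notation RM := (measurableTypeR R).

Lemma exists_div_expn2_lt (a e : R) : 0 < e ->
  exists N, forall n, (N <= n)%N -> a / 2 ^+ n < e.
Proof.
move=> e0; have := @cvg_geometric R a 2^-1.
rewrite ger0_norm ?invr_ge0// invf_lt1// ltr1n => /(_ isT).
move=> /cvgrPdist_lt /(_ _ e0)[N _ HN]; exists N => n /HN /=.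
by rewrite sub0r normrN exprVn; apply: le_lt_trans; exact: ler_norm.
Qed.

Lemma sqr_normcD_le (a b : C) : nc (a + b) ^+ 2 <= 2 * nc a ^+ 2 + 2 * nc b ^+ 2.
Proof.
apply: (@le_trans _ _ ((nc a + nc b) ^+ 2)).
  by rewrite ler_pXn2r ?nnegrE ?addr_ge0 ?normc_ge0 ?ler_normcD.
have := sqr_ge0 (nc a - nc b); nra.
Qed.

(** Iterating [|a + b|^2 <= 2 |a|^2 + 2 |b|^2] doubles the weight of each further increment, whence
    the factors [2 ^+ j]. *)
Lemma sqr_normc_telescope (u : nat -> C) n k :
  nc (u n - u (n + k)%N) ^+ 2 <=
  2 / 2 ^+ n * \sum_(n <= j < n + k) 2 ^+ j * nc (u j - u j.+1) ^+ 2.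
Proof.
elim: k n => [|k IH] n.
  by rewrite addn0 subrr Normc.normc0 expr0n big_geq ?mulr0.
rewrite big_ltn; last by rewrite -[X in (X < _)%N]addn0 ltn_add2l.
rewrite -addSnnS.
have -> : u n - u (n.+1 + k)%N = (u n - u n.+1) + (u n.+1 - u (n.+1 + k)%N).
  by rewrite addrA subrK.
apply: le_trans (sqr_normcD_le _ _) _.
rewrite mulrDr; apply: lerD.
  by rewrite [leRHS]mulrA divfK ?expf_neq0.
apply: le_trans (ler_wpM2l _ (IH n.+1)) _ => //.
rewrite [leLHS]mulrA (_ : 2 * (2 / 2 ^+ n.+1) = 2 / 2 ^+ n)//.
by rewrite exprS; field; rewrite expf_neq0.
Qed.

(** The Riesz-Fischer argument. The rate [8 ^- n] pays for the weights [2 ^+ n] of the telescoping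
    inequality and still leaves the summable [4 ^- n]; hence the weighted sum [G] of squared
    increments has integral at most 2, is finite almost everywhere and dominates the squared
    distance to the limit. *)
Lemma l2_complete (phi : nat -> RM -> C) : (forall n, l2 (phi n)) ->
  (forall n, n2 (fun w => phi n w - phi n.+1 w) <= (8 ^+ n)^-1) ->
  exists psi, l2 psi /\ forall n, n2 (fun w => phi n w - psi w) <= 4 / 2 ^+ n.
Proof.
move=> phi2 dphi.
pose b k w := 2 ^+ k * nc (phi k w - phi k.+1 w) ^+ 2.
have b0 k w : 0 <= b k w by rewrite mulr_ge0 ?sqr_ge0 ?exprn_ge0.
have ib k : integ setT (b k).
  by apply: integZ => //; have [] := l2B (phi2 k) (phi2 k.+1).
have mb k : measurable_fun setT (EFin \o b k).
  by apply/measurable_EFinP; exact: integ_measurable (ib k).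
have sb k : (\int[mu]_w (b k w)%:E <= ((4 ^+ k)^-1)%:E)%E.
  rewrite -(@fineK _ (\int[mu]_w (b k w)%:E)%E); last exact: integrable_fin_num (ib k).
  rewrite lee_fin; have -> : fine (\int[mu]_w (b k w)%:E)%E =
      2 ^+ k * n2 (fun w => phi k w - phi k.+1 w).
    by rewrite /n2 -RintegralZl//; have [] := l2B (phi2 k) (phi2 k.+1).
  apply: le_trans (ler_wpM2l _ (dphi k)) _; first exact: exprn_ge0.
  rewrite (_ : 8 = 2 * 4 :> R); last by ring.
  by rewrite exprMn invfM mulrA divff ?mul1r// expf_neq0.
pose G w := (\sum_(k <oo) (b k w)%:E)%E.
have G0 w : (0 <= G w)%E by apply: nneseries_ge0 => k _ _; rewrite lee_fin.
have mG : measurable_fun [set: RM] G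
  by apply: ge0_emeasurable_sum => [k w _ _|k _]; [rewrite lee_fin|exact: mb].
have geom n : \sum_(0 <= k < n) (4 ^+ k)^-1 <= 2 - 2 / 4 ^+ n :> R.
  elim: n => [|n IH]; first by rewrite big_geq// expr0 divr1 subrr.
  rewrite big_nat_recr//=; apply: le_trans (lerD IH (lexx _)) _.
  have : 0 <= (4 ^+ n)^-1 :> R by rewrite invr_ge0 exprn_ge0.
  rewrite exprS invfM; set q := (4 ^+ n)^-1; lra.
have iG : (\int[mu]_w G w <= 2%:E)%E.
  rewrite integral_nneseries//; last by move=> k w _; rewrite lee_fin.
  apply: lime_le.
    by apply: is_cvg_nneseries => k _ _; apply: integral_ge0 => w _; rewrite lee_fin.
  apply: nearW => n; apply: (@le_trans _ _ (\sum_(0 <= k < n) ((4 ^+ k)^-1)%:E)%E).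
    by apply: lee_sum => k _; exact: sb.
  rewrite sumEFin lee_fin (le_trans (geom n))// gerBl divr_ge0// exprn_ge0//.
pose good : set RM := [set w | (G w < +oo)%E].
have mgood : measurable good.
  rewrite -[good]setTI; exact: emeasurable_fun_infty_o.
pose g w := fine (G w).
have gE w : good w -> G w = (g w)%:E.
  by move=> Gw; rewrite /g fineK// ge0_fin_numE.
have g0 w : 0 <= g w by exact: fine_ge0.
have psum w m n : good w -> \sum_(m <= k < n) b k w <= g w.
  move=> Gw; rewrite -lee_fin -gE// -sumEFin.
  have [mn|nm] := leqP m n; last by rewrite big_geq// ltnW.
  apply: (@le_trans _ _ (\sum_(0 <= k < n) (b k w)%:E)%E).
    rewrite [leRHS](big_cat_nat (n := m))//= leeDr// sume_ge0// => k _.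
    by rewrite lee_fin.
  by apply: nneseries_lim_ge => k _ _; rewrite lee_fin.
(* Cutting off to 0 where [G] is infinite makes the sequence converge everywhere, so that its limit
   is measurable. *)
pose u n w : C := phi n w * (\1_good w)%:C.
have u_good n w : good w -> u n w = phi n w.
  by move=> Gw; rewrite /u indicE mem_set// mulr1.
have u_bad n w : ~ good w -> u n w = 0.
  by move=> Gw; rewrite /u indicE memNset// mulr0.
have udist w n k : good w -> nc (u n w - u (n + k)%N w) ^+ 2 <= 2 / 2 ^+ n * g w.
  move=> Gw; apply: le_trans (sqr_normc_telescope (u ^~ w) n k) _.
  rewrite ler_wpM2l ?divr_ge0 ?exprn_ge0//.
  apply: le_trans _ (psum w n (n + k)%N Gw).
  by apply: ler_sum => j _; rewrite !u_good.
have ucvg w (P : C -> R) : (forall a b, `|P a - P b| <= nc (a - b)) ->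
    cvgn (fun n => P (u n w)).
  move=> Plip; have [Gw|Gw] := pselect (good w); last first.
    by under eq_fun do rewrite u_bad//; exact: is_cvg_cst.
  apply/cauchy_cvgP/cauchy_exP => e e0.
  have e20 : 0 < e ^+ 2 by rewrite exprn_gt0.
  have [N HN] := exists_div_expn2_lt (2 * g w) e20.
  exists (P (u N w)); exists N => // n /= Nn.
  rewrite /ball /=; apply: le_lt_trans (Plip _ _) _.
  rewrite -(@ltr_pXn2r _ 2)// ?nnegrE ?normc_ge0 ?(ltW e0)//.
  rewrite -(subnKC Nn); apply: le_lt_trans (udist w N _ Gw) _.
  by rewrite mulrAC; exact: HN.
have reL a c : `|re a - re c| <= nc (a - c) by rewrite -ReN -ReD ler_Re_normc.
have imL a c : `|im a - im c| <= nc (a - c) by rewrite -ImN -ImD ler_Im_normc.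
pose psi w := (limn (fun n => re (u n w))) +i* (limn (fun n => im (u n w))).
have mu_ n : cmeas setT (u n).
  apply: cmeasM; first by have [] := phi2 n.
  by split; [exact: measurable_indic|exact: measurable_cst].
have mpsi : cmeas setT psi.
  split.
    apply: (@measurable_fun_cvg _ _ _ _ (fun n w => re (u n w))) => [n|w _].
      by have [] := mu_ n.
    exact: (ucvg w re reL).
  apply: (@measurable_fun_cvg _ _ _ _ (fun n w => im (u n w))) => [n|w _].
    by have [] := mu_ n.
  exact: (ucvg w im imL).
have psid w n : good w -> nc (phi n w - psi w) ^+ 2 <= 2 / 2 ^+ n * g w.
  move=> Gw; rewrite -(u_good n w Gw) sqr_normcE.
  have cr : (re (u n w) - re (u (n + k)%N w)) ^+ 2 +
      (im (u n w) - im (u (n + k)%N w)) ^+ 2 @[k --> \oo] -->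
      re (u n w - psi w) ^+ 2 + im (u n w - psi w) ^+ 2.
    rewrite !ReD !ImD !ReN !ImN /psi /=.
    have cr1 : re (u (n + k)%N w) @[k --> \oo] --> limn (fun n => re (u n w)).
      under eq_fun do rewrite addnC.
      have : (fun k => re (u k w)) @ \oo --> limn (fun n => re (u n w)).
        exact: (ucvg w re reL).
      by rewrite -(cvg_shiftn n).
    have ci1 : im (u (n + k)%N w) @[k --> \oo] --> limn (fun n => im (u n w)).
      under eq_fun do rewrite addnC.
      have : (fun k => im (u k w)) @ \oo --> limn (fun n => im (u n w)).
        exact: (ucvg w im imL).
      by rewrite -(cvg_shiftn n).
    by apply: cvgD; rewrite expr2; apply: cvgM; apply: cvgB => //; exact: cvg_cst.
  rewrite -(cvg_lim _ cr)//; apply: limr_le.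
    by apply/cvg_ex; eexists; exact: cr.
  apply: nearW => k; rewrite -!ReN -!ReD -!ImN -!ImD -sqr_normcE; exact: udist.
have aegood : {ae mu, forall w, good w}.
  have iGG : mu.-integrable setT G.
    apply/integrableP; split => //.
    under eq_integral do rewrite gee0_abs//.
    by apply: le_lt_trans iG _; rewrite ltry.
  have := integrable_ae measurableT iGG; apply: filterS => w /(_ I).
  by rewrite ge0_fin_numE.
have bnd n : (\int[mu]_w (nc (phi n w - psi w) ^+ 2)%:E <= (4 / 2 ^+ n)%:E)%E.
  have mn : cmeas setT (fun w => phi n w - psi w).
    by apply: cmeasB => //; have [] := phi2 n.
  apply: (@le_trans _ _ (\int[mu]_w ((2 / 2 ^+ n)%:E * G w))%E).
    apply: ae_ge0_le_integral => //.
    - by move=> w _; rewrite lee_fin sqr_ge0.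
    - by apply/measurable_EFinP; exact: measurable_sqr_normc.
    - by move=> w _; rewrite mule_ge0// lee_fin divr_ge0// exprn_ge0.
    - exact: measurable_funeM.
    - apply: filterS aegood => w Gw _; rewrite gE// -EFinM lee_fin.
      exact: psid.
  rewrite ge0_integralZl//.
  apply: (@le_trans _ _ ((2 / 2 ^+ n)%:E * 2%:E)%E).
    by apply: lee_wpmul2l => //; rewrite lee_fin divr_ge0// exprn_ge0.
  by rewrite -EFinM lee_fin mulrAC -natrM.
have l2d n := l2_bounded (cmeasB (proj1 (phi2 n)) mpsi) (bnd n).
exists psi; split; last by move=> n; have [] := l2d n.
have := l2B (phi2 0%N) (proj1 (l2d 0%N)).
by under eq_fun do rewrite opprB addrC subrK.
Qed.

End SquareIntegrableLimit.

(** * Existence of the boundary function *)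

Section BoundaryFunction.
Variable R : realType.
Local Notation C := R[i].
Local Notation nc := (@Normc.normc R).
Local Notation re := (@complex.Re R).
Local Notation mu := (@lebesgue_measure R).
Local Notation RM := (measurableTypeR R).
Implicit Types (x y a s t : R).

Lemma sqr_normcB (a b : C) :
  nc (a - b) ^+ 2 = nc a ^+ 2 + nc b ^+ 2 - 2 * re (a * conjc b).
Proof. by rewrite !sqr_normcE; case: a b => a1 a2 [b1 b2] /=; ring. Qed.

Lemma n2B (g h : RM -> C) : l2 g -> l2 h ->
  n2 (fun w => g w - h w) = n2 g + n2 h - 2 * re (cint setT (fun w => g w * conjc (h w))).
Proof.
move=> sg sh; have [igh _] := l2_cintegM sg (l2_conj sh).
have [_ ig] := sg; have [_ ih] := sh.
rewrite /n2 /cint /= -RintegralZl// -RintegralD//.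
rewrite -RintegralB//; [|exact: integD|exact: integZ].
by apply: eq_Rintegral => w _; rewrite sqr_normcB.
Qed.

Lemma re_cint_self (g : RM -> C) : re (cint setT (fun w => g w * conjc (g w))) = n2 g.
Proof. by apply: eq_Rintegral => w _; rewrite mulc_conj. Qed.

Section boundary.
Variables (f : C -> C) (M : R).
Hypotheses (fH : scalar_hardy f M).
Hypothesis (fR : forall z, 0 < re z -> f (conjc z) = conjc (f z)).

Let fx x w : C := f (x +i* w).
Let l2f x : 0 < x -> l2 (fx x).
Proof. by move=> x0; have [] := scalar_hardy_l2 fH x0. Qed.

(* By [fR], both sides are integrals of the holomorphic function
   [f z * f (x + y + a - z)] over vertical lines. *)
Lemma cint_shift x y a : 0 < x -> 0 < y -> 0 < a ->
  cint setT (fun w => fx x w * conjc (fx (y + a) w)) =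
  cint setT (fun w => fx (x + a) w * conjc (fx y w)).
Proof.
move=> x0 y0 a0; pose c : R := x + y + a.
pose h z := f z * f (c%:C + -1 * z).
have hE t w : t < c -> h (t +i* w) = fx t w * conjc (fx (c - t) w).
  move=> tc; rewrite /h /fx -fR /=; last by rewrite subr_gt0.
  by congr (_ * f _); apply: eq_ReIm; rewrite /=; ring.
have hd t w : x <= t <= x + a -> exists L, cdiff h (t +i* w) L.
  move=> /andP[xt ta].
  have [|L fL] := fH.1 (t +i* w); first by rewrite /= (lt_le_trans x0).
  have [|K fK] := fH.1 (c%:C + -1 * (t +i* w)).
    by rewrite /= /c; lra.
  by eexists; apply: cdiffM; [exact: fL|exact: cdiff_affine fK].
have n2M t : 0 < t -> l2 (fx t) /\ n2 (fx t) <= M by move=> /(scalar_hardy_l2 fH).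
have bnd t : x <= t <= x + a -> (\int[mu]_w (nc (h (t +i* w)))%:E <= (M + M)%:E)%E.
  move=> /andP[xt ta].
  have tc : t < c by rewrite /c; lra.
  have t0 : 0 < t by lra.
  have ct0 : 0 < c - t by rewrite subr_gt0.
  have [[mt it] Mt] := n2M t t0; have [[mct ict] Mct] := n2M _ ct0.
  have isum := integD measurableT it ict.
  apply: (@le_trans _ _ (\int[mu]_w (nc (fx t w) ^+ 2 + nc (fx (c - t) w) ^+ 2)%:E)%E).
    apply: ge0_le_integral => //=.
    - by move=> w _; rewrite lee_fin normc_ge0.
    - under eq_fun do rewrite hE//.
      apply/measurable_EFinP; apply: measurable_normc.
      by apply: cmeasM => //; exact: cmeas_conj.
    - by apply/measurable_EFinP; exact: integ_measurable isum.
    - move=> w _; rewrite lee_fin hE// Normc.normcM normc_conj.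
      exact: mul_le_sqrD.
  rewrite -(@fineK _ (\int[mu]_w _)%E); last exact: integrable_fin_num isum.
  rewrite lee_fin; apply: le_trans (lerD Mt Mct).
  by rewrite /n2 -RintegralD.
have := @strip_shift _ h (x + a / 2)%:C x (x + a) (M + M).
rewrite /= ltrDl ltrD2l ltr_pdivrMr// mulr_natr mulr2n ltrDl divr_gt0// a0.
move=> /(_ isT) H; rewrite [LHS](_ : _ = cint setT (fun w => h (x +i* w))); last first.
  apply: eq_cint => w _; rewrite hE; last by rewrite /c; lra.
  by congr (_ * conjc (fx _ _)); rewrite /c; ring.
rewrite H.
- apply: eq_cint => w _; rewrite hE; last by rewrite /c; lra.
  by congr (_ * conjc (fx _ _)); rewrite /c; ring.
- by move=> t w xt; have [L /cdiff_cont] := hd t w xt.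
- by move=> t w xt _; exact: hd.
- exact: bnd.
Qed.

Let N x := n2 (fx x).

Lemma n2_shift x y : 0 < y -> y < x ->
  n2 (fun w => fx x w - fx y w) = N x + N y - 2 * N ((x + y) / 2).
Proof.
move=> y0 yx; have x0 := lt_trans y0 yx.
rewrite n2B; [|exact: l2f..]; congr (_ - 2 * _).
pose d := (x - y) / 2; have d0 : 0 < d by rewrite divr_gt0// subr_gt0.
have E1 : x = y + d + d by rewrite /d; field.
have E2 : (x + y) / 2 = y + d by rewrite /d; field.
rewrite E2 {1}E1 -cint_shift//; last by rewrite addr_gt0.
exact: re_cint_self.
Qed.

(* [n2_shift] makes [N] midpoint convex, and [N] is bounded by [M]: an increase
   over one step would repeat at every further step. *)
Lemma n2_line_le x y : 0 < y -> y <= x -> N x <= N y.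
Proof.
move=> y0; rewrite le_eqVlt => /predU1P[->//|yx].
rewrite leNgt; apply/negP => Nyx.
pose d := x - y; have d0 : 0 < d by rewrite subr_gt0.
pose e := N x - N y; have e0 : 0 < e by rewrite subr_gt0.
have step k : e <= N (y + k.+1%:R * d) - N (y + k%:R * d).
  elim: k => [|k IH]; first by rewrite mul1r mul0r addr0 subrKC.
  have pos j : 0 < y + j%:R * d by rewrite ltr_wpDr// mulr_ge0// ltW.
  have lt2 : y + k%:R * d < y + k.+2%:R * d by rewrite ltrD2l ltr_pM2r// ltr_nat.
  have := n2_ge0 (fun w => fx (y + k.+2%:R * d) w - fx (y + k%:R * d) w).
  rewrite (n2_shift (pos k) lt2).
  have -> : (y + k.+2%:R * d + (y + k%:R * d)) / 2 = y + k.+1%:R * d.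
    by rewrite -!natr1; field.
  move: IH; clear; lra.
have grow k : N y + k%:R * e <= N (y + k%:R * d).
  elim: k => [|k IH]; first by rewrite !mul0r !addr0.
  have := step k; move: IH; rewrite -natr1; lra.
pose k := (Num.truncn (M / e)).+1.
have kM : M < k%:R * e by rewrite -ltr_pdivrMr// truncnS_gt.
have k0 : 0 < y + k%:R * d by rewrite ltr_wpDr// mulr_ge0// ltW.
have [_ NM] := scalar_hardy_l2 fH k0.
have := grow k; have := n2_ge0 (fx y); move: NM kM; rewrite /N; lra.
Qed.

(** As [N] is decreasing, its value at the midpoint is at least its value at the larger abscissa;
    inserting this in [n2_shift] leaves the gap of [N]. *)
Lemma n2_dist_le x y : 0 < x -> 0 < y ->
  n2 (fun w => fx x w - fx y w) <= `|N x - N y|.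
Proof.
move=> x0 y0; have [xy|yx|<-] := ltgtP x y; last first.
- rewrite subrr normr0; under eq_n2 do rewrite subrr.
  by rewrite /n2 Rintegral_cst// Normc.normc0 expr0n mul0r.
- have yx2 : (x + y) / 2 <= x by lra.
  have y20 : 0 < (x + y) / 2 by lra.
  have h1 := n2_line_le y20 yx2; have h2 := n2_line_le y0 (ltW yx).
  by rewrite (n2_shift y0 yx) ler0_norm ?subr_le0//; lra.
- have yx2 : (x + y) / 2 <= y by lra.
  have y20 : 0 < (x + y) / 2 by lra.
  have h1 := n2_line_le y20 yx2; have h2 := n2_line_le x0 (ltW xy).
  rewrite (_ : n2 _ = n2 (fun w => fx y w - fx x w)); last first.
    by apply: eq_Rintegral => w _; rewrite normc_distC.
  by rewrite (n2_shift x0 xy) ger0_norm ?subr_ge0// (addrC y); lra.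
Qed.

Lemma exists_boundary_function : exists f0 (x_ : nat -> R), [/\ l2 f0,
  forall n, 0 < x_ n <= n.+1%:R^-1 &
  forall n, n2 (fun w => f (x_ n +i* w) - f0 w) <= 4 / 2 ^+ n].
Proof.
pose S := [set N x | x in [set x | 0 < x]].
have S0 : S !=set0 by exists (N 1), 1 => //=; rewrite ltr01.
have Sub : has_ubound S.
  by exists M => _ [x /= x0 <-]; have [] := scalar_hardy_l2 fH x0.
have leS x : 0 < x -> N x <= sup S by move=> x0; apply: ub_le_sup => //; exists x.
(* Lines whose means are within [8 ^- n] of the supremum satisfy the rate required by [l2_complete];
   since [N] is decreasing, they may be moved closer to the axis. *)
have /choice[x_ x_P] : forall n, exists x,
    0 < x <= n.+1%:R^-1 /\ sup S - (8 ^+ n)^-1 < N x.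
  move=> n; have e0 : 0 < (8 ^+ n)^-1 :> R by rewrite invr_gt0 exprn_gt0.
  have [_ [x /= x0 <-] Hx] := sup_adherent e0 (conj S0 Sub).
  have n0 : 0 < n.+1%:R^-1 :> R by rewrite invr_gt0.
  exists (Num.min x n.+1%:R^-1); split.
    by rewrite lt_min x0 n0 ge_min lexx orbT.
  apply: lt_le_trans Hx _; apply: n2_line_le; first by rewrite lt_min x0 n0.
  by rewrite ge_min lexx.
have x_0 n : 0 < x_ n by have [/andP[]] := x_P n.
have [//|n|f0 [f0l2 Hf0]] := @l2_complete _ (fun n => fx (x_ n)).
- by move=> n; exact: l2f.
- apply: le_trans (n2_dist_le (x_0 _) (x_0 _)) _.
  have [_ h1] := x_P n; have [_ h2] := x_P n.+1.
  have h3 := leS _ (x_0 n); have h4 := leS _ (x_0 n.+1).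
  have h5 : (8 ^+ n.+1)^-1 <= (8 ^+ n)^-1 :> R.
    by rewrite lef_pV2 ?posrE ?exprn_gt0// ler_eXn2l// ltr1n.
  by rewrite ler_norml; lra.
by exists f0, x_; split => // n; have [] := x_P n.
Qed.

End boundary.
End BoundaryFunction.

(** * Poisson means at Lebesgue points *)

Section PoissonLebesguePoint.
Variable R : realType.
Local Notation mu := (@lebesgue_measure R).
Local Notation RM := (measurableTypeR R).
Implicit Types (u : RM -> R) (x w s t e : R).

Lemma near_at_right (P : R -> Prop) : (\forall r \near (0 : R)^'+, P r) <->
  exists2 d, 0 < d & forall r, 0 < r -> r < d -> P r.
Proof.
split.
  rewrite /prop_near1 /nbhs /= /at_right /within /= => /nbhs_ballP[d /= d0 Hd].
  exists d => // r r0 rd; apply: Hd => //.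
  by rewrite /ball /= sub0r normrN gtr0_norm.
move=> [d d0 Hd]; rewrite /prop_near1 /nbhs /= /at_right /within /=.
apply/nbhs_ballP; exists d => // r; rewrite /ball /= sub0r normrN => rd r0.
by apply: Hd => //; rewrite -(gtr0_norm r0).
Qed.

Lemma measurable_ballM w r : measurable (ball w r : set RM).
Proof. exact: measurable_ball. Qed.

Lemma lebesgue_pt_integral u w : measurable_fun setT u ->
  (forall r, integ (ball w r) (fun t => `|u t - u w|)) -> lebesgue_pt u w ->
  forall e, 0 < e -> exists2 d, 0 < d & forall r, 0 < r -> r < d ->
    (\int[mu]_(t in ball w r) `|u t - u w| <= e * (2 * r))%R.
Proof.
move=> mu_ iu Hw e e0.
have : \forall r \near (0 : R)^'+, (davg u w r < e%:E)%E.
  have nb : nbhs (0%E : \bar R) [set y | (y < e%:E)%E].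
    by apply: open_nbhs_nbhs; split; [exact: open_ereal_lt_ereal|rewrite /= lte_fin].
  exact: (Hw _ nb).
move=> /near_at_right[d d0 Hd]; exists d => // r r0 rd.
have := Hd r r0 rd; rewrite /davg /iavg lebesgue_measure_ball ?(ltW r0)//.
have -> : (\int[mu]_(y in ball w r) `|((center (u w) \o u) y)%:E| =
    (\int[mu]_(t in ball w r) `|u t - u w|)%R%:E)%E.
  rewrite /Rintegral fineK; last first.
    exact: (integrable_fin_num (measurable_ballM w r) (iu r)).
  by apply: eq_integral.
rewrite inver mulrn_eq0/= gt_eqF// -EFinM lte_fin mulrC ltr_pdivrMr ?pmulrn_lgt0//.
by move=> /ltW; rewrite mulr_natl.
Qed.

Lemma lor_le_inv x w t : 0 < x -> lor x w t <= x ^- 2.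
Proof.
move=> x0; rewrite /lor lef_pV2 ?posrE ?exprn_gt0//; last first.
  by rewrite ltr_pwDl ?exprn_gt0// sqr_ge0.
by rewrite lerDl sqr_ge0.
Qed.

Lemma lor_le_dist x w t s : 0 < s -> s <= `|t - w| -> lor x w t <= s ^- 2.
Proof.
move=> s0 st; have h : s ^+ 2 <= (t - w) ^+ 2.
  by rewrite -[leRHS]real_normK ?num_real// ler_pXn2r ?nnegrE// ltW.
have s20 : 0 < s ^+ 2 by rewrite exprn_gt0.
have pos : 0 < x ^+ 2 + (t - w) ^+ 2 by rewrite ltr_wpDl ?sqr_ge0// (lt_le_trans s20).
by rewrite /lor lef_pV2 ?posrE// (le_trans h)// lerDr sqr_ge0.
Qed.

Lemma integ_sqr_lor u x w : 0 < x -> measurable_fun setT u ->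
  integ setT (fun t => u t ^+ 2) -> integ setT (fun t => u t * lor x w t).
Proof.
move=> x0 mu_ iu2; have il := integ_lor w x0.
apply: (integ_le measurableT _ (integD measurableT iu2 (integZ (x ^- 2) measurableT il))).
  by apply: measurable_funM => //; exact: integ_measurable il.
move=> t _; rewrite normrM (ger0_norm (lor_ge0 _ _ _)).
apply: le_trans (mul_le_sqrD _ _) _; rewrite real_normK ?num_real// lerD2l.
by rewrite expr2 ler_wpM2r ?lor_ge0// lor_le_inv.
Qed.

(* The Poisson kernel is estimated on the dyadic balls of radius [2 ^+ N * x]
   around [w], up to the radius where the Lebesgue point property applies. *)
Lemma poisson_lebesgue_pt u w e : measurable_fun setT u ->
  integ setT (fun t => u t ^+ 2) -> lebesgue_pt u w -> 0 < e ->
  exists2 d, 0 < d & forall x, 0 < x -> x < d ->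
    `|x / pi * (\int[mu]_t (u t * lor x w t))%R - u w| < e.
Proof.
move=> mu_ iu2 Hw e0.
pose a (t : RM) : R := `|u t - u w|.
have a0 t : 0 <= a t by exact: normr_ge0.
have ma : measurable_fun setT a.
  by apply: measurableT_comp => //; apply: measurable_funB.
have ial x : 0 < x -> integ setT (fun t => a t * lor x w t).
  move=> x0; have il := integ_lor w x0.
  have i1 := integ_norm (integ_sqr_lor w x0 mu_ iu2).
  apply: (integ_le measurableT _ (integD measurableT i1 (integZ `|u w| measurableT il))).
    by apply: measurable_funM => //; exact: integ_measurable il.
  move=> t _; rewrite ger0_norm ?mulr_ge0 ?lor_ge0// normrM.
  rewrite (ger0_norm (lor_ge0 _ _ _)) -mulrDl ler_wpM2r ?lor_ge0//.
  exact: ler_normB.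
(* On the ball of radius [r] the Lorentzian [lor r w] is at least [1 / (2 * r ^+ 2)], so
   integrability against it gives integrability on the ball. *)
have iaB r : integ (ball w r) a.
  have [r0|r0] := ltP 0 r; last by rewrite (ball0 _ _).2//; exact: integrable_set0.
  have h := integS (measurable_ballM w r) measurableT (@subsetT _ _) (ial r r0).
  apply: (integ_le (measurable_ballM w r) _ (integZ (2 * r ^+ 2) (measurable_ballM w r) h)).
    exact: measurable_funS ma.
  move=> t; rewrite /ball /= => tr; rewrite ger0_norm// mulrCA ler_peMr//.
  rewrite /lor ler_pdivlMr ?mul1r; last by rewrite ltr_pwDl ?exprn_gt0// sqr_ge0.
  have : (t - w) ^+ 2 <= r ^+ 2.
    by rewrite -[leLHS]real_normK ?num_real// ler_pXn2r ?nnegrE ?(ltW r0)// distrC ltW.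
  lra.
(* The balls contribute at most [10 * eps] and the remainder at most [eps]. *)
pose eps := e / 12; have eps0 : 0 < eps by rewrite divr_gt0.
have [d0 d00 Hd0] := lebesgue_pt_integral mu_ iaB Hw eps0.
pose B x N : set RM := ball w (2 ^+ N * x).
have mB x N : measurable (B x N : set RM) by exact: measurable_ballM.
have ialB x (A : set RM) : 0 < x -> measurable A -> integ A (fun t => a t * lor x w t).
  by move=> x0 mA; apply: integS (ial x x0).
have iB x N : integ (B x N) a by exact: iaB.
(* The central ball contributes [2 * eps]. The ring of outer radius [2 ^+ N.+1 * x] contributes
   [4 * eps / 2 ^+ N], because the kernel decays quadratically while the bound on the integral of
   [a] grows linearly in the radius. *)
have near x N : 0 < x -> 2 ^+ N * x < d0 ->
    x * (\int[mu]_(t in B x N) (a t * lor x w t))%R <= (5 - 4 / 2 ^+ N) * (2 * eps).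
  move=> x0; elim: N => [|N IH] Nd.
    rewrite expr0 divr1 (_ : 5 - 4 = 1 :> R); last by ring.
    rewrite mul1r.
    have h : (\int[mu]_(t in B x 0%N) (a t * lor x w t) <=
        x ^- 2 * \int[mu]_(t in B x 0%N) a t)%R.
      rewrite -RintegralZl//; last exact: iB.
      apply: le_Rintegral => //.
      - exact: ialB.
      - exact: integZ.
      by move=> t _; rewrite mulrC ler_wpM2r// lor_le_inv.
    have h2 : (\int[mu]_(t in B x 0%N) a t <= eps * (2 * x))%R.
      by rewrite /B expr0 mul1r; apply: Hd0 => //; rewrite expr0 mul1r in Nd.
    apply: le_trans (ler_wpM2l (ltW x0) h) _.
    have c0 : 0 <= x * x ^- 2 by rewrite mulr_ge0 ?invr_ge0 ?exprn_ge0 ?ltW.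
    rewrite mulrA; apply: le_trans (ler_wpM2l c0 h2) _.
    by rewrite le_eqVlt; apply/orP; left; apply/eqP; field; rewrite gt_eqF.
  have p0 : 0 < 2 ^+ N * x by rewrite mulr_gt0 ?exprn_gt0.
  have BS : B x N `<=` B x N.+1.
    by apply: le_ball; rewrite ler_wpM2r ?(ltW x0)// ler_eXn2l ?ltr1n.
  have mD : measurable (B x N.+1 `\` B x N : set RM) by exact: measurableD.
  have Nd' : 2 ^+ N * x < d0.
    apply: le_lt_trans Nd; rewrite ler_wpM2r ?(ltW x0)// ler_eXn2l ?ltr1n//.
  rewrite -(setDUK BS) Rintegral_setU//; first last.
  - by apply/disj_setPS => t [h1 [_ /(_ h1)]].
  - by apply: ialB => //; exact: measurableU.
  rewrite mulrDr.
  pose c := (2 ^+ N * x) ^- 2.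
  have c0 : 0 <= c by rewrite invr_ge0 exprn_ge0// ltW.
  have ring_le : (\int[mu]_(t in B x N.+1 `\` B x N) (a t * lor x w t) <=
      c * (eps * (2 * (2 ^+ N.+1 * x))))%R.
    apply: (@le_trans _ _ (c * \int[mu]_(t in B x N.+1 `\` B x N) a t)%R).
      have iaD : integ (B x N.+1 `\` B x N) a.
        exact: (integS mD (mB x N.+1) (@subDsetl _ _ _) (iB x N.+1)).
      rewrite -RintegralZl//; apply: le_Rintegral => //.
      - exact: ialB.
      - exact: integZ.
      move=> t [_ Bt]; rewrite mulrC ler_wpM2r//; apply: lor_le_dist => //.
      by rewrite leNgt; apply/negP => h; apply: Bt; rewrite /B /ball /= distrC.
    rewrite ler_wpM2l//.
    apply: le_trans (le_Rintegral_set mD (mB x N.+1) (@subDsetl _ _ _) (iB x N.+1) a0) _.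
    by apply: Hd0 => //; rewrite mulr_gt0 ?exprn_gt0.
  apply: le_trans (lerD (IH Nd') (ler_wpM2l (ltW x0) ring_le)) _.
  rewrite le_eqVlt; apply/orP; left; apply/eqP.
  have q0 : 2 ^+ N != 0 :> R by rewrite expf_neq0.
  rewrite /c (exprS _ N); move: q0; move: (2 ^+ N) => q q0.
  by field; rewrite q0 gt_eqF.
pose s0 := d0 / 2; have s00 : 0 < s0 by rewrite divr_gt0.
(* At distance at least [s0] from [w] every [lor x w] is at most [1 + s0 ^- 2] times [lor 1 w], so
   the far part is bounded independently of [x]. *)
pose K := (1 + s0 ^- 2) * (\int[mu]_t (a t * lor 1 w t))%R.
have K0 : 0 <= K.
  rewrite mulr_ge0//; first by rewrite addr_ge0// invr_ge0 exprn_ge0 ?ltW.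
  by apply: Rintegral_ge0 => t _; rewrite mulr_ge0 ?lor_ge0.
have far x N : 0 < x -> s0 <= 2 ^+ N * x ->
    (\int[mu]_(t in ~` B x N) (a t * lor x w t) <= K)%R.
  move=> x0 sN; have mC : measurable (~` B x N : set RM) by exact: measurableC.
  apply: (@le_trans _ _ ((1 + s0 ^- 2) * \int[mu]_(t in ~` B x N) (a t * lor 1 w t))%R).
    rewrite -RintegralZl//; last exact: ialB.
    apply: le_Rintegral => //; [exact: ialB|by apply: integZ => //; exact: ialB|].
    move=> t Bt; rewrite mulrCA ler_wpM2l//.
    have st : s0 <= `|t - w|.
      apply: le_trans sN _; rewrite leNgt; apply/negP => h; apply: Bt.
      by rewrite /B /ball /= distrC.
    have h : s0 ^+ 2 <= (t - w) ^+ 2.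
      by rewrite -[leRHS]real_normK ?num_real// ler_pXn2r ?nnegrE// ltW.
    have s20 : 0 < s0 ^+ 2 by rewrite exprn_gt0.
    have tw0 : 0 < (t - w) ^+ 2 by exact: lt_le_trans h.
    apply: (@le_trans _ _ ((t - w) ^+ 2)^-1).
      have px : 0 < x ^+ 2 + (t - w) ^+ 2 by rewrite ltr_pwDl ?exprn_gt0// sqr_ge0.
      by rewrite /lor lef_pV2 ?posrE// lerDr sqr_ge0.
    have p1 : 0 < 1 + (t - w) ^+ 2 by rewrite ltr_pwDl// sqr_ge0.
    rewrite /lor expr1n ler_pdivlMr// mulrDr mulr1 mulVf ?gt_eqF//.
    by rewrite addrC lerD2l lef_pV2.
  rewrite ler_wpM2l//; first by rewrite addr_ge0// invr_ge0 ltW// exprn_gt0.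
  apply: le_Rintegral_set => //; first exact: ial.
  by move=> t; rewrite mulr_ge0 ?lor_ge0.
exists (Num.min d0 (eps / (K + 1))).
  by rewrite lt_min d00 divr_gt0// ltr_wpDl.
move=> x x0; rewrite lt_min ltr_pdivlMr; last by rewrite ltr_wpDl.
move=> /andP[xd xK].
(* The last doubling that stays below [d0] has reached at least [d0 / 2], which is why [s0] is half
   of [d0]. *)
have [N Nd Ns] : exists2 N, 2 ^+ N * x < d0 & s0 <= 2 ^+ N * x.
  have ex : exists N, d0 <= 2 ^+ N.+1 * x.
    have [N HN] := exists_div_expn2_lt d0 x0.
    exists N; have := HN N.+1 (leqnSn N).
    by rewrite ltr_pdivrMr ?exprn_gt0// mulrC => /ltW.
  case: (ex_minnP ex) => N HN Nmin; exists N.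
    case: N HN Nmin => [|N] HN Nmin; first by rewrite expr0 mul1r.
    by rewrite ltNge; apply/negP => /Nmin; rewrite ltnn.
  by rewrite /s0 ler_pdivrMr// mulrAC -exprSr.
have il := integ_lor w x0.
have pi1 : 1 <= pi :> R by have := pi_ge2 R; lra.
have pi0 : 0 < pi :> R by lra.
have uwE : u w = x / pi * (u w * \int[mu]_t lor x w t)%R.
  rewrite Rintegral_lor// mulrCA -(invf_div pi x) mulVf ?mulr1//.
  by rewrite gt_eqF// divr_gt0.
rewrite {1}uwE -mulrBr -RintegralZl// -RintegralB//; last 2 first.
- exact: integ_sqr_lor.
- exact: integZ.
have xpi : 0 <= x / pi by rewrite divr_ge0 ?ltW.
rewrite normrM (ger0_norm xpi).
have i1 : integ setT (fun t => u t * lor x w t - u w * lor x w t).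
  by apply: integB => //; [exact: integ_sqr_lor|exact: integZ].
apply: le_lt_trans (ler_wpM2l xpi (le_normr_Rintegral measurableT i1)) _.
rewrite (_ : (\int[mu]_t `|u t * lor x w t - u w * lor x w t|)%R =
    (\int[mu]_t (a t * lor x w t))%R); last first.
  apply: eq_Rintegral => t _.
  by rewrite -mulrBl normrM (ger0_norm (lor_ge0 _ _ _)).
rewrite (Rintegral_setC (mB x N) (ial x x0)).
have h1 := near x N x0 Nd; have h2 := ler_wpM2l (ltW x0) (far x N x0 Ns).
set I1 := (\int[mu]_(t in B x N) _)%R in h1 *.
set I2 := (\int[mu]_(t in ~` B x N) _)%R in h2 *.
have h3 : (5 - 4 / 2 ^+ N) * (2 * eps) <= 10 * eps.
  have q0 : 0 <= 4 / 2 ^+ N :> R by rewrite divr_ge0// exprn_ge0.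
  have : 0 <= 4 / 2 ^+ N * (2 * eps) by rewrite !mulr_ge0// ltW.
  by rewrite mulrBl; lra.
have h4 : x * K <= eps by have := ltW xK; rewrite mulrDr mulr1; lra.
have I0 : 0 <= x * (I1 + I2).
  rewrite mulr_ge0 ?(ltW x0)// addr_ge0//; apply: Rintegral_ge0 => t _;
  by rewrite mulr_ge0 ?lor_ge0.
apply: (@le_lt_trans _ _ (x * (I1 + I2))).
  by rewrite mulrAC ler_pdivrMr// ler_peMr.
rewrite mulrDr; have : e = 12 * eps by rewrite /eps; field.
lra.
Qed.

End PoissonLebesguePoint.

(** * Reproducing formula and boundary limits *)

Section HardyBoundary.
Variable R : realType.
Local Notation C := R[i].
Local Notation nc := (@Normc.normc R).
Local Notation re := (@complex.Re R).
Local Notation im := (@complex.Im R).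
Local Notation mu := (@lebesgue_measure R).
Local Notation RM := (measurableTypeR R).
Implicit Types (x w t e : R) (p q m : C).

Lemma conjcM (a b : C) : conjc (a * b) = conjc a * conjc b.
Proof. by case: a b => ? ? [? ?]; apply: eq_ReIm => /=; ring. Qed.

(** The Cauchy kernel with pole [p], restricted to the imaginary axis. *)
Definition rk p (t : RM) : C := ((0 +i* t) - p)^-1.

Lemma rk_neq0 p t : re p != 0 -> (0 +i* t) - p != 0.
Proof.
by rewrite subr_eq0; apply: contra => /eqP <-.
Qed.

Lemma normc_rk p t : nc (rk p t) ^+ 2 = lor (re p) (im p) t.
Proof.
by rewrite /rk Normc.normcV exprVn sqr_normcE ReD ImD ReN ImN /= sub0r sqrrN.
Qed.

Lemma cmeas_rk p : re p != 0 -> cmeas setT (rk p).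
Proof.
move=> p0; apply: (@cmeas_vertical _ (fun z => (z - p)^-1) 0) => t.
apply: ccontV; first exact: rk_neq0.
by apply: cdiff_cont; apply: cdiffB; [exact: cdiff_id|exact: cdiff_cst].
Qed.

Lemma normc_rk_le p t (a : R) : 0 < a -> a <= `|re p| -> nc (rk p t) <= a^-1.
Proof.
move=> a0 ap; have p0 : 0 < `|re p| by exact: lt_le_trans ap.
rewrite /rk Normc.normcV lef_pV2 ?posrE//.
  apply: le_trans ap _; rewrite normc_distC.
  by apply: le_trans (ler_Re_normc _); rewrite ReD ReN /= subr0.
by rewrite normc_gt0 rk_neq0// -normr_gt0.
Qed.

Lemma l2_rk p : re p != 0 -> l2 (rk p).
Proof.
move=> p0; split; first exact: cmeas_rk.
have p1 : 0 < `|re p| by rewrite normr_gt0.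
apply: (eq_integ measurableT _ (integ_lor (im p) p1)) => t _.
by rewrite normc_rk /lor real_normK ?num_real.
Qed.

Lemma l2_rkM p (k : RM -> C) : re p != 0 -> l2 k -> l2 (fun t => rk p t * k t).
Proof.
move=> p0 k2; apply: (l2Mbounded k2 (cmeas_rk p0)) => t.
by apply: (@normc_rk_le p t `|re p|); rewrite ?normr_gt0.
Qed.

(** The resolvent identity. *)
Lemma rkB p q t : re p != 0 -> re q != 0 ->
  rk p t - rk q t = (p - q) * (rk p t * rk q t).
Proof.
by move=> /(rk_neq0 t) p0 /(rk_neq0 t) q0; rewrite /rk; field; rewrite p0 q0.
Qed.

Lemma Rintegral_opp (u : RM -> R) : integ setT u ->
  (\int[mu]_t u (- t) = \int[mu]_t u t)%R.
Proof.
move=> /integrableP[mu_ _]; congr fine.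
have opp (v : RM -> \bar R) : measurable_fun setT v -> (forall t, (0 <= v t)%E) ->
    (\int[mu]_t v (- t)%R = \int[mu]_t v t)%E.
  move=> mv v0.
  transitivity (\int[mu]_(t in (-%R : RM -> RM) @^-1` setT) (v \o -%R) t)%E.
    by rewrite preimage_setT.
  rewrite -(@ge0_integral_pushforward _ _ RM RM)//.
  by apply: eq_measure_integral => //= A mA _; exact: lebesgue_measureN.
rewrite integralE [RHS]integralE; congr (_ - _)%E.
  by rewrite -(opp ((EFin \o u)^\+)%E)//; [by apply: eq_integral => t _; rewrite !funeposE|exact: measurable_funepos].
by rewrite -(opp ((EFin \o u)^\-)%E)//; [by apply: eq_integral => t _; rewrite !funenegE|exact: measurable_funeneg].
Qed.

Lemma im_cint_symmetric (g : RM -> C) : cinteg setT g ->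
  (forall t, g (- t) = conjc (g t)) -> im (cint setT g) = 0.
Proof.
move=> [g1 g2] gs; rewrite /cint /=.
have : (\int[mu]_t im (g (- t)) = \int[mu]_t im (g t))%R.
  exact: (Rintegral_opp g2).
have -> : (\int[mu]_t im (g (- t)) = - \int[mu]_t im (g t))%R.
  rewrite -mulN1r -RintegralZl//; apply: eq_Rintegral => t _.
  by rewrite gs ImJ mulN1r.
lra.
Qed.

Lemma cint_l2_cvg (phi : nat -> RM -> C) (psi k : RM -> C) (e : R) :
  (forall n, l2 (phi n)) -> l2 psi -> l2 k ->
  (forall n, n2 (fun t => phi n t - psi t) <= 4 / 2 ^+ n) -> 0 < e ->
  exists N, forall n, (N <= n)%N ->
    nc (cint setT (fun t => phi n t * k t) - cint setT (fun t => psi t * k t)) < e.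
Proof.
move=> phi2 psi2 k2 dist e0.
have e20 : 0 < e ^+ 2 by rewrite exprn_gt0.
(* 16 is the constant 4 of [normc_cintM] times the 4 in the rate of [dist]. *)
have [N HN] := exists_div_expn2_lt (16 * n2 k) e20.
exists N => n /HN Nn; rewrite -(@ltr_pXn2r _ 2)// ?nnegrE ?normc_ge0 ?(ltW e0)//.
rewrite -cintB//; [|exact: l2_cintegM..].
rewrite (@eq_cint _ _ _ (fun t => (phi n t - psi t) * k t)); last first.
  by move=> t _; rewrite mulrBl.
apply: le_lt_trans (normc_cintM (l2B (phi2 n) psi2) k2) _.
apply: le_lt_trans _ Nn; rewrite mulrA (_ : 16 * n2 k / 2 ^+ n = 4 * (4 / 2 ^+ n) * n2 k).
  by rewrite ler_wpM2r ?n2_ge0// ler_wpM2l.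
by field; rewrite expf_neq0.
Qed.

(** The reproducing formula and the vanishing imaginary part are established on the lines [x_ n], by
    [kernel_level] and by the symmetry of [f], and pass to the limit because pairing with an L2
    kernel is continuous in L2. *)
Lemma hardy_boundary (f : C -> C) (M : R) : scalar_hardy f M ->
  (forall z, 0 < re z -> f (conjc z) = conjc (f z)) ->
  exists f0 : RM -> C, [/\ l2 f0,
    forall p m, 0 < re p -> re m < 0 ->
      cint setT (fun t => f0 t * (rk p t * rk m t)) =
      - (2 * pi)%:C * (f p / (p - m)),
    {ae mu, forall w : RM, forall e, 0 < e -> exists2 d, 0 < d &
      forall x, 0 < x -> x < d -> nc (f (x +i* w) - f0 w) < e} &
    forall k : RM -> C, l2 k -> (forall t, k (- t) = conjc (k t)) ->
      im (cint setT (fun t => f0 t * k t)) = 0].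
Proof.
move=> fH fR; have [f0 [x_ [f02 x_P dist]]] := exists_boundary_function fH fR.
have x_0 n : 0 < x_ n by have /andP[] := x_P n.
have x_small e : 0 < e -> exists N, forall n, (N <= n)%N -> x_ n < e.
  move=> e0; exists (Num.truncn e^-1) => n Nn.
  have /andP[_ h] := x_P n; apply: le_lt_trans h _.
  rewrite invf_plt ?posrE//; apply: lt_le_trans (truncnS_gt _) _.
  by rewrite ler_nat ltnS.
have lf n : l2 (fun t => f (x_ n +i* t)).
  by have [] := scalar_hardy_l2 fH (x_0 n).
have kernel p m : 0 < re p -> re m < 0 ->
    cint setT (fun t => f0 t * (rk p t * rk m t)) =
    - (2 * pi)%:C * (f p / (p - m)).
  move=> p0 m0; have p1 : re p != 0 by rewrite gt_eqF.
  have m1 : re m != 0 by rewrite lt_eqF.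
  have k2 : l2 (fun t => rk p t * rk m t) by apply: l2_rkM => //; exact: l2_rk.
  apply/eqP; rewrite -subr_eq0 -normc_eq0 eq_le normc_ge0 andbT.
  apply/ler_addgt0Pl => e e0; rewrite addr0.
  have e20 : 0 < e / 2 by rewrite divr_gt0.
  have [N1 HN1] := cint_l2_cvg lf f02 k2 dist e20.
  pose A : C := - (2 * pi)%:C / (p - m).
  have [L /cdiff_cont fc] := fH.1 p p0.
  have A0 : 0 < nc A + 1 by rewrite ltr_wpDl// normc_ge0.
  have [d d0 Hd] := fc _ (divr_gt0 e20 A0).
  have [N2 HN2] := x_small d d0.
  pose n := maxn N1 N2.
  have h1 := HN1 n (leq_maxl _ _); have h2 := HN2 n (leq_maxr _ _).
  have := kernel_level fH (x_0 n) p0 m0.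
  rewrite (@eq_cint _ _ _ (fun t => f (x_ n +i* t) * (rk p t * rk m t))); last first.
    by move=> t _; rewrite /rk invfM.
  move=> kE; rewrite kE in h1.
  have h3 : nc (A * (f ((x_ n)%:C + p) - f p)) < e / 2.
    have /Hd : nc ((x_ n)%:C + p - p) < d by rewrite addrK normc_real gtr0_norm.
    rewrite ltr_pdivlMr// (Normc.normcM A) => h; apply: le_lt_trans h.
    by rewrite mulrC ler_wpM2l ?normc_ge0// lerDl.
  set I0 := cint _ _ in h1 *.
  have -> : I0 - - (2 * pi)%:C * (f p / (p - m)) =
      A * (f ((x_ n)%:C + p) - f p) -
      (- (2 * pi)%:C * (f ((x_ n)%:C + p) / (p - m)) - I0).
    by rewrite /A; ring.
  by apply: le_trans (ler_normcB _ _) _; lra.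
have sym k : l2 k -> (forall t, k (- t) = conjc (k t)) ->
    im (cint setT (fun t => f0 t * k t)) = 0.
  move=> k2 ks; apply/eqP; rewrite -normr_eq0 eq_le normr_ge0 andbT.
  apply/ler_addgt0Pl => e e0; rewrite addr0.
  have [N HN] := cint_l2_cvg lf f02 k2 dist e0.
  have := HN N (leqnn N); set I := cint _ (fun t => f (_ +i* t) * _).
  have I0 : im I = 0.
    apply: im_cint_symmetric; first exact: l2_cintegM.
    move=> t; rewrite ks conjcM -fR//.
    exact: x_0.
  move=> /ltW; apply: le_trans.
  by apply: le_trans (ler_Im_normc _); rewrite ImD ImN I0 add0r normrN.
exists f0; split => //.
(* The reproducing formula with [p = x + i w] and [m = - conj p], for which the product of the two
   Cauchy kernels is minus the Lorentzian. *)
have poisson x w : 0 < x ->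
    f (x +i* w) = (x / pi)%:C * cint setT (fun t => f0 t * (lor x w t)%:C).
  move=> x0; have := kernel (x +i* w) (- conjc (x +i* w)).
  rewrite /= oppr_lt0 => /(_ x0 x0).
  rewrite opprK (_ : (x +i* w) + conjc (x +i* w) = (2 * x)%:C); last first.
    by apply: eq_ReIm; rewrite /=; ring.
  have rkE t : rk (x +i* w) t * rk (- conjc (x +i* w)) t = -1 * (lor x w t)%:C.
    rewrite /rk -invfM opprK mulrC (sqr_sub_conj t (x +i* w)) /= invrN mulN1r.
    by rewrite /lor fmorphV.
  rewrite (@eq_cint _ _ _ (fun t => -1 * (f0 t * (lor x w t)%:C))); last first.
    by move=> t _; rewrite rkE; ring.
  have iL : cinteg setT (fun t => f0 t * (lor x w t)%:C).
    apply: (@eq_cinteg _ _ (fun t => -1 * (f0 t * (rk (x +i* w) t * rk (- conjc (x +i* w)) t)))) => //.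
      by move=> t _; rewrite rkE; ring.
    apply: cintegZ => //; apply: l2_cintegM => //; apply: l2_rkM.
      by rewrite /= gt_eqF.
    by apply: l2_rk; rewrite /= oppr_eq0 gt_eqF.
  rewrite cintZ// => /(congr1 (fun z => - z * (x / pi)%:C)).
  rewrite mulN1r opprK mulrC => ->.
  have x1 : x%:C != 0 :> C by rewrite eq_complex /= eqxx andbT gt_eqF.
  have pi1 : (pi : R)%:C != 0 :> C by rewrite eq_complex /= eqxx andbT gt_eqF// pi_gt0.
  rewrite (_ : (x / pi)%:C = x%:C / (pi : R)%:C); last by rewrite rmorphM fmorphV.
  rewrite (_ : (2 * pi)%:C = 2 * (pi : R)%:C); last by rewrite rmorphM rmorph_nat.
  rewrite (_ : (2 * x)%:C = 2 * x%:C); last by rewrite rmorphM rmorph_nat.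
  move: x1 pi1.
  move: (pi%:C) (x%:C) => P X X0 P0.
  by field; rewrite X0 P0.
have [mf0 if0] := f02; have [mre mim] := mf0.
have sq (F : C -> R) : (forall z, F z ^+ 2 <= nc z ^+ 2) ->
    measurable_fun setT (fun t => F (f0 t)) -> integ setT (fun t => F (f0 t) ^+ 2).
  move=> FL mF; apply: (integ_le measurableT _ if0); first exact: measurable_funX.
  by move=> t _; rewrite ger0_norm ?sqr_ge0.
have i_re : integ setT (fun t => re (f0 t) ^+ 2).
  by apply: sq => // z; rewrite sqr_normcE lerDl sqr_ge0.
have i_im : integ setT (fun t => im (f0 t) ^+ 2).
  by apply: sq => // z; rewrite sqr_normcE lerDr sqr_ge0.
(* On a compact set [1 + u ^+ 2] is an integrable majorant of [u]. *)
have loc (u : RM -> R) : measurable_fun setT u -> integ setT (fun t => u t ^+ 2) ->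
    locally_integrable setT u.
  move=> mu_ iu; split => //; first exact: openT.
  move=> K _ cK; have mK : measurable (K : set RM) by exact: compact_measurable.
  have i1 : integ K (fun=> 1 : R).
    by apply: continuous_compact_integrable => // x; exact: cst_continuous.
  have : integ K u.
    apply: (integ_le mK _ (integD mK i1 (integS mK measurableT (@subsetT _ _) iu))).
      exact: measurable_funS mu_.
    move=> t _; rewrite -[u t ^+ 2]real_normK ?num_real//.
    have := sqr_ge0 (`|u t| - 1); have := normr_ge0 (u t); nra.
  by move=> /integrableP[].
have ae_re := lebesgue_differentiation (loc _ mre i_re).
have ae_im := lebesgue_differentiation (loc _ mim i_im).
apply: (filterS2 (ae_filter_ringOfSetsType mu) _ ae_re ae_im) => w Lre Lim e e0.
have e20 : 0 < e / 2 by rewrite divr_gt0.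
have [d1 d10 Hd1] := poisson_lebesgue_pt mre i_re Lre e20.
have [d2 d20 Hd2] := poisson_lebesgue_pt mim i_im Lim e20.
exists (Num.min d1 d2); first by rewrite lt_min d10.
move=> x x0; rewrite lt_min => /andP[xd1 xd2].
apply: le_lt_trans (normc_le_ReIm _) _.
have := Hd1 x x0 xd1; have := Hd2 x x0 xd2; rewrite poisson//.
rewrite !ReD !ImD !ReN !ImN !Re_mulE !Im_mulE /= !mul0r subr0 addr0.
have -> : (\int[mu]_t re (f0 t * (lor x w t)%:C) = \int[mu]_t (re (f0 t) * lor x w t))%R.
  by apply: eq_Rintegral => t _; rewrite Re_mulE /= mulr0 subr0.
have -> : (\int[mu]_t im (f0 t * (lor x w t)%:C) = \int[mu]_t (im (f0 t) * lor x w t))%R.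
  by apply: eq_Rintegral => t _; rewrite Im_mulE /= mulr0 add0r.
lra.
Qed.

End HardyBoundary.

(** * Kernels with both poles in the right half-plane *)

Section KernelConsequences.
Variable R : realType.
Local Notation C := R[i].
Local Notation nc := (@Normc.normc R).
Local Notation re := (@complex.Re R).
Local Notation RM := (measurableTypeR R).
Implicit Types (x w t e : R) (p q m : C).

Definition reproduces (f0 : RM -> C) (f : C -> C) := forall p m,
  0 < re p -> re m < 0 ->
  cint setT (fun t => f0 t * (rk p t * rk m t)) = - (2 * pi)%:C * (f p / (p - m)).

Variables (f0 : RM -> C) (f : C -> C).
Hypotheses (f02 : l2 f0) (f0f : reproduces f0 f).

(** [reproduces] wants one pole on each side. With [m = -1], partial fractions write [rk p * rk q]
    as [((p - m) rk p rk m - (q - m) rk q rk m) / (p - q)], and the factors [p - m] and [q - m]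
    cancel those of the formula. *)
Lemma reproduces_difference p q : 0 < re p -> 0 < re q -> p != q ->
  cint setT (fun t => f0 t * (rk p t * rk q t)) =
  - (2 * pi)%:C * ((f p - f q) / (p - q)).
Proof.
move=> p0 q0 pq; have p1 : re p != 0 by rewrite gt_eqF.
have q1 : re q != 0 by rewrite gt_eqF.
pose m : C := -1; have m0 : re m < 0 by rewrite /= ltrN10.
have m1 : re m != 0 by rewrite lt_eqF.
have pm : p - m != 0 by rewrite subr_eq0; apply: contraTneq p0 => ->; rewrite -leNgt ltW.
have qm : q - m != 0 by rewrite subr_eq0; apply: contraTneq q0 => ->; rewrite -leNgt ltW.
have pq0 : p - q != 0 by rewrite subr_eq0.
have ip : cinteg setT (fun t => f0 t * (rk p t * rk m t)).
  by apply: l2_cintegM => //; apply: l2_rkM => //; exact: l2_rk.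
have iq : cinteg setT (fun t => f0 t * (rk q t * rk m t)).
  by apply: l2_cintegM => //; apply: l2_rkM => //; exact: l2_rk.
rewrite (@eq_cint _ _ _ (fun t => (p - m) / (p - q) * (f0 t * (rk p t * rk m t)) -
    (q - m) / (p - q) * (f0 t * (rk q t * rk m t)))); last first.
  move=> t _; rewrite /rk; field.
  by rewrite pq0 !rk_neq0.
rewrite cintB//; [|exact: cintegZ..].
rewrite !cintZ// f0f// f0f//.
by field; rewrite pm qm pq0.
Qed.

(** The limit of [reproduces_difference] as the second pole [p + h] tends to [p]: the kernels differ
    by [h * rk (p + h) * rk p ^ 2], whose last three factors stay bounded in L2 while
    [|h| < re p / 2]. *)
Lemma reproduces_derivative p (L : C) : 0 < re p -> cdiff f p L ->
  cint setT (fun t => f0 t * (rk p t * rk p t)) = - (2 * pi)%:C * L.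
Proof.
move=> p0 fL; have p1 : re p != 0 by rewrite gt_eqF.
pose a := re p; have a0 : 0 < a by [].
pose A : C := - (2 * pi)%:C.
pose I0 := cint setT (fun t => f0 t * (rk p t * rk p t)).
(* The kernels with poles [p + h] and [p] are bounded by [(a / 2)^-1] and [a^-1]. The final 1 turns
   the Cauchy-Schwarz bound [J ^+ 2 <= Q - 1] into [J <= Q]. *)
pose Q := 4 * (n2 f0 * (((a / 2)^-1 * a^-1) ^+ 2 * n2 (rk p))) + 1.
have Q0 : 0 < Q.
  apply: ltr_wpDl => //; apply: mulr_ge0 => //; apply: mulr_ge0; first exact: n2_ge0.
  by apply: mulr_ge0; [exact: sqr_ge0|exact: n2_ge0].
have bound (h : C) : h != 0 -> nc h < a / 2 ->
    nc (A * ((f (p + h) - f p) / h) - I0) <= Q * nc h.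
  move=> h0 ha.
  have rq : a / 2 <= re (p + h).
    rewrite ReD -/a; have := ler_Re_normc h; rewrite ler_norml => /andP[h1 _].
    lra.
  have q0 : 0 < re (p + h) by apply: lt_le_trans rq; rewrite divr_gt0.
  have q1 : re (p + h) != 0 by rewrite gt_eqF.
  have pq : p + h != p by rewrite -subr_eq0 addrAC subrr add0r.
  have := reproduces_difference q0 p0 pq.
  rewrite addrAC subrr add0r -/A => <-.
  have k1 : l2 (fun t => rk p t * rk p t) by apply: l2_rkM => //; exact: l2_rk.
  have k2 : l2 (fun t => rk (p + h) t * rk p t) by apply: l2_rkM => //; exact: l2_rk.
  have k3 : l2 (fun t => rk (p + h) t * (rk p t * rk p t)) by exact: l2_rkM.
  rewrite /I0 -cintB//; [|exact: l2_cintegM..].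
  rewrite (@eq_cint _ _ _ (fun t => h * (f0 t * (rk (p + h) t * (rk p t * rk p t)))));
      last first.
    move=> t _; rewrite -mulrBr -mulrBl rkB// addrAC subrr add0r.
    by ring.
  rewrite cintZ//; last exact: l2_cintegM.
  rewrite Normc.normcM mulrC ler_wpM2r ?normc_ge0//.
  set J := nc _; have J0 : 0 <= J by exact: normc_ge0.
  have : J ^+ 2 <= Q - 1.
    rewrite addrK; apply: le_trans (normc_cintM f02 k3) _.
    rewrite ler_pM2l// ler_wpM2l ?n2_ge0//.
    have [_ i3] := k3; have [_ ip] := l2_rk p1.
    rewrite /n2 -RintegralZl//; apply: le_Rintegral => //; first exact: integZ.
    move=> t _; rewrite mulrA !Normc.normcM exprMn ler_wpM2r ?sqr_ge0//.
    have a20 : 0 < a / 2 by rewrite divr_gt0.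
    have h1 : nc (rk (p + h) t) <= (a / 2)^-1.
      by apply: normc_rk_le => //; rewrite (le_trans rq)// ler_norm.
    have h2 : nc (rk p t) <= a^-1 by apply: normc_rk_le => //; exact: ler_norm.
    rewrite ler_pXn2r ?nnegrE ?mulr_ge0 ?normc_ge0 ?invr_ge0 ?(ltW a0) ?(ltW a20)//.
    by apply: ler_pM; rewrite ?normc_ge0.
  by have := sqr_ge0 (J - 1); nra.
apply/esym/eqP; rewrite -subr_eq0 -normc_eq0 eq_le normc_ge0 andbT.
apply/ler_addgt0Pl => e e0; rewrite addr0 -/I0.
have e20 : 0 < e / 2 by rewrite divr_gt0.
have A1 : 0 < nc A + 1 by rewrite ltr_wpDl// normc_ge0.
have [d d0 Hd] := fL _ (divr_gt0 e20 A1).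
pose r := Num.min (d / 2) (Num.min (a / 4) (e / 2 / Q)).
have r0 : 0 < r by rewrite !lt_min !divr_gt0.
have rd : r < d by rewrite gt_min; apply/orP; left; lra.
have ra : r < a / 2 by rewrite !gt_min; apply/orP; right; apply/orP; left; lra.
have rQ : r <= e / 2 / Q by rewrite !ge_min lexx !orbT.
pose h : C := r%:C.
have nch : nc h = r by rewrite normc_real gtr0_norm.
have h0 : h != 0 by rewrite -normc_gt0 nch.
have b1 := bound h h0; rewrite nch in b1; have {}b1 := b1 ra.
have b2 : nc (A * (L - (f (p + h) - f p) / h)) <= e / 2.
  have := Hd h; rewrite nch => /(_ rd) H.
  have -> : L - (f (p + h) - f p) / h = - ((f (p + h) - f p - L * h) / h) by field.
  rewrite (Normc.normcM A) (normcN (_ / h)) (Normc.normcM _ h^-1) Normc.normcV nch.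
  have : nc (f (p + h) - f p - L * h) / r <= e / 2 / (nc A + 1).
    by rewrite ler_pdivrMr.
  rewrite ler_pdivlMr// => H'; apply: le_trans H'; rewrite mulrC.
  by rewrite ler_wpM2l ?mulr_ge0 ?normc_ge0 ?invr_ge0 ?(ltW r0)// lerDl.
rewrite (_ : - (2 * pi)%:C * L - I0 = A * (L - (f (p + h) - f p) / h) +
    (A * ((f (p + h) - f p) / h) - I0)); last by rewrite -/A; ring.
apply: le_trans (ler_normcD _ _) _.
have : Q * r <= e / 2 by rewrite mulrC -ler_pdivlMr.
lra.
Qed.

End KernelConsequences.

(** * Perturbation of diagonal second-order models *)

Section Variation.
Variable R : realType.

(** Fermat's rule: minimality makes the first-order gain [2 * t * X t] at most the second-order cost
    [t ^+ 2 * B]. Dividing by positive and by negative [t] bounds the limit [X0] of [X] from both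
    sides by 0. *)
Lemma first_variation (X : R -> R) (X0 A B d : R) : 0 < d -> 0 <= A -> 0 <= B ->
  (forall t, `|t| < d -> 2 * t * X t <= t ^+ 2 * B) ->
  (forall t, `|t| < d -> `|X t - X0| <= `|t| * A) -> X0 = 0.
Proof.
move=> d0 A0 B0 H1 H2; apply/eqP; rewrite -normr_eq0 eq_le normr_ge0 andbT.
apply/ler_addgt0Pl => e e0; rewrite addr0.
have K0 : 0 < A + B + 1 by rewrite ltr_wpDl// addr_ge0.
pose t := Num.min (d / 2) (e / (A + B + 1)).
have t0 : 0 < t by rewrite lt_min !divr_gt0.
have td : t < d by rewrite gt_min; apply/orP; left; lra.
have te : t * (A + B + 1) <= e by rewrite -ler_pdivlMr// ge_min lexx orbT.
have h1 := H1 t; have h2 := H2 t; rewrite gtr0_norm// in h1 h2.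
have h3 := H1 (- t); have h4 := H2 (- t); rewrite normrN gtr0_norm// in h3 h4.
have {}h1 : 2 * X t <= t * B.
  have := h1 td; have -> : 2 * t * X t = t * (2 * X t) by ring.
  have -> : t ^+ 2 * B = t * (t * B) by ring.
  by rewrite ler_pM2l.
have {}h3 : - (2 * X (- t)) <= t * B.
  have := h3 td; have -> : 2 * - t * X (- t) = t * (- (2 * X (- t))) by ring.
  have -> : (- t) ^+ 2 * B = t * (t * B) by ring.
  by rewrite ler_pM2l.
have := h2 td; have := h4 td; rewrite !ler_norml => /andP[h5 h6] /andP[h7 h8].
have tA : 0 <= t * A by rewrite mulr_ge0// ltW.
have tB : 0 <= t * B by rewrite mulr_ge0// ltW.
lra.
Qed.

End Variation.

(** * Closure properties of the scalar Hardy space *)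

Section HardyClosure.
Variable R : realType.
Local Notation C := R[i].
Local Notation nc := (@Normc.normc R).
Local Notation re := (@complex.Re R).
Local Notation im := (@complex.Im R).
Local Notation mu := (@lebesgue_measure R).
Local Notation RM := (measurableTypeR R).
Implicit Types (f g : C -> C) (z : C).

Definition is_hardy f := exists M, scalar_hardy f M.

Lemma cmeas_hardy f (x : R) : (forall z, 0 < re z -> exists L, cdiff f z L) ->
  0 < x -> cmeas setT (fun w => f (x +i* w)).
Proof.
by move=> fd x0; apply: cmeas_vertical => w; have [//|L /cdiff_cont] := fd (x +i* w).
Qed.

Lemma is_hardy_le f (u : R -> RM -> R) (M : R) :
  (forall z, 0 < re z -> exists L, cdiff f z L) ->
  (forall x, 0 < x -> integ setT (u x)) ->
  (forall x, 0 < x -> (\int[mu]_w u x w)%R <= M) ->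
  (forall x w, 0 < x -> nc (f (x +i* w)) ^+ 2 <= u x w) -> is_hardy f.
Proof.
move=> fd iu uM fu; exists M; split => // x x0.
have mf := cmeas_hardy fd x0.
apply: (@le_trans _ _ (\int[mu]_w (u x w)%:E)%E).
  apply: ge0_le_integral => //=.
  - by move=> w _; rewrite lee_fin sqr_ge0.
  - by apply/measurable_EFinP; exact: measurable_sqr_normc.
  - by apply/measurable_EFinP; exact: integ_measurable (iu x x0).
  - by move=> w _; rewrite lee_fin fu.
rewrite -(@fineK _ (\int[mu]_w (u x w)%:E)%E) ?lee_fin; first exact: uM.
exact: integrable_fin_num (iu x x0).
Qed.

Lemma is_hardyD f g : is_hardy f -> is_hardy g -> is_hardy (fun z => f z + g z).
Proof.
move=> [M fM] [M' gM'].
apply: (@is_hardy_le _ (fun x w => 2 * nc (f (x +i* w)) ^+ 2 + 2 * nc (g (x +i* w)) ^+ 2)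
  (2 * M + 2 * M')).
- move=> z z0; have [L fL] := fM.1 z z0; have [L' gL'] := gM'.1 z z0.
  by exists (L + L'); exact: cdiffD.
- move=> x x0; have [[_ i1] _] := scalar_hardy_l2 fM x0.
  by have [[_ i2] _] := scalar_hardy_l2 gM' x0; apply: integD => //; exact: integZ.
- move=> x x0; have [[_ i1] h1] := scalar_hardy_l2 fM x0.
  have [[_ i2] h2] := scalar_hardy_l2 gM' x0.
  rewrite RintegralD//; [|exact: integZ..].
  by rewrite !RintegralZl// lerD// ler_pM2l.
- by move=> x w _; exact: sqr_normcD_le.
Qed.

Lemma is_hardyZ f (c : C) : is_hardy f -> is_hardy (fun z => c * f z).
Proof.
move=> [M fM].
apply: (@is_hardy_le _ (fun x w => nc c ^+ 2 * nc (f (x +i* w)) ^+ 2) (nc c ^+ 2 * M)).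
- move=> z z0; have [L fL] := fM.1 z z0.
  by eexists; apply: cdiffM; [exact: cdiff_cst|exact: fL].
- by move=> x x0; have [[_ i1] _] := scalar_hardy_l2 fM x0; apply: integZ.
- move=> x x0; have [[_ i1] h1] := scalar_hardy_l2 fM x0.
  by rewrite RintegralZl// ler_wpM2l// sqr_ge0.
- by move=> x w _; rewrite Normc.normcM exprMn.
Qed.

Lemma is_hardy0 : is_hardy (fun=> 0).
Proof.
apply: (@is_hardy_le _ (fun _ _ => 0) 0).
- by move=> z _; exists 0; exact: cdiff_cst.
- by move=> x _; exact: integ0.
- by move=> x _; rewrite Rintegral_cst// mul0r.
- by move=> x w _; rewrite Normc.normc0 expr0n.
Qed.

Lemma is_hardy_sum (I : Type) (s : seq I) (F : I -> C -> C) :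
  (forall i, is_hardy (F i)) -> is_hardy (fun z => \sum_(i <- s) F i z).
Proof.
move=> HF; elim: s => [|i s IH].
  by under eq_fun do rewrite big_nil; exact: is_hardy0.
by under eq_fun do rewrite big_cons; exact: is_hardyD.
Qed.

(** On the right half-plane one factor is bounded by [1 / b], and the square of the other by a
    Lorentzian that does not depend on the abscissa. *)
Lemma is_hardy_rational (l m : C) : re l < 0 -> re m < 0 ->
  is_hardy (fun z => ((z - l) * (z - m))^-1).
Proof.
move=> l0 m0; pose a := - re l; pose b := - re m.
have a0 : 0 < a by rewrite oppr_gt0. have b0 : 0 < b by rewrite oppr_gt0.
have nz (k z : C) : re k < 0 -> 0 < re z -> z - k != 0.
  move=> k0 z0; rewrite subr_eq0; apply: contraTneq z0 => ->.
  by rewrite -leNgt ltW.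
apply: (@is_hardy_le _ (fun _ w => b ^- 2 * lor a (im l) w) (b ^- 2 * (pi / a))).
- move=> z z0; eexists; apply: cdiffV; last first.
    by apply: cdiffM; apply: cdiffB; [exact: cdiff_id|exact: cdiff_cst|
      exact: cdiff_id|exact: cdiff_cst].
  by rewrite mulf_neq0// nz.
- by move=> x _; apply: integZ => //; exact: integ_lor.
- by move=> x _; rewrite RintegralZl ?Rintegral_lor//; exact: integ_lor.
- move=> x w x0; rewrite invfM Normc.normcM !Normc.normcV exprMn !exprVn mulrC.
  have h1 : 0 < a ^+ 2 + (w - im l) ^+ 2 by rewrite ltr_pwDl ?exprn_gt0// sqr_ge0.
  have ax : a ^+ 2 <= (x - re l) ^+ 2.
    have h3 : a <= x - re l by rewrite /a; lra.
    by rewrite ler_pXn2r ?nnegrE ?(ltW a0)// (le_trans (ltW a0)).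
  have bx : b ^+ 2 <= (x - re m) ^+ 2.
    have h3 : b <= x - re m by rewrite /b; lra.
    by rewrite ler_pXn2r ?nnegrE ?(ltW b0)// (le_trans (ltW b0)).
  have b20 : 0 < b ^+ 2 by rewrite exprn_gt0.
  apply: ler_pM; rewrite ?invr_ge0 ?sqr_ge0// sqr_normcE ReD ImD ReN ImN /=.
    rewrite lef_pV2 ?posrE//; last by rewrite ltr_pwDl ?sqr_ge0// (lt_le_trans b20).
    by apply: le_trans bx _; rewrite lerDl sqr_ge0.
  rewrite /lor lef_pV2 ?posrE ?lerD2r//.
  by apply: lt_le_trans h1 _; rewrite lerD2r.
Qed.

Lemma is_hardy_eq f g : (forall z, 0 < re z -> f z = g z) -> is_hardy f -> is_hardy g.
Proof.
move=> fg [M fM]; apply: (@is_hardy_le _ (fun x w => nc (f (x +i* w)) ^+ 2) M).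
- move=> z z0; have [L fL] := fM.1 z z0; exists L.
  apply: (near_eq_cdiff z0 _ fL) => w wz; apply: fg.
  have := le_lt_trans (ler_Re_normc _) wz; rewrite ReD ReN ltr_norml.
  by move=> /andP[h _]; lra.
- by move=> x x0; have [[_ i1] _] := scalar_hardy_l2 fM x0.
- by move=> x x0; have [[_ i1] h1] := scalar_hardy_l2 fM x0.
- by move=> x w x0; rewrite fg.
Qed.

Lemma lim_at_right0 (F : R -> C) (L : C) :
  (forall e, 0 < e -> exists2 d, 0 < d & forall x, 0 < x -> x < d -> nc (F x - L) < e) ->
  lim ((F x : C^o) @[x --> (0 : R)^'+]) = L.
Proof.
move=> FL; apply: cvg_lim; first exact: norm_hausdorff.
apply/cvgrPdist_lt => e /gtc0_realE[e' e0 ->].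
have [d d0 Hd] := FL e' e0; apply/near_at_right; exists d => // x x0 xd.
by rewrite normc_normr ltcR normc_distC; exact: Hd.
Qed.

End HardyClosure.

(** * Transfer functions of diagonal models *)

Section DiagonalModels.
Variables (R : realType) (no ni r : nat).
Local Notation C := R[i].
Local Notation re := (@complex.Re R).
Local Notation im := (@complex.Im R).
Implicit Types (S : so_model R no ni r) (s z : C) (k : 'I_r).

Definition den S k s : C := s ^+ 2 + s * (so_E S k k)%:C + (so_K S k k)%:C.

Lemma so_pencil_diag S s : is_diag_mx (so_E S) -> is_diag_mx (so_K S) ->
  so_pencil S s = diag_mx (\row_k den S k s).
Proof.
move=> /is_diag_mxP dE /is_diag_mxP dK; apply/matrixP => a b.
rewrite !mxE; have [->|ab] := eqVneq a b; first by rewrite !mulr1n.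
by rewrite dE// dK// !mulr0n mulr0 !add0r.
Qed.

Lemma so_eigenvalue_den S s : is_diag_mx (so_E S) -> is_diag_mx (so_K S) ->
  so_eigenvalue S s <-> exists k, den S k s = 0.
Proof.
move=> dE dK; rewrite /so_eigenvalue so_pencil_diag// unitmxE det_diag unitfE negbK.
split => [/prodf_eq0[k _]|[k kE]].
  by rewrite mxE => /eqP; exists k.
by apply/prodf_eq0; exists k => //; rewrite mxE kE.
Qed.

Lemma so_tfE S s i j : is_diag_mx (so_E S) -> is_diag_mx (so_K S) ->
  (forall k, den S k s != 0) ->
  so_tf S s i j = \sum_k (so_C S i k * so_B S k j)%:C * (den S k s)^-1.
Proof.
move=> dE dK den0; rewrite /so_tf.
have -> : invmx (so_pencil S s) = diag_mx (\row_k (den S k s)^-1).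
  rewrite so_pencil_diag//; set A := diag_mx _; set B := diag_mx _.
  have uA : A \in unitmx.
    rewrite unitmxE det_diag unitfE; apply/prodf_neq0 => k _.
    by rewrite mxE.
  rewrite -[B](mulKmx uA) mulmx_diag -[LHS]mulmx1; congr (_ *m _).
  apply/matrixP => a b; rewrite !mxE; have [->|ab] := eqVneq a b; last by rewrite !mulr0n.
  by rewrite mulfV.
rewrite mxE; apply: eq_bigr => k _.
rewrite mul_mx_diag !mxE rmorphM; ring.
Qed.

Lemma Sigma_DSO_den S k s : Sigma_DSO S -> 0 <= re s -> den S k s != 0.
Proof.
move=> [dE dK eig] s0; apply/eqP => kE.
have /eig : so_eigenvalue S s by apply/so_eigenvalue_den => //; exists k.
by rewrite /left_half_plane /= ltNge s0.
Qed.

Lemma quadratic_stable (e k : R) s : 0 < e -> 0 < k ->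
  s ^+ 2 + s * e%:C + k%:C = 0 -> re s < 0.
Proof.
case: s => x y e0 k0 H; have := congr1 re H; have := congr1 im H.
rewrite /= !(mulr0, add0r, addr0, subr0) => h1 h2.
rewrite ltNge; apply/negP => x0.
have : y * (2 * x + e) = 0.
  by rewrite -[RHS]h1; ring.
move=> /eqP; rewrite mulf_eq0 => /orP[/eqP y0|/eqP xe]; last by lra.
rewrite y0 in h2; nra.
Qed.

(** Stability in a form that visibly survives small changes of the diagonal entries; it admits the
    perturbed models as competitors. *)
Lemma Sigma_DSO_pos S : is_diag_mx (so_E S) -> is_diag_mx (so_K S) ->
  (forall k, 0 < so_E S k k) -> (forall k, 0 < so_K S k k) -> Sigma_DSO S.
Proof.
move=> dE dK E0 K0; split => // s /(so_eigenvalue_den s dE dK)[k].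
exact: quadratic_stable.
Qed.

Lemma cdiff_den S k s : exists L, cdiff (den S k) s L.
Proof.
eexists; apply: cdiffD; last exact: cdiff_cst.
apply: cdiffD; last by apply: cdiffM; [exact: cdiff_id|exact: cdiff_cst].
rewrite (_ : (fun x => x ^+ 2) = (fun x : C => x * x)); last by apply/funext => x.
by apply: cdiffM; exact: cdiff_id.
Qed.

Lemma ccont_sum (I : Type) (l : seq I) (F : I -> C -> C) z :
  (forall i, ccont (F i) z) -> ccont (fun x => \sum_(i <- l) F i x) z.
Proof.
move=> HF; elim: l => [|i l IH].
  by under eq_fun do rewrite big_nil; exact: ccont_cst.
by under eq_fun do rewrite big_cons; exact: ccontD.
Qed.

(* Entry of [so_tf], in a form that is meaningful for every [s]: [so_tf] is
   defined by [invmx], which is junk when a single [den S k s] vanishes. *)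
Definition so_entry S i j s : C :=
  \sum_k (so_C S i k * so_B S k j)%:C * (den S k s)^-1.

Lemma so_tf_entry S s i j : Sigma_DSO S -> 0 <= re s -> so_tf S s i j = so_entry S i j s.
Proof.
move=> SS s0; have [dE dK _] := SS.
by apply: so_tfE => // k; exact: Sigma_DSO_den.
Qed.

Lemma ccont_so_entry S i j s : Sigma_DSO S -> 0 <= re s -> ccont (so_entry S i j) s.
Proof.
move=> SS s0; apply: ccont_sum => k; apply: ccontM; first exact: ccont_cst.
apply: ccontV; first exact: Sigma_DSO_den.
by have [L /cdiff_cont] := cdiff_den S k s.
Qed.

Lemma so_entry_conj S i j s : so_entry S i j (conjc s) = conjc (so_entry S i j s).
Proof.
have conjD (a b : C) : conjc (a + b) = conjc a + conjc b.
  by case: a b => ? ? [? ?]; apply: eq_ReIm => /=; ring.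
rewrite /so_entry (big_morph (@conjc R) conjD (conjc0 R)); apply: eq_bigr => k _.
rewrite conjcM conjc_real conjc_inv; congr (_ * _^-1).
rewrite /den; case: s => x y; apply: eq_ReIm => /=; ring.
Qed.

End DiagonalModels.

(** * The Hardy norm as an L2 norm of boundary functions *)

Section BoundaryNorm.
Import HBNNSimple.
Variable R : realType.
Local Notation C := R[i].
Local Notation nc := (@Normc.normc R).
Local Notation mu := (@lebesgue_measure R).
Local Notation RM := (measurableTypeR R).

(* The integral of a nonnegative function is a supremum over simple functions,
   which may be cut off on the null set. *)
Lemma ge0_ae_le_integral_nomeas (f g : RM -> \bar R) :
  (forall w, (0 <= f w)%E) -> (forall w, (0 <= g w)%E) ->
  {ae mu, forall w, f w = g w} -> (\int[mu]_w f w <= \int[mu]_w g w)%E.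
Proof.
move=> f0 g0 [N [mN muN subN]].
rewrite ge0_integralTE// [leRHS]ge0_integralTE//.
apply: ge_ereal_sup => _ [h /= hf <-].
have mC : measurable (~` N) by exact: measurableC.
pose h' := proj_nnsfun h mC.
rewrite (_ : sintegral mu h = sintegral mu h'); last first.
  rewrite -!integralT_nnsfun; apply: ge0_ae_eq_integral => //.
  - by apply/measurable_EFinP.
  - by apply/measurable_EFinP.
  - by move=> w _; rewrite lee_fin.
  - by move=> w _; rewrite lee_fin.
  - exists N; split => // w /= hw; apply: contrapT => Nw; apply: hw => _.
    congr EFin; transitivity (h w * \1_(~` N) w); last by [].
    by rewrite indicE mem_set// mulr1.
apply: ereal_sup_ubound => /=; exists h' => // w.
change ((h w * \1_(~` N) w)%:E <= g w)%E.
rewrite indicE; have [Nw|Nw] := pselect (N w).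
  by rewrite memNset ?mulr0//= => /(_ Nw).
rewrite mem_set// mulr1; apply: le_trans (hf w) _.
by rewrite (_ : f w = g w)//; apply: contrapT => fg; apply: Nw; exact: subN.
Qed.

Lemma ge0_ae_eq_integral_nomeas (f g : RM -> \bar R) :
  (forall w, (0 <= f w)%E) -> (forall w, (0 <= g w)%E) ->
  {ae mu, forall w, f w = g w} -> (\int[mu]_w f w = \int[mu]_w g w)%E.
Proof.
move=> f0 g0 fg; apply/eqP; rewrite eq_le !ge0_ae_le_integral_nomeas//.
by apply: filterS fg => w ->.
Qed.

Lemma integ_sum (I : Type) (s : seq I) (F : I -> RM -> R) :
  (forall i, integ setT (F i)) -> integ setT (fun w => \sum_(i <- s) F i w).
Proof.
move=> HF; elim: s => [|i s IH].
  by under eq_fun do rewrite big_nil; exact: integ0.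
by under eq_fun do rewrite big_cons; exact: integD.
Qed.

Lemma Rintegral_sum (I : Type) (s : seq I) (F : I -> RM -> R) :
  (forall i, integ setT (F i)) ->
  (\int[mu]_w \sum_(i <- s) F i w = \sum_(i <- s) \int[mu]_w F i w)%R.
Proof.
move=> HF; elim: s => [|i s IH].
  rewrite big_nil (@eq_Rintegral _ _ _ mu setT (fun=> 0)); first by rewrite Rintegral_cst// mul0r.
  by move=> w _; rewrite big_nil.
rewrite big_cons -IH -RintegralD//; [|exact: HF|exact: integ_sum].
by apply: eq_Rintegral => w _; rewrite big_cons.
Qed.

Variables (no ni : nat).

Lemma sqr_frobenius (A : 'M[C]_(no, ni)) :
  frobenius A ^+ 2 = \sum_i \sum_j nc (A i j) ^+ 2.
Proof.
rewrite /frobenius sqr_sqrtr//; apply: sumr_ge0 => i _; apply: sumr_ge0 => j _.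
exact: sqr_ge0.
Qed.

(** [boundary_value] is a [lim], with a default value wherever the limit fails, and its
    measurability is not assumed. It is therefore exchanged with [b] by the comparison of integrals
    that asks for none. *)
Lemma h2norm_boundary (F : C -> 'M[C]_(no, ni)) (b : 'I_no -> 'I_ni -> RM -> C) :
  (forall i j, l2 (b i j)) ->
  {ae mu, forall w : RM, forall i j, forall e, 0 < e -> exists2 d, 0 < d &
    forall x, 0 < x -> x < d -> nc (F (x +i* w) i j - b i j w) < e} ->
  h2norm F = (((2 * pi)^-1 * \sum_i \sum_j n2 (b i j)) `^ 2^-1)%:E.
Proof.
move=> b2 Fb; rewrite /h2norm.
have ib i : integ setT (fun w => \sum_j nc (b i j w) ^+ 2).
  by apply: integ_sum => j; have [] := b2 i j.
have -> : (\int[mu]_w (frobenius (boundary_value F w) ^+ 2)%:E =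
    (\sum_i \sum_j n2 (b i j))%:E)%E.
  rewrite (@ge0_ae_eq_integral_nomeas _
    (fun w => (\sum_i \sum_j nc (b i j w) ^+ 2)%:E)).
  - rewrite (_ : \sum_i _ = (\int[mu]_w \sum_i \sum_j nc (b i j w) ^+ 2)%R).
      by rewrite /Rintegral fineK//; apply: integrable_fin_num => //; exact: integ_sum.
    rewrite Rintegral_sum//; apply: eq_bigr => i _.
    by rewrite Rintegral_sum// => j; have [] := b2 i j.
  - by move=> w; rewrite lee_fin sqr_ge0.
  - move=> w; rewrite lee_fin; apply: sumr_ge0 => i _; apply: sumr_ge0 => j _.
    exact: sqr_ge0.
  - apply: filterS Fb => w Fw; rewrite sqr_frobenius; congr EFin.
    apply: eq_bigr => i _; apply: eq_bigr => j _; rewrite mxE.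
    by rewrite (lim_at_right0 (Fw i j)).
by rewrite -EFinM poweR_EFin.
Qed.

End BoundaryNorm.

(** * First-order optimality *)

Section Stationarity.
Variable R : realType.
Local Notation C := R[i].
Local Notation nc := (@Normc.normc R).
Local Notation re := (@complex.Re R).
Local Notation mu := (@lebesgue_measure R).
Local Notation RM := (measurableTypeR R).
Variables (no ni r : nat) (H : C -> 'M[C]_(no, ni)) (S : so_model R no ni r).
Variable g0 : 'I_no -> 'I_ni -> RM -> C.
Hypothesis g02 : forall i j, l2 (g0 i j).
Hypothesis g0lim : {ae mu, forall w : RM, forall i j, forall e, 0 < e ->
  exists2 d, 0 < d & forall x, 0 < x -> x < d ->
    nc (H (x +i* w) i j - so_entry S i j (x +i* w) - g0 i j w) < e}.
Hypothesis S_opt : h2_optimal H (@Sigma_DSO R no ni r) S.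

(** Stable models are continuous up to the imaginary axis, so the error of the competitor has
    boundary function [g0 - D]; the factor [1 / (2 pi)] and the square root are removed by
    monotonicity. *)
Lemma optimality_inequality (S' : so_model R no ni r)
    (D : 'I_no -> 'I_ni -> RM -> C) : Sigma_DSO S' -> (forall i j, l2 (D i j)) ->
  (forall i j w, so_entry S' i j (0 +i* w) - so_entry S i j (0 +i* w) = D i j w) ->
  \sum_i \sum_j n2 (g0 i j) <= \sum_i \sum_j n2 (fun w => g0 i j w - D i j w).
Proof.
move=> SS' D2 DE; have [SS opt] := S_opt.
(* Needed for [T = S'] and, with the zero perturbation, for [T = S]. *)
have norm (T : so_model R no ni r) (E : 'I_no -> 'I_ni -> RM -> C) :
    Sigma_DSO T -> (forall i j, l2 (E i j)) ->
    (forall i j w, so_entry T i j (0 +i* w) - so_entry S i j (0 +i* w) = E i j w) ->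
    h2norm (fun s => H s - so_tf T s) =
      (((2 * pi)^-1 * \sum_i \sum_j n2 (fun w => g0 i j w - E i j w)) `^ 2^-1)%:E.
  move=> ST E2 EE; apply: h2norm_boundary; first by move=> i j; exact: l2B.
  apply: filterS g0lim => w gw i j e e0.
  have e30 : 0 < e / 3 by rewrite divr_gt0.
  have [d1 d10 Hd1] := gw i j _ e30.
  have w0 : 0 <= re (0 +i* w) by [].
  have [d2 d20 Hd2] := ccont_so_entry i j ST w0 e30.
  have [d3 d30 Hd3] := ccont_so_entry i j SS w0 e30.
  exists (Num.min d1 (Num.min d2 d3)); first by rewrite !lt_min d10 d20.
  move=> x x0; rewrite !lt_min => /and3P[xd1 xd2 xd3].
  have dx d : x < d -> nc ((x +i* w) - (0 +i* w)) < d.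
    move=> xd; rewrite (_ : _ - _ = x%:C); first by rewrite normc_real gtr0_norm.
    by apply: eq_ReIm; rewrite /= ?subr0 ?subrr.
  have h1 := Hd1 x x0 xd1; have h2 := Hd2 _ (dx _ xd2); have h3 := Hd3 _ (dx _ xd3).
  rewrite mxE [X in _ + X - _]mxE so_tf_entry//=; last exact: ltW.
  rewrite -EE; set a := H _ i j in h1 *; set bS := so_entry S i j (x +i* w) in h1 h3 *.
  set bT := so_entry T i j (x +i* w) in h2 *.
  set cS := so_entry S i j (0 +i* w) in h3 *.
  set cT := so_entry T i j (0 +i* w) in h2 *.
  have -> : a - bT - (g0 i j w - (cT - cS)) = (a - bS - g0 i j w) + (bS - cS) - (bT - cT).
    by ring.
  apply: le_lt_trans (ler_normcB _ _) _.
  have := ler_normcD (a - bS - g0 i j w) (bS - cS); lra.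
have z2 : l2 (fun=> 0 : C).
  have := l2Z 0 (l2_rk (R := R) (p := 1) (oner_neq0 _)).
  by congr l2; apply/funext => w; rewrite mul0r.
have n1 := norm S (fun _ _ _ => 0) SS (fun i j => z2) (fun i j w => subrr _).
have := opt _ SS'; rewrite (norm S' D)// n1 //.
under eq_bigr do under eq_bigr do under eq_n2 do rewrite subr0.
rewrite lee_fin => le12; rewrite leNgt; apply/negP => lt21.
have s0 (F : 'I_no -> 'I_ni -> RM -> C) : 0 <= \sum_i \sum_j n2 (F i j).
  by apply: sumr_ge0 => i _; apply: sumr_ge0 => j _; exact: n2_ge0.
have pi0 : 0 < (2 * pi : R)^-1 by rewrite invr_gt0 mulr_gt0// pi_gt0.
move: le12; rewrite leNgt => /negP; apply.
by apply: gt0_ltr_powR; rewrite ?invr_gt0 ?nnegrE ?mulr_ge0 ?(ltW pi0)// ltr_pM2l.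
Qed.

(** Bilinear rather than sesquilinear: conjugation is written into [k], so that the reproducing
    formulas apply once the conjugate kernel is computed. *)
Definition pairing (m : 'I_no -> 'I_ni -> R) (k : RM -> C) : C :=
  \sum_i \sum_j (m i j)%:C * cint setT (fun w => g0 i j w * k w).

(* Comparing the model with [S_ t] perturbs the boundary error by
   [t * m i j * ka_ t]; this is the vanishing of the derivative at [t = 0] of the
   squared norm. *)
Lemma stationarity (m : 'I_no -> 'I_ni -> R) (ka : RM -> C) (ka_ : R -> RM -> C)
    (S_ : R -> so_model R no ni r) (A d : R) :
  0 < d -> 0 <= A -> l2 ka ->
  (forall t, `|t| < d -> [/\ Sigma_DSO (S_ t), l2 (ka_ t),
     n2 (fun w => ka_ t w - ka w) <= t ^+ 2 * A &
     forall i j w, so_entry (S_ t) i j (0 +i* w) - so_entry S i j (0 +i* w) =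
       (t * m i j)%:C * ka_ t w]) ->
  re (pairing m (fun w => conjc (ka w))) = 0.
Proof.
move=> d0 A0 ka2 Ht.
have reS (T : so_model R no ni r) k : l2 k ->
    re (pairing m k) = \sum_i \sum_j m i j * re (cint setT (fun w => g0 i j w * k w)).
  move=> k2; rewrite /pairing.
  have reD (a b : C) : re (a + b) = re a + re b by exact: ReD.
  rewrite (big_morph re reD (erefl : re 0 = 0)); apply: eq_bigr => i _.
  rewrite (big_morph re reD (erefl : re 0 = 0)); apply: eq_bigr => j _.
  by rewrite Re_mulE /= mul0r subr0.
pose X t := re (pairing m (fun w => conjc (ka_ t w))).
(* A bound for the squared norm of [m i j * ka_ t], summed over the entries, uniform in
   [|t| < d]. *)
pose B := (\sum_i \sum_j m i j ^+ 2) * (2 * n2 ka + 2 * (d ^+ 2 * A)).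
have s0 : 0 <= \sum_i \sum_j m i j ^+ 2.
  by apply: sumr_ge0 => i _; apply: sumr_ge0 => j _; exact: sqr_ge0.
have B0 : 0 <= B.
  rewrite mulr_ge0// addr_ge0// mulr_ge0// ?n2_ge0// mulr_ge0// sqr_ge0//.
(* [1 + Z] stands in for the square root of the Cauchy-Schwarz constant [Z]. *)
pose A' := \sum_i \sum_j `|m i j| * (1 + 4 * (n2 (g0 i j) * A)).
have A'0 : 0 <= A'.
  apply: sumr_ge0 => i _; apply: sumr_ge0 => j _.
  by rewrite mulr_ge0// addr_ge0// mulr_ge0// mulr_ge0// n2_ge0.
apply: (@first_variation _ X _ A' B d) => //.
- move=> t td; have [St k2 nk DE] := Ht t td.
  have kc2 := l2_conj k2.
  have tk2 i j : l2 (fun w => (t * m i j)%:C * ka_ t w) by exact: l2Z.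
  have := optimality_inequality St tk2 DE.
  have -> : \sum_i \sum_j n2 (fun w => g0 i j w - (t * m i j)%:C * ka_ t w) =
      \sum_i \sum_j n2 (g0 i j) + (t ^+ 2 * ((\sum_i \sum_j m i j ^+ 2) * n2 (ka_ t)) -
      2 * t * X t).
    rewrite /X (reS S)//.
    rewrite !big_distrl !big_distrr/= -sumrB -big_split/=; apply: eq_bigr => i _.
    rewrite !big_distrl !big_distrr/= -sumrB -big_split/=; apply: eq_bigr => j _.
    rewrite n2B//.
    have -> : n2 (fun w => (t * m i j)%:C * ka_ t w) = (t * m i j) ^+ 2 * n2 (ka_ t).
      have [_ ik] := k2; rewrite /n2 -RintegralZl//; apply: eq_Rintegral => w _.
      by rewrite Normc.normcM normc_real exprMn real_normK ?num_real.
    rewrite (@eq_cint _ _ _ (fun w => (t * m i j)%:C * (g0 i j w * conjc (ka_ t w)))).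
      rewrite cintZ//; last exact: l2_cintegM.
      by rewrite Re_mulE /= mul0r subr0; ring.
    by move=> w _; rewrite conjcM conjc_real; ring.
  rewrite lerDl subr_ge0 => h; apply: le_trans h _.
  rewrite ler_wpM2l ?sqr_ge0// ler_wpM2l//.
  have n2k : n2 (ka_ t) <= 2 * n2 ka + 2 * n2 (fun w => ka_ t w - ka w).
    have [_ i0] := k2; have [_ i1] := ka2; have [_ i2] := l2B k2 ka2.
    rewrite /n2 -!RintegralZl// -RintegralD//; [|exact: integZ..].
    apply: le_Rintegral => //; first by apply: integD => //; exact: integZ.
    by move=> w _; rewrite -{1}(subrK (ka w) (ka_ t w)) addrC; exact: sqr_normcD_le.
  apply: le_trans n2k _; rewrite lerD2l ler_pM2l//; apply: le_trans nk _.
  rewrite ler_wpM2r// -[leLHS]real_normK ?num_real//.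
  by rewrite ler_pXn2r ?nnegrE ?(ltW d0)// ltW.
- move=> t td; have [St k2 nk DE] := Ht t td.
  have kc2 := l2_conj k2; have kac2 := l2_conj ka2.
  rewrite /X (reS S)// (reS S)// -sumrB.
  rewrite /A' big_distrr/=; apply: le_trans (ler_norm_sum _ _ _) _.
  apply: ler_sum => i _; rewrite -sumrB big_distrr/=.
  apply: le_trans (ler_norm_sum _ _ _) _; apply: ler_sum => j _.
  rewrite -mulrBr normrM mulrCA ler_wpM2l//.
  have reB (a b : C) : re a - re b = re (a - b) by rewrite ReD ReN.
  change (`|re (cint setT (fun w => g0 i j w * conjc (ka_ t w))) -
    re (cint setT (fun w => g0 i j w * conjc (ka w)))| <=
    `|t| * (1 + 4 * (n2 (g0 i j) * A))).
  rewrite reB -cintB//; [|exact: l2_cintegM..].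
  apply: le_trans (ler_Re_normc _) _.
  rewrite (@eq_cint _ _ _ (fun w => g0 i j w * conjc (ka_ t w - ka w))); last first.
    move=> w _; rewrite -mulrBr; congr (_ * _).
    by case: (ka_ t w) (ka w) => a b [a' b']; apply: eq_ReIm => /=; ring.
  set J := nc _; have J0 : 0 <= J by exact: normc_ge0.
  have : J ^+ 2 <= t ^+ 2 * (4 * (n2 (g0 i j) * A)).
    apply: le_trans (normc_cintM (g02 i j) (l2_conj (l2B k2 ka2))) _.
    rewrite (_ : t ^+ 2 * _ = 4 * (n2 (g0 i j) * (t ^+ 2 * A))); last by ring.
    rewrite ler_pM2l// ler_wpM2l ?n2_ge0//; apply: le_trans nk.
    by rewrite le_eqVlt; apply/orP; left; apply/eqP; apply: eq_Rintegral => w _;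
      rewrite normc_conj.
  set Z := 4 * _ => JZ.
  have Z0 : 0 <= Z by rewrite mulr_ge0// mulr_ge0// n2_ge0.
  rewrite -(@ler_pXn2r _ 2) ?nnegrE// ?mulr_ge0 ?addr_ge0//.
  apply: le_trans JZ _; rewrite exprMn real_normK ?num_real//.
  by rewrite ler_wpM2l ?sqr_ge0//; nra.
Qed.

End Stationarity.

Lemma is_diag_mxD_delta (R : pzRingType) n (A : 'M[R]_n) (c : R) k :
  is_diag_mx A -> is_diag_mx (A + c *: delta_mx k k).
Proof.
move=> /is_diag_mxP dA; apply/is_diag_mxP => x y xy; rewrite !mxE dA//.
case: eqP => [xk|_]; case: eqP => [yk|_]; rewrite /= ?mulr0 ?addr0//.
by rewrite xk yk eqxx in xy.
Qed.

(** * Variations of B, C, E and K *)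

Section Perturbations.
Variable R : realType.
Local Notation C := R[i].
Local Notation nc := (@Normc.normc R).
Local Notation re := (@complex.Re R).
Local Notation im := (@complex.Im R).
Local Notation mu := (@lebesgue_measure R).
Local Notation RM := (measurableTypeR R).
Variables (no ni r : nat) (H : C -> 'M[C]_(no, ni)) (S : so_model R no ni r).
Variable g0 : 'I_no -> 'I_ni -> RM -> C.
Hypothesis g02 : forall i j, l2 (g0 i j).
Hypothesis g0lim : {ae mu, forall w : RM, forall i j, forall e, 0 < e ->
  exists2 d, 0 < d & forall x, 0 < x -> x < d ->
    nc (H (x +i* w) i j - so_entry S i j (x +i* w) - g0 i j w) < e}.
Hypothesis S_opt : h2_optimal H (@Sigma_DSO R no ni r) S.
Hypothesis g0sym : forall i j (k : RM -> C), l2 k -> (forall t, k (- t) = conjc (k t)) ->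
  im (cint setT (fun t => g0 i j t * k t)) = 0.

Lemma im_pairing (m : 'I_no -> 'I_ni -> R) (k : RM -> C) :
  l2 k -> (forall t, k (- t) = conjc (k t)) -> im (pairing g0 m k) = 0.
Proof.
move=> k2 ks; have imD (a b : C) : im (a + b) = im a + im b by exact: ImD.
rewrite /pairing (big_morph im imD (erefl : im 0 = 0)); apply: big1 => i _.
rewrite (big_morph im imD (erefl : im 0 = 0)); apply: big1 => j _.
have := g0sym i j k2 ks; set c := cint _ _ => c0.
by rewrite Im_mulE c0 /= mul0r mulr0 addr0.
Qed.

Variables (k : 'I_r) (a b : C).
Hypotheses (a0 : re a < 0) (b0 : re b < 0).
Hypothesis denE : forall s, den S k s = (s - a) * (s - b).

Let psi w : C := (den S k (0 +i* w))^-1.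

Let psiE w : psi w = rk a w * rk b w.
Proof. by rewrite /psi denE invfM. Qed.

Let l2_psi : l2 psi.
Proof.
rewrite (_ : psi = fun w => rk a w * rk b w); last by apply/funext => w; exact: psiE.
by apply: l2_rkM; rewrite ?lt_eqF//; apply: l2_rk; rewrite lt_eqF.
Qed.

Let den_neq0 w : den S k (0 +i* w) != 0.
Proof. by apply: Sigma_DSO_den => //; have [] := S_opt. Qed.

Let den_opp w : den S k (0 +i* (- w)) = conjc (den S k (0 +i* w)).
Proof. by rewrite /den; apply: eq_ReIm => /=; ring. Qed.

(* Real perturbations only control the real part; the imaginary part of the
   pairing vanishes because all functions involved are real symmetric. *)
Lemma pairing_conj_eq0 (m : 'I_no -> 'I_ni -> R) (ka : RM -> C) : l2 ka ->
  (forall t, ka (- t) = conjc (ka t)) ->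
  re (pairing g0 m (fun w => conjc (ka w))) = 0 ->
  pairing g0 m (fun w => conjc (ka w)) = 0.
Proof.
move=> k2 ks h; apply: eq_ReIm => //; apply: im_pairing; first exact: l2_conj.
by move=> t; rewrite ks.
Qed.

(** The transfer function is affine in B, and likewise in C, so the perturbed scalar factor is [psi]
    for every [t] and the remainder constant is 0. *)
Lemma stationarity_B j :
  pairing g0 (fun i j' => so_C S i k * (j' == j)%:R) (fun w => conjc (psi w)) = 0.
Proof.
have [SS _] := S_opt.
pose S_ t := SOModel (so_E S) (so_K S) (so_B S + t *: delta_mx k j) (so_C S).
apply: pairing_conj_eq0 => //.
  by move=> t; rewrite /psi den_opp conjc_inv.
apply: (@stationarity _ _ _ _ H S g0 g02 g0lim S_opt _ psi (fun=> psi) S_ 0 1) => //.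
move=> t _; split => //.
- rewrite mulr0 (@eq_n2 _ _ (fun=> 0)) => [|w]; last by rewrite subrr.
  by rewrite /n2 (@eq_Rintegral _ _ _ mu setT (fun=> 0)) ?Rintegral_cst ?mul0r// => w _;
    rewrite Normc.normc0 expr0n.
- move=> i j' w; rewrite /so_entry -sumrB (bigD1 k)//= big1 ?addr0.
    rewrite /psi /den /= !mxE !eqxx /=; set q := (_)^-1.
    rewrite -mulrBl -rmorphB; congr (_%:C * _); ring.
  move=> l lk; rewrite /den /= !mxE (negbTE lk) /= mulr0 addr0.
  by rewrite subrr.
Qed.

Lemma stationarity_C i :
  pairing g0 (fun i' j => (i' == i)%:R * so_B S k j) (fun w => conjc (psi w)) = 0.
Proof.
have [SS _] := S_opt.
pose S_ t := SOModel (so_E S) (so_K S) (so_B S) (so_C S + t *: delta_mx i k).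
apply: pairing_conj_eq0 => //.
  by move=> t; rewrite /psi den_opp conjc_inv.
apply: (@stationarity _ _ _ _ H S g0 g02 g0lim S_opt _ psi (fun=> psi) S_ 0 1) => //.
move=> t _; split => //.
- rewrite mulr0 (@eq_n2 _ _ (fun=> 0)) => [|w]; last by rewrite subrr.
  by rewrite /n2 (@eq_Rintegral _ _ _ mu setT (fun=> 0)) ?Rintegral_cst ?mul0r// => w _;
    rewrite Normc.normc0 expr0n.
- move=> i' j w; rewrite /so_entry -sumrB (bigD1 k)//= big1 ?addr0.
    rewrite /psi /den /= !mxE !eqxx /= andbT; set q := (_)^-1.
    rewrite -mulrBl -rmorphB; congr (_%:C * _); ring.
  move=> l lk; rewrite /den /= !mxE (negbTE lk) /= andbF mulr0 addr0.
  by rewrite subrr.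
Qed.

Hypothesis E0 : forall l, 0 < so_E S l l.
Hypothesis K0 : forall l, 0 < so_K S l l.

(* The direction is [E + t * al], [K + t * be] in the [k]th diagonal entry. *)
Lemma stationarity_EK (al be : R) :
  pairing g0 (fun i j => so_C S i k * so_B S k j)
    (fun w => conjc (- ((0 +i* w) * al%:C + be%:C) * (psi w * psi w))) = 0.
Proof.
have [SS _] := S_opt; have [dE dK _] := SS.
pose ell (w : R) : C := (0 +i* w) * al%:C + be%:C.
pose M1 := `|re a|^-1; pose M2 := `|re b|^-1.
have ra : 0 < `|re a| by rewrite normr_gt0 lt_eqF.
have rb : 0 < `|re b| by rewrite normr_gt0 lt_eqF.
have M10 : 0 < M1 by rewrite invr_gt0.
have M20 : 0 < M2 by rewrite invr_gt0.
(* A bound for [ell * psi] on the imaginary axis, read off from its expression in [rk a] and [rk b],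
   which are bounded by [M1] and [M2]; the 1 makes it positive. *)
pose D := ((1 + nc a * M1) * `|al| + `|be| * M1) * M2 + 1.
have D0 : 0 < D.
  apply: ltr_wpDl => //; apply: mulr_ge0; last exact: ltW.
  apply: addr_ge0; apply: mulr_ge0 => //; last exact: ltW.
  by apply: addr_ge0 => //; apply: mulr_ge0; [exact: normc_ge0|exact: ltW].
have ellpsi w : nc (ell w * psi w) <= D.
  have ha : nc (rk a w) <= M1 by exact: normc_rk_le.
  have hb : nc (rk b w) <= M2 by exact: normc_rk_le.
  have -> : ell w * psi w = ((1 + a * rk a w) * al%:C + be%:C * rk a w) * rk b w.
    have wa : (0 +i* w) - a != 0 by apply: rk_neq0; rewrite lt_eqF.
    have wb : (0 +i* w) - b != 0 by apply: rk_neq0; rewrite lt_eqF.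
    by rewrite /ell psiE /rk; field; rewrite wa wb.
  rewrite Normc.normcM; apply: (@le_trans _ _ (((1 + nc a * M1) * `|al| + `|be| * M1) * M2)).
    apply: ler_pM; rewrite ?normc_ge0//.
    apply: le_trans (ler_normcD _ _) _; rewrite !Normc.normcM !normc_real lerD//.
      rewrite ler_wpM2r//; apply: le_trans (ler_normcD _ _) _.
      by rewrite Normc.normc1 lerD2l Normc.normcM ler_wpM2l ?normc_ge0.
    by rewrite ler_wpM2l.
  by rewrite lerDl.
have conjell w : ell (- w) = conjc (ell w) by apply: eq_ReIm => /=; ring.
have cell : cmeas setT ell.
  apply: (@cmeas_vertical _ (fun s => s * al%:C + be%:C) 0) => w.
  apply: (@cdiff_cont _ _ _ ((0 +i* w) * 0 + al%:C * 1 + 0)).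
  apply: cdiffD; last exact: cdiff_cst.
  by apply: cdiffM; [exact: cdiff_id|exact: cdiff_cst].
have cpsi : cmeas setT psi by have [] := l2_psi.
pose ka w := - ell w * (psi w * psi w).
have ka2 : l2 ka.
  have := l2N (l2Mbounded l2_psi (cmeasM cell cpsi) ellpsi).
  by congr l2; apply/funext => w; rewrite /ka; ring.
apply: (@pairing_conj_eq0 _ ka) => //.
  move=> t; rewrite /ka conjell /psi den_opp.
  by rewrite !conjcM conjc_inv; congr (_ * _); case: (ell t) => x y; apply: eq_ReIm.
pose S_ t := SOModel (so_E S + (t * al) *: delta_mx k k)
  (so_K S + (t * be) *: delta_mx k k) (so_B S) (so_C S).
(* The perturbed denominator. The identity [1 / q - psi = t * ka_ t] is exact, and [ka] is the value
   of [ka_ t] at [t = 0]. *)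
pose q t w := den S k (0 +i* w) + t%:C * ell w.
pose ka_ t w := - (ell w * psi w) * (q t w)^-1.
(* The first bound keeps [|q|] at least half of the unperturbed denominator, the other two keep the
   perturbed entries positive. *)
pose d := Num.min (D^-1 / 2) (Num.min (so_E S k k / (`|al| + 1)) (so_K S k k / (`|be| + 1))).
have d0 : 0 < d by rewrite !lt_min !divr_gt0 ?invr_gt0 ?E0 ?K0// ltr_wpDl.
(* The remainder is [ka_ t - ka = t * (ell * psi) ^ 2 / q], with [|ell * psi| <= D] and
   [|1 / q| <= 2 |psi|]; squaring gives the constant. *)
apply: (@stationarity _ _ _ _ H S g0 g02 g0lim S_opt _ ka ka_ S_ (4 * D ^+ 4 * n2 psi) d).
- exact: d0.
- by rewrite mulr_ge0 ?n2_ge0// mulr_ge0// exprn_ge0// ltW.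
- exact: ka2.
move=> t; rewrite !lt_min => /and3P[tD tE tK].
have qE w : q t w = den S k (0 +i* w) * (1 + t%:C * (ell w * psi w)).
  by rewrite /q /psi; field; exact: den_neq0.
have half w : 2^-1 <= nc (1 + t%:C * (ell w * psi w)).
  have := ler_sub_normcD 1 (t%:C * (ell w * psi w)).
  rewrite Normc.normc1 Normc.normcM normc_real.
  have := ler_wpM2l (normr_ge0 t) (ellpsi w).
  have : `|t| * D <= 2^-1.
    by rewrite -ler_pdivlMr// mulrC ltW.
  lra.
have q0 w : q t w != 0.
  rewrite qE mulf_neq0 ?den_neq0// -normc_gt0.
  by apply: lt_le_trans (half w); rewrite invr_gt0.
have qV w : nc (q t w)^-1 <= 2 * nc (psi w).
  rewrite qE invfM Normc.normcM mulrC -/(psi w) ler_wpM2r ?normc_ge0//.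
  rewrite Normc.normcV -[leRHS]invrK lef_pV2 ?posrE ?invr_gt0//.
  by apply: lt_le_trans (half w); rewrite invr_gt0.
have cq : cmeas setT (fun w => (q t w)^-1).
  apply: (@cmeas_vertical _ (fun s => (den S k s + t%:C * (s * al%:C + be%:C))^-1) 0) => w.
  apply: ccontV; first exact: q0.
  apply: ccontD; first by have [L /cdiff_cont] := cdiff_den S k (0 +i* w).
  apply: ccontM; first exact: ccont_cst.
  apply: ccontD; last exact: ccont_cst.
  by apply: ccontM; [exact: cdiff_cont (cdiff_id _)|exact: ccont_cst].
have qV2 : l2 (fun w => (q t w)^-1).
  apply: (l2_le cq (integZ 4 measurableT (l2_psi.2))) => w.
  rewrite (_ : 4 * _ = (2 * nc (psi w)) ^+ 2); last by ring.
  by rewrite ler_pXn2r ?nnegrE ?mulr_ge0 ?normc_ge0.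
have kat2 : l2 (ka_ t).
  have := l2N (l2Mbounded qV2 (cmeasM cell cpsi) ellpsi).
  by congr l2; apply/funext => w; rewrite /ka_; ring.
split; last 1 first.
- move=> i j w; rewrite /so_entry -sumrB (bigD1 k)//= big1 ?addr0.
    rewrite -mulrBr; set c := so_C S i k * so_B S k j.
    have -> : den (S_ t) k (0 +i* w) = q t w.
      by rewrite /q /den /ell /= !mxE !eqxx /= !mulr1; apply: eq_ReIm => /=; ring.
    have -> : (t * c)%:C = t%:C * c%:C by exact: rmorphM.
    rewrite /ka_ /psi; have := q0 w; rewrite /q => qn.
    by field; rewrite qn den_neq0.
  move=> l lk; rewrite (_ : den (S_ t) l (0 +i* w) = den S l (0 +i* w)) ?subrr//.
  by rewrite /den /= !mxE (negbTE lk) /= !mulr0 !addr0.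
- apply: Sigma_DSO_pos => /=.
  + exact: is_diag_mxD_delta.
  + exact: is_diag_mxD_delta.
  + move=> l; rewrite !mxE; case: eqP => [->|_]; last by rewrite /= mulr0 addr0.
    rewrite /= mulr1; move: tE; rewrite ltr_pdivlMr ?(ltr_wpDl (normr_ge0 _) ltr01)// => tE.
    have : `|t * al| < so_E S k k.
      by apply: le_lt_trans tE; rewrite normrM mulrDr mulr1 lerDl.
    by rewrite ltr_norml => /andP[h _]; lra.
  + move=> l; rewrite !mxE; case: eqP => [->|_]; last by rewrite /= mulr0 addr0.
    rewrite /= mulr1; move: tK; rewrite ltr_pdivlMr ?(ltr_wpDl (normr_ge0 _) ltr01)// => tK.
    have : `|t * be| < so_K S k k.
      by apply: le_lt_trans tK; rewrite normrM mulrDr mulr1 lerDl.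
    by rewrite ltr_norml => /andP[h _]; lra.
- exact: kat2.
- have [_ ipsi] := l2_psi; have [_ ikk] := l2B kat2 ka2.
  rewrite mulrA /n2 -RintegralZl//; apply: le_Rintegral => //; first exact: integZ.
  move=> w _; have -> : ka_ t w - ka w = t%:C * ((ell w * psi w) ^+ 2 * (q t w)^-1).
    have := q0 w; rewrite /ka_ /ka /psi /q => qn.
    by field; rewrite qn den_neq0.
  rewrite (_ : _ * nc (psi w) ^+ 2 = (`|t| * (D ^+ 2 * (2 * nc (psi w)))) ^+ 2); last first.
    by rewrite exprMn real_normK ?num_real//; ring.
  rewrite ler_pXn2r ?nnegrE ?normc_ge0 ?mulr_ge0 ?normc_ge0 ?(ltW D0)//.
  rewrite Normc.normcM normc_real ler_wpM2l// Normc.normcM normcX.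
  by apply: ler_pM; rewrite ?normc_ge0 ?sqr_ge0// ler_pXn2r ?nnegrE ?normc_ge0//; exact: ltW.
Qed.

End Perturbations.

(** * From orthogonality relations to interpolation conditions *)

Section Interpolation.
Variable R : realType.
Local Notation C := R[i].
Local Notation re := (@complex.Re R).
Local Notation RM := (measurableTypeR R).
Variables (no ni : nat) (g : 'I_no -> 'I_ni -> C -> C).
Variable g0 : 'I_no -> 'I_ni -> RM -> C.
Hypothesis g02 : forall i j, l2 (g0 i j).
Hypothesis g0rep : forall i j, reproduces (g0 i j) (g i j).
Variable m : 'I_no -> 'I_ni -> R.
Local Notation pair := (pairing g0 m).

Lemma pairingD (k k' : RM -> C) : l2 k -> l2 k' ->
  pair (fun w => k w + k' w) = pair k + pair k'.
Proof.
move=> k2 k2'; rewrite /pairing -big_split/=; apply: eq_bigr => i _.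
rewrite -big_split/=; apply: eq_bigr => j _; rewrite -mulrDr; congr (_ * _).
rewrite -cintD//; [|exact: l2_cintegM..].
by apply: eq_cint => w _; rewrite mulrDr.
Qed.

Lemma pairingZ c (k : RM -> C) : l2 k -> pair (fun w => c * k w) = c * pair k.
Proof.
move=> k2; rewrite /pairing big_distrr/=; apply: eq_bigr => i _.
rewrite big_distrr/=; apply: eq_bigr => j _; rewrite mulrCA; congr (_ * _).
rewrite -cintZ//; last exact: l2_cintegM.
by apply: eq_cint => w _; rewrite mulrCA.
Qed.

Lemma pi2_neq0 : - (2 * pi)%:C != 0 :> C.
Proof.
rewrite oppr_eq0 -normc_eq0 normc_real normr_eq0.
by rewrite mulf_neq0 ?pnatr_eq0// gt_eqF// pi_gt0.
Qed.

Lemma pairing_difference p q : 0 < re p -> 0 < re q -> p != q ->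
  pair (fun w => rk p w * rk q w) =
  - (2 * pi)%:C / (p - q) * \sum_i \sum_j (m i j)%:C * (g i j p - g i j q).
Proof.
move=> p0 q0 pq; rewrite /pairing big_distrr/=; apply: eq_bigr => i _.
rewrite big_distrr/=; apply: eq_bigr => j _.
rewrite (reproduces_difference (g02 i j) (@g0rep i j) p0 q0 pq).
by rewrite mulrCA -mulrA; congr (_ * _); rewrite [RHS]mulrCA; congr (_ * _); rewrite mulrC.
Qed.

Lemma pairing_difference_eq0 p q : 0 < re p -> 0 < re q -> p != q ->
  pair (fun w => rk p w * rk q w) = 0 ->
  \sum_i \sum_j (m i j)%:C * (g i j p - g i j q) = 0.
Proof.
move=> p0 q0 pq; rewrite pairing_difference//.
have c0 : - (2 * pi)%:C / (p - q) != 0.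
  by apply: mulf_neq0; rewrite ?pi2_neq0// invr_neq0// subr_eq0.
by move=> /eqP; rewrite mulf_eq0 (negbTE c0) => /eqP.
Qed.

Lemma pairing_derivative p (L : 'I_no -> 'I_ni -> C) : 0 < re p ->
  (forall i j, cdiff (g i j) p (L i j)) -> pair (fun w => rk p w * rk p w) = 0 ->
  \sum_i \sum_j (m i j)%:C * L i j = 0.
Proof.
move=> p0 gL.
have -> : pair (fun w => rk p w * rk p w) = - (2 * pi)%:C *
    \sum_i \sum_j (m i j)%:C * L i j.
  rewrite /pairing big_distrr/=; apply: eq_bigr => i _.
  rewrite big_distrr/=; apply: eq_bigr => j _.
  by rewrite (reproduces_derivative (g02 i j) (@g0rep i j) p0 (gL i j)) mulrCA.
by move=> /eqP; rewrite mulf_eq0 (negbTE pi2_neq0) => /eqP.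
Qed.

(* From [(p - q) rk p rk q = rk p - rk q], multiplied by [rk p]: the square
   [rk p ^ 2] is a combination of [rk p rk q] and [rk p ^ 2 rk q], and the
   latter equals [(i w - q) (rk p rk q) ^ 2]. *)
Lemma pairing_square p q : re p != 0 -> re q != 0 ->
  pair (fun w => rk p w * rk q w) = 0 ->
  pair (fun w => (rk p w * rk q w) ^+ 2) = 0 ->
  pair (fun w => (0 +i* w) * (rk p w * rk q w) ^+ 2) = 0 ->
  pair (fun w => rk p w * rk p w) = 0.
Proof.
move=> p0 q0 h1 h2 h3.
have lq := l2_rk q0; have lp := l2_rk p0.
have l1 : l2 (fun w => rk p w * rk q w) by exact: l2_rkM.
have l2' : l2 (fun w => (rk p w * rk q w) ^+ 2).
  have := l2_rkM p0 (l2_rkM q0 l1); congr l2; apply/funext => w; ring.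
have l3 : l2 (fun w => (0 +i* w) * (rk p w * rk q w) ^+ 2).
  have := l2D (l2_rkM p0 l1) (l2Z q l2'); congr l2; apply/funext => w.
  have := rk_neq0 w p0; have := rk_neq0 w q0; rewrite /rk => wq wp.
  by field; rewrite wq wp.
have -> : pair (fun w => rk p w * rk p w) = pair (fun w => rk p w * rk q w +
    ((p - q) * ((0 +i* w) * (rk p w * rk q w) ^+ 2) +
      - ((p - q) * q) * (rk p w * rk q w) ^+ 2)).
  congr pairing; apply/funext => w.
  have := rk_neq0 w p0; have := rk_neq0 w q0; rewrite /rk => wq wp.
  by field; rewrite wq wp.
rewrite pairingD//; last by apply: l2D; exact: l2Z.
rewrite pairingD; [|exact: l2Z..].
by rewrite !pairingZ// h1 h2 h3 !mulr0 !addr0.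
Qed.

End Interpolation.

(** * Interpolation conditions for an optimal model *)

Section Optimality.
Variables (R : realType) (no ni r : nat).
Local Notation C := R[i].
Local Notation nc := (@Normc.normc R).
Local Notation re := (@complex.Re R).
Local Notation im := (@complex.Im R).
Local Notation mu := (@lebesgue_measure R).
Local Notation RM := (measurableTypeR R).
Variables (H : C -> 'M[C]_(no, ni)) (S : so_model R no ni r).
Hypotheses (H_hardy : hardy2 H) (H_real : real_symmetric H).
Hypothesis S_opt : h2_optimal H (@Sigma_DSO R no ni r) S.
Variables lp lm : 'rV[C]_r.
Hypothesis E_eq : map_mx (real_complex R) (so_E S) = - (diag_mx lp + diag_mx lm).
Hypothesis K_eq : map_mx (real_complex R) (so_K S) = diag_mx lp *m diag_mx lm.
Hypothesis lp_lm : forall i, lp 0 i <> lm 0 i.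

Lemma den_factor k s : den S k s = (s - lp 0 k) * (s - lm 0 k).
Proof.
have := congr1 (fun A : 'M[C]_r => A k k) E_eq.
have := congr1 (fun A : 'M[C]_r => A k k) K_eq.
rewrite mul_diag_mx !mxE eqxx !mulr1n /den => -> ->; ring.
Qed.

Lemma re_pole k : re (lp 0 k) < 0 /\ re (lm 0 k) < 0.
Proof.
have [SS _] := S_opt; have h s : den S k s = 0 -> re s < 0.
  move=> s0; rewrite ltNge; apply/negP => rs.
  by have := Sigma_DSO_den k SS rs; rewrite s0 eqxx.
by split; apply: h; rewrite den_factor subrr ?mulr0 ?mul0r.
Qed.

Lemma so_E_gt0 k : 0 < so_E S k k.
Proof.
have [p0 m0] := re_pole k; have := congr1 (fun A : 'M[C]_r => re (A k k)) E_eq.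
by rewrite !mxE eqxx !mulr1n ReN ReD /= => ->; lra.
Qed.

(** As E is real, the two poles have opposite imaginary parts [b] and [- b]; the entry of K is then
    the product of their negative real parts plus [b ^ 2]. *)
Lemma so_K_gt0 k : 0 < so_K S k k.
Proof.
have [p0 m0] := re_pole k; have := congr1 (fun A : 'M[C]_r => A k k) E_eq.
have := congr1 (fun A : 'M[C]_r => A k k) K_eq.
rewrite mul_diag_mx !mxE eqxx !mulr1n.
case: (lp 0 k) (lm 0 k) p0 m0 => a b [c d] /= a0 c0 KE EE.
have := congr1 im EE; have := congr1 re KE; rewrite /= => -> bd.
have -> : d = - b by lra.
by have := sqr_ge0 b; nra.
Qed.

Let g i j z : C := H z i j - so_entry S i j z.

Lemma cdiff_H z i j : 0 < re z -> cdiff (fun s => H s i j) z (mx_derive H z i j).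
Proof.
by move=> z0; rewrite mxE; apply: cdiff_derivable; exact: H_hardy.1.
Qed.

Lemma is_hardy_H i j : is_hardy (fun z => H z i j).
Proof.
have [M HM] := H_hardy.2; exists M; split.
  by move=> z z0; eexists; exact: cdiff_H.
move=> x x0; apply: le_trans (HM x x0).
have mH i' j' : cmeas setT (fun w : RM => H (x +i* w) i' j').
  apply: (@cmeas_hardy _ (fun z => H z i' j')) => // z z0.
  by eexists; exact: cdiff_H.
apply: ge0_le_integral => //=.
- by move=> w _; rewrite lee_fin sqr_ge0.
- by apply/measurable_EFinP; exact: measurable_sqr_normc.
- under eq_fun do rewrite sqr_frobenius.
  apply/measurable_EFinP; apply: measurable_sum => i'.
  by apply: measurable_sum => j'; exact: measurable_sqr_normc.
- move=> w _; rewrite lee_fin sqr_frobenius (bigD1 i)//= (bigD1 j)//=.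
  rewrite -addrA lerDl addr_ge0//.
    by apply: sumr_ge0 => j' _; exact: sqr_ge0.
  by apply: sumr_ge0 => i' _; apply: sumr_ge0 => j' _; exact: sqr_ge0.
Qed.

Lemma is_hardy_so_entry i j : is_hardy (so_entry S i j).
Proof.
apply: is_hardy_sum => k; apply: is_hardyZ; have [p0 m0] := re_pole k.
apply: is_hardy_eq (is_hardy_rational p0 m0) => z _.
by rewrite den_factor.
Qed.

(** The disc of radius [re z] around [z] stays in the right half-plane, where [so_tf] and [so_entry]
    agree, so they have the same derivative at [z]. *)
Lemma cdiff_so_entry z i j : 0 < re z ->
  cdiff (so_entry S i j) z (mx_derive (so_tf S) z i j).
Proof.
move=> z0; have [SS _] := S_opt; have [M [hd _]] := is_hardy_so_entry i j.
have [L hL] := hd z z0; apply: cdiff_eq (hL) _; apply/esym; rewrite mxE.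
apply: cdiff_derive1; apply: (near_eq_cdiff z0 _ hL) => w wz.
rewrite so_tf_entry//; have := le_lt_trans (ler_Re_normc _) wz.
by rewrite ReD ReN ltr_norml => /andP[h _]; lra.
Qed.

Lemma is_hardy_error i j : is_hardy (g i j).
Proof.
apply: is_hardy_eq (is_hardyD (is_hardy_H i j) (is_hardyZ (-1) (is_hardy_so_entry i j))).
by move=> z _; rewrite mulN1r.
Qed.

Lemma error_boundary : exists g0 : 'I_no -> 'I_ni -> RM -> C, [/\
  forall i j, l2 (g0 i j), forall i j, reproduces (g0 i j) (g i j),
  {ae mu, forall w : RM, forall i j, forall e, 0 < e ->
    exists2 d, 0 < d & forall x, 0 < x -> x < d -> nc (g i j (x +i* w) - g0 i j w) < e} &
  forall i j (k : RM -> C), l2 k -> (forall t, k (- t) = conjc (k t)) ->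
    im (cint setT (fun t => g0 i j t * k t)) = 0].
Proof.
pose P (ij : 'I_no * 'I_ni) (f0 : RM -> C) := [/\ l2 f0, reproduces f0 (g ij.1 ij.2),
  {ae mu, forall w : RM, forall e, 0 < e -> exists2 d, 0 < d &
      forall x, 0 < x -> x < d -> nc (g ij.1 ij.2 (x +i* w) - f0 w) < e} &
  forall k : RM -> C, l2 k -> (forall t, k (- t) = conjc (k t)) ->
      im (cint setT (fun t => f0 t * k t)) = 0].
have /choice[g0 g0P] : forall ij, exists f0, P ij f0.
  move=> [i j]; have [M gM] := is_hardy_error i j.
  apply: (hardy_boundary gM) => z z0; rewrite /g so_entry_conj.
  have -> : H (conjc z) i j = conjc (H z i j) by rewrite (H_real z0) mxE.
  by case: (H z i j) (so_entry _ _ _ _) => x y [x' y']; apply: eq_ReIm => /=; ring.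
exists (fun i j => g0 (i, j)); split.
- by move=> i j; have [] := g0P (i, j).
- by move=> i j; have [] := g0P (i, j).
- apply: (@filter_forall RM _ (fun i w => forall j e, 0 < e ->
    exists2 d, 0 < d & forall x, 0 < x -> x < d ->
      nc (g i j (x +i* w) - g0 (i, j) w) < e) _ (ae_filter_ringOfSetsType mu)) => i.
  apply: (@filter_forall RM _ (fun j w => forall e, 0 < e ->
    exists2 d, 0 < d & forall x, 0 < x -> x < d ->
      nc (g i j (x +i* w) - g0 (i, j) w) < e) _ (ae_filter_ringOfSetsType mu)) => j.
  by have [] := g0P (i, j).
- by move=> i j; have [_ _ _] := g0P (i, j).
Qed.

Lemma optimality_conditions k :
  let p := - conjc (lp 0 k) in let q := - conjc (lm 0 k) in
  [/\ forall i, \sum_j (so_B S k j)%:C * (g i j p - g i j q) = 0,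
      forall j, \sum_i (so_C S i k)%:C * (g i j p - g i j q) = 0,
      \sum_i \sum_j (so_C S i k * so_B S k j)%:C *
        (mx_derive H p i j - mx_derive (so_tf S) p i j) = 0 &
      \sum_i \sum_j (so_C S i k * so_B S k j)%:C *
        (mx_derive H q i j - mx_derive (so_tf S) q i j) = 0].
Proof.
move=> p q; have [a0 b0] := re_pole k; have dE := den_factor k.
have p0 : 0 < re p by rewrite /p ReN ReJ; lra.
have q0 : 0 < re q by rewrite /q ReN ReJ; lra.
have p1 : re p != 0 by rewrite gt_eqF.
have q1 : re q != 0 by rewrite gt_eqF.
have pq : p != q.
  apply/eqP => /oppr_inj /(congr1 (@conjc R)); rewrite !conjcK.
  exact: lp_lm.
have [g0 [g02 g0rep g0lim g0sym]] := error_boundary.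
have psiE w : conjc (den S k (0 +i* w))^-1 = rk p w * rk q w.
  rewrite dE conjc_inv conjcM -[RHS]invfM; congr (_^-1).
  rewrite (_ : conjc ((0 +i* w) - lp 0 k) = - ((0 +i* w) - p)); last first.
    by rewrite /p; case: (lp 0 k) => x y; apply: eq_ReIm => /=; ring.
  rewrite (_ : conjc ((0 +i* w) - lm 0 k) = - ((0 +i* w) - q)); last first.
    by rewrite /q; case: (lm 0 k) => x y; apply: eq_ReIm => /=; ring.
  by rewrite mulrNN.
have psi_fun : (fun w => conjc (den S k (0 +i* w))^-1) = fun w => rk p w * rk q w.
  by apply/funext.
(* Varying the entry [(k, j)] of B leaves column [k] of C as the weight, hence the condition with
   [c_k] on the left; varying C gives the one with [b_k] on the right. *)
have hB j : \sum_i (so_C S i k)%:C * (g i j p - g i j q) = 0.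
  have := stationarity_B g02 g0lim S_opt g0sym a0 b0 dE j.
  rewrite psi_fun => /(pairing_difference_eq0 g02 g0rep p0 q0 pq) h0.
  rewrite -[RHS]h0.
  apply: eq_bigr => i _; rewrite (bigD1 j)//= eqxx mulr1 big1 ?addr0// => j' /negbTE jj.
  by rewrite jj mulr0 mul0r.
have EK := stationarity_EK g02 g0lim S_opt g0sym a0 b0 dE so_E_gt0 so_K_gt0.
set m := fun i j => so_C S i k * so_B S k j in EK.
have cdg z : 0 < re z -> forall i j, cdiff (g i j) z
    (mx_derive H z i j - mx_derive (so_tf S) z i j).
  by move=> z0 i j; apply: cdiffB; [exact: cdiff_H|exact: cdiff_so_entry].
(* Not a new variation: it is the combination of the conditions [hB] with coefficients
   [so_B S k j]. *)
have h1 : pairing g0 m (fun w => rk p w * rk q w) = 0.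
  rewrite (pairing_difference g02 g0rep)// exchange_big/= big1 ?mulr0// => j _.
  transitivity ((so_B S k j)%:C * \sum_i (so_C S i k)%:C * (g i j p - g i j q)).
    rewrite big_distrr/=; apply: eq_bigr => i _.
    by rewrite /m rmorphM/=; ring.
  by rewrite hB mulr0.
(* The variation of K, with [be = -1] to absorb the sign of the derivative of [1 / q_k]. *)
have h2 : pairing g0 m (fun w => (rk p w * rk q w) ^+ 2) = 0.
  rewrite -[RHS](EK 0 (-1)); congr pairing; apply/funext => w.
  rewrite !conjcM psiE -expr2 (_ : conjc _ = 1) ?mul1r//.
  by apply: eq_ReIm => /=; ring.
(* The variation of E; here the sign is absorbed by conjugation, as [conj (- i w) = i w]. *)
have h3 : pairing g0 m (fun w => (0 +i* w) * (rk p w * rk q w) ^+ 2) = 0.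
  rewrite -[RHS](EK 1 0); congr pairing; apply/funext => w.
  rewrite !conjcM psiE -expr2 (_ : conjc _ = 0 +i* w)//.
  by apply: eq_ReIm => /=; ring.
split => //.
- move=> i; have := stationarity_C g02 g0lim S_opt g0sym a0 b0 dE i.
  rewrite psi_fun => /(pairing_difference_eq0 g02 g0rep p0 q0 pq) h0.
  rewrite -[RHS]h0 [RHS](bigD1 i)//= [X in _ = _ + X]big1 ?addr0; last first.
    by move=> i' /negbTE ii; apply: big1 => j _; rewrite ii !mul0r.
  by apply: eq_bigr => j _; rewrite eqxx mul1r.
- apply: (pairing_derivative g02 g0rep p0 (cdg p p0)).
  exact: (pairing_square g02 p1 q1).
- apply: (pairing_derivative g02 g0rep q0 (cdg q q0)).
  have swap (F : RM -> C -> C) :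
      (fun w => F w (rk q w * rk p w)) = (fun w => F w (rk p w * rk q w)).
    by apply/funext => w; rewrite mulrC.
  by apply: (pairing_square g02 q1 p1); rewrite (swap (fun _ x => x))
    || rewrite (swap (fun _ x => x ^+ 2)) || rewrite (swap (fun w x => (0 +i* w) * x ^+ 2)).
Qed.

End Optimality.

Theorem theorem4p1 (R : realType) (no ni r : nat)
    (no_gt0 : (0 < no)%N) (ni_gt0 : (0 < ni)%N) (r_gt0 : (0 < r)%N)
    (H : R[i] -> 'M[R[i]]_(no, ni))
    (H_hardy : hardy2 H) (H_real : real_symmetric H)
    (S : so_model R no ni r)
    (S_opt : h2_optimal H (@Sigma_DSO R no ni r) S)
    (lp lm : 'rV[R[i]]_r)
    (E_eq : map_mx (real_complex R) (so_E S) = - (diag_mx lp + diag_mx lm))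
    (K_eq : map_mx (real_complex R) (so_K S) = diag_mx lp *m diag_mx lm)
    (lp_inj : forall i j, i <> j -> lp 0 i <> lp 0 j)
    (lm_inj : forall i j, i <> j -> lm 0 i <> lm 0 j)
    (lp_lm : forall i j, lp 0 i <> lm 0 j) :
  (forall s : R[i], ~ so_eigenvalue S s ->
     so_tf S s =
       \sum_(i < r) ((s - lp 0 i) * (s - lm 0 i))^-1 *:
         (so_c S i *m (so_b S i)^T)) /\
  (forall i : 'I_r,
     [/\ (H (- (lp 0 i)^*) - H (- (lm 0 i)^*)) *m so_b S i =
         (so_tf S (- (lp 0 i)^*) - so_tf S (- (lm 0 i)^*)) *m so_b S i,
         (so_c S i)^T *m (H (- (lp 0 i)^*) - H (- (lm 0 i)^*)) =
         (so_c S i)^T *m (so_tf S (- (lp 0 i)^*) - so_tf S (- (lm 0 i)^*)),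
         (so_c S i)^T *m mx_derive H (- (lp 0 i)^*) *m so_b S i =
         (so_c S i)^T *m mx_derive (so_tf S) (- (lp 0 i)^*) *m so_b S i &
         (so_c S i)^T *m mx_derive H (- (lm 0 i)^*) *m so_b S i =
         (so_c S i)^T *m mx_derive (so_tf S) (- (lm 0 i)^*) *m so_b S i]).
Proof.
have [SS _] := S_opt; have [dE dK _] := SS.
have lpm i : lp 0 i <> lm 0 i by exact: lp_lm.
have bE k j : so_b S k j 0 = (so_B S k j)%:C.
  rewrite !mxE (bigD1 k)//= big1 ?addr0 => [|l lk]; rewrite !mxE ?eqxx ?mulr1//.
  by rewrite (negbTE lk) mulr0.
have cE k i : so_c S k i 0 = (so_C S i k)%:C.
  rewrite !mxE (bigD1 k)//= big1 ?addr0 => [|l lk]; rewrite !mxE ?eqxx ?mulr1//.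
  by rewrite (negbTE lk) mulr0.
split=> [s eigs|k].
  apply/matrixP => i j; rewrite so_tfE//.
    rewrite summxE; apply: eq_bigr => k _; rewrite !mxE big_ord1 cE mxE bE.
    by rewrite (den_factor E_eq K_eq) rmorphM/= mulrC.
  move=> k; apply/eqP => k0; apply: eigs.
  by apply/so_eigenvalue_den => //; exists k.
have [a0 b0] := re_pole S_opt E_eq K_eq k.
have := optimality_conditions H_hardy H_real S_opt E_eq K_eq lpm k.
change ((lp 0 k)^*) with (conjc (lp 0 k)); change ((lm 0 k)^*) with (conjc (lm 0 k)).
set p := - conjc (lp 0 k); set q := - conjc (lm 0 k) => /= -[hC hB hp hq].
have tfE s i j : 0 < complex.Re s -> so_tf S s i j = so_entry S i j s.
  by move=> s0; apply: so_tf_entry => //; exact: ltW.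
have p0 : 0 < complex.Re p by rewrite /p ReN ReJ; lra.
have q0 : 0 < complex.Re q by rewrite /q ReN ReJ; lra.
(* Turns the bitangential conditions on derivatives, which are equations between 1 x 1 matrices,
   into the double sums [hp] and [hq]. *)
have triple (M : 'M[R[i]]_(no, ni)) : (so_c S k)^T *m M *m so_b S k =
    (\sum_i \sum_j (so_C S i k * so_B S k j)%:C * M i j)%:M.
  apply/matrixP => x y; rewrite !ord1 exchange_big !mxE mulr1n; apply: eq_bigr => j _.
  rewrite mxE big_distrl/=; apply: eq_bigr => i _.
  by rewrite mxE cE bE rmorphM/= mulrAC.
have sub4 (A B A' B' : 'M[R[i]]_(no, ni)) x y :
    (A - B - (A' - B')) x y = A x y - A' x y - (B x y - B' x y).
  by rewrite !mxE; ring.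
have sub2 (A B : 'M[R[i]]_(no, ni)) x y : (A - B) x y = A x y - B x y by rewrite !mxE.
split; apply/eqP; rewrite -subr_eq0.
- rewrite -mulmxBl; apply/eqP/matrixP => i y; rewrite ord1 mxE [RHS]mxE -[RHS](hC i).
  by apply: eq_bigr => j _; rewrite bE sub4 mulrC !tfE.
- rewrite -mulmxBr; apply/eqP/matrixP => x j; rewrite ord1 mxE [RHS]mxE -[RHS](hB j).
  by apply: eq_bigr => i _; rewrite mxE cE sub4 !tfE.
- rewrite -mulmxBl -mulmxBr triple; apply/eqP.
  rewrite (_ : \sum_i _ = 0) ?raddf0// -[RHS]hp.
  by apply: eq_bigr => i _; apply: eq_bigr => j _; rewrite sub2.
- rewrite -mulmxBl -mulmxBr triple; apply/eqP.
  rewrite (_ : \sum_i _ = 0) ?raddf0// -[RHS]hq.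
  by apply: eq_bigr => i _; apply: eq_bigr => j _; rewrite sub2.
Qed.
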